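(* Let $p$ be a prime, $m\in\mathbb{N}_0=\mathbb{N}\cup\{0\}$ and let $k\geq 2$ be an even integer. If $f(z)\in\mathcal{P}_k(p^m)$, then $$\sum_{r\in R(p^m)} v_r(f) < \begin{cases} 1 & \text{if } p^m=1,\\ 4 & \text{if } p^m=4,\\ p^{[(m-1)/2]}\left(p^{(m-1)-2[(m-1)/2]}+1\right) & \text{if } p^m\neq 1 \text{ or } 4.\end{cases}$$
   Context: Let $z$ be in the complex upper half-plane and $q=e^{2\pi i z}$. For an even integer $k\geq 2$, the Eisenstein series is normalized as $E_k(z)=-\frac{B_k}{2k}+\sum_{n\geq1}\sigma_{k-1}(n)q^n$, where $B_k$ is the $k$-th Bernoulli number and $\sigma_{k-1}(n)=\sum_{0<d\mid n}d^{k-1}$. For a positive integer $N$ define the $\mathbb{Q}$-vector spaces $\mathcal{E}_2(N)=\langle E_2(z)-dE_2(dz) : 1<d\mid N\rangle_{\mathbb{Q}}$ and, for $k\geq 4$ even, $\mathcal{E}_k(N)=\langle E_k(dz): 1\leq d\mid N\rangle_{\mathbb{Q}}$; these are subspaces of the space of modular forms of weight $k$ for $\Gamma_0(N)$. Define $\mathcal{O}_k(N)=\bigcup_{1<d\mid N}\big(\mathcal{E}_k(N/d)\cup\{f(dz): f(z)\in\mathcal{E}_k(N/d)\}\big)$ and $\mathcal{P}_k(N)=\mathcal{E}_k(N)\setminus\mathcal{O}_k(N)$. $R(N)$ denotes a complete set of inequivalent cusps of $\Gamma_0(N)$, and for a cusp $r$, $v_r(f)$ denotes the order of vanishing of $f$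 at $r$ (measured in the local uniformizer at $r$ for $\Gamma_0(N)$). $[x]$ denotes the integer part of $x$. *)

(* Defs.v *)
From HB Require Import structures.
From mathcomp Require Import all_boot all_order all_algebra.
From mathcomp Require Import complex.
From mathcomp Require Import all_classical all_reals all_analysis.

Set Implicit Arguments.
Unset Strict Implicit.
Unset Printing Implicit Defensive.

Import Order.TTheory GRing.Theory Num.Theory.
Import numFieldNormedType.Exports.

Local Open Scope classical_set_scope.
Local Open Scope ring_scope.

(* [:: B_0; ...; B_(n-1)], from \sum_(j <= n) 'C(n+1, j) B_j = [n = 0]. *)
Fixpoint bernoulli_seq (n : nat) : seq rat :=
  if n is n'.+1 then
    let s := bernoulli_seq n' in
    rcons s (((n' == 0%N)%:R - \sum_(j < n') 'C(n'.+1, j)%:R * s`_j) / n'.+1%:R)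
  else [::].

Definition bernoulli_number (n : nat) : rat := (bernoulli_seq n.+1)`_n.

Definition sigma (j n : nat) : nat := (\sum_(d <- divisors n) d ^ j)%N.

(* Functions on the upper half-plane are total functions R[i] -> R[i] of which
   only the restriction to this set matters. *)
Definition upper_half_plane (R : realType) : set R[i] :=
  [set z | 0 < complex.Im z].

Definition cexp (R : realType) (z : R[i]) : R[i] :=
  (expR (complex.Re z))%:C%C * (cos (complex.Im z) +i* sin (complex.Im z))%C.

(* e^(2 pi i z) *)
Definition nome (R : realType) (z : R[i]) : R[i] :=
  cexp ((2 * pi)%:C%C * 'i%C * z).

Definition eisenstein (R : realType) (k : nat) (z : R[i]) : R[i] :=
  - ratr (bernoulli_number k / (2 * k)%:R)
  + limn (series (fun n : nat => (sigma k.-1 n.+1)%:R * nome z ^+ n.+1)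
          : nat -> R[i]^o).

Definition rat_span (R : realType) (s : seq nat) (g : nat -> R[i] -> R[i]) :
    set (R[i] -> R[i]) :=
  [set f | exists c : nat -> rat, forall z, upper_half_plane z ->
     f z = \sum_(d <- s) ratr (c d) * g d z].

Definition eis_space (R : realType) (k N : nat) : set (R[i] -> R[i]) :=
  if k == 2%N then
    rat_span [seq d <- divisors N | (1 < d)%N]
      (fun d z => eisenstein 2 z - d%:R * eisenstein 2 (d%:R * z))
  else rat_span (divisors N) (fun d z => eisenstein k (d%:R * z)).

Definition old_eis (R : realType) (k N : nat) : set (R[i] -> R[i]) :=
  [set f | exists d : nat, [/\ (1 < d)%N, (d %| N)%N &
     eis_space k (N %/ d) f \/
     exists2 g, eis_space k (N %/ d) g &
       forall z, upper_half_plane z -> f z = g (d%:R * z)]].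

Definition prim_eis (R : realType) (k N : nat) : set (R[i] -> R[i]) :=
  @eis_space R k N `\` @old_eis R k N.

Definition SL2Z : set 'M[int]_2 := [set g | \det g = 1].

Definition Gamma0 (N : nat) : set 'M[int]_2 :=
  [set g | SL2Z g /\ (N%:Z %| g 1%R 0%R)%Z].

(* P^1(Q), with None as the point at infinity. *)
Definition cusp : Type := option rat.

Definition cusp_act (g : 'M[int]_2) (r : cusp) : cusp :=
  match r with
  | None => if g 1 0 == 0 then None else Some ((g 0 0)%:~R / (g 1 0)%:~R)
  | Some x =>
      if (g 1 0)%:~R * x + (g 1 1)%:~R == 0 then None
      else Some (((g 0 0)%:~R * x + (g 0 1)%:~R) /
                 ((g 1 0)%:~R * x + (g 1 1)%:~R))
  end.

Definition cusp_equiv (N : nat) (r s : cusp) : Prop :=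
  exists2 g, Gamma0 N g & cusp_act g r = s.

(* The entries of rs form a complete set of inequivalent cusps of Gamma0 N. *)
Definition cusp_representatives (N : nat) (rs : seq cusp) : Prop :=
  [/\ uniq rs,
      forall r s, r \in rs -> s \in rs -> cusp_equiv N r s -> r = s &
      forall r, exists2 s, s \in rs & cusp_equiv N r s].

Definition translation (h : nat) : 'M[int]_2 := 1%:M + h%:Z *: delta_mx 0 1.

(* h is the width of the cusp g(oo) for Gamma0 N; since - 1 lies in Gamma0 N,
   no sign needs to be allowed in front of the translation. *)
Definition cusp_width (N : nat) (g : 'M[int]_2) (h : nat) : Prop :=
  let stab j := (0 < j)%N /\ Gamma0 N (g *m translation j *m invmx g) in
  stab h /\ forall j, stab j -> (h <= j)%N.

(* The weight k action (f|_k g)(z) = (c z + d)^-k f((a z + b) / (c z + d)). *)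
Definition slash (R : realType) (k : nat) (f : R[i] -> R[i]) (g : 'M[int]_2)
    (z : R[i]) : R[i] :=
  let j := (g 1 0)%:~R * z + (g 1 1)%:~R in
  j ^- k * f (((g 0 0)%:~R * z + (g 0 1)%:~R) / j).

(* f|_k g = \sum_n a_n q_h^n on the upper half-plane, where q_h(z) =
   e^(2 pi i z / h) and h is the width of the cusp g(oo). *)
Definition cusp_expansion (R : realType) (N k : nat) (f : R[i] -> R[i])
    (g : 'M[int]_2) (a : nat -> R[i]) : Prop :=
  exists2 h, cusp_width N g h &
    forall z, upper_half_plane z ->
      (series (fun n : nat => a n * nome (z / h%:R) ^+ n) : nat -> R[i]^o)
        @ \oo --> (slash k f g z : R[i]^o).

(* Order of vanishing at the cusp r = g(oo): the least n with a_n != 0, which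
   does not depend on g. It is +oo when f vanishes identically and also when f
   has no expansion at r. *)
Definition cusp_order (R : realType) (N k : nat) (f : R[i] -> R[i]) (r : cusp) :
    \bar R :=
  ereal_inf [set n%:R%:E | n in [set n : nat | exists g a,
    [/\ SL2Z g, cusp_act g None = r, cusp_expansion N k f g a & a n != 0]]].

Definition order_bound (p m : nat) : nat :=
  (if p ^ m == 1 then 1
   else if p ^ m == 4 then 4
   else p ^ ((m - 1) %/ 2) * (p ^ ((m - 1) - 2 * ((m - 1) %/ 2)) + 1))%N.

(* Main.v *)
Require Import Defs.
From HB Require Import structures.
From mathcomp Require Import all_boot all_order all_algebra.
From mathcomp Require Import complex.
From mathcomp Require Import all_classical all_reals all_analysis.
From mathcomp Require Import ring lra zify.

Set Implicit Arguments.
Unset Strict Implicit.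
Unset Printing Implicit Defensive.

Import Order.TTheory GRing.Theory Num.Theory.
Import numFieldNormedType.Exports ComplexField.Normc.

Local Open Scope classical_set_scope.
Local Open Scope ring_scope.

(** Write f = \sum_i c_i E_k(p^i z) with c_0 and c_m nonzero, since f is neither
    of level p^(m-1) nor of the form g(p z) with g of level p^(m-1). If the
    denominator of a cusp g(oo) has gcd p^e with p^m, then factoring
    diag(p^i, 1) g = g_i [A, B; 0, D] with g_i in SL2(Z) gives
      f|g = \sum_i c_i p^(-k max(i - e, 0)) E_k((A_i z + B_i) / D_i),
    and the coefficient of the local uniformizer is c_m times a unit if 2e < m,
    is c_0 if 2e > m, and is c_0 + c_m p^(-k e) xi, with xi a primitive p^e-th
    root of unity, if 2e = m. Hence every order of vanishing is at most 1 unless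
    p^m = 4. The constant terms for e = m and e = m - 1 differ by a nonzero
    multiple of c_m, so some order is 0, and the bound is the number of cusps.
    When p^m = 4 the coefficients of 1, q, q^2 at the cusp 1/2 are compared.

    Modularity of the q-series E_k is proved from scratch. Lipschitz' formula
    follows by letting M grow in the distribution relation
    H(z) = M^(-k) \sum_(j mod M) H((z + j) / M), H(z) = \sum_r r^(k-1) q^r;
    its k = 1 case is the partial fraction expansion of the cotangent, which
    also identifies the constant term -B_k/2k with a zeta value. Then E_k(-1/z)
    is compared with E_k(z) by interchanging a double sum, absolutely convergent
    for k >= 4; for k = 2 the defect is computed with a telescoping series. *)

Section ComplexModulus.
Context {R : rcfType}.
Implicit Types x y z : R[i].

Lemma complex_ext x y :
  complex.Re x = complex.Re y -> complex.Im x = complex.Im y -> x = y.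
Proof. by case: x y => [a b] [c d] /= -> ->. Qed.

Lemma natr_complex n : n%:R = (n%:R : R)%:C%C.
Proof. by rewrite rmorph_nat. Qed.

Lemma normr_normc z : `|z| = (normc z)%:C%C.
Proof. by []. Qed.

Lemma normcE_sqrt z :
  normc z = Num.sqrt (complex.Re z ^+ 2 + complex.Im z ^+ 2).
Proof. by case: z. Qed.

Lemma normc_ge0 z : 0 <= normc z.
Proof. by rewrite normcE_sqrt sqrtr_ge0. Qed.

Lemma normc_eq0 z : (normc z == 0) = (z == 0).
Proof. by apply/eqP/eqP => [/eq0_normc //|->]; exact: normc0. Qed.

Lemma normc_gt0 z : (0 < normc z) = (z != 0).
Proof. by rewrite lt_def normc_ge0 andbT normc_eq0. Qed.

Lemma normcX z n : normc (z ^+ n) = normc z ^+ n.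
Proof. by elim: n => [|n IHn]; rewrite ?normc1 // !exprS normcM IHn. Qed.

Lemma distcC x y : normc (x - y) = normc (y - x).
Proof. by rewrite -normcN opprB. Qed.

Lemma normc_real (a : R) : normc (a%:C)%C = `|a|.
Proof. by rewrite normcE_sqrt /= expr0n addr0 sqrtr_sqr. Qed.

Lemma normc_nat n : normc (n%:R : R[i]) = n%:R.
Proof. by rewrite natr_complex normc_real normr_nat. Qed.

Lemma ler_Re_normc z : `|complex.Re z| <= normc z.
Proof. by rewrite normcE_sqrt -sqrtr_sqr ler_wsqrtr// lerDl sqr_ge0. Qed.

Lemma ler_Im_normc z : `|complex.Im z| <= normc z.
Proof. by rewrite normcE_sqrt -sqrtr_sqr ler_wsqrtr// lerDr sqr_ge0. Qed.

Lemma ler_normc_ReIm z : normc z <= `|complex.Re z| + `|complex.Im z|.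
Proof.
rewrite normcE_sqrt -(ler_pXn2r (n := 2))// ?nnegrE ?sqrtr_ge0 ?addr_ge0//.
rewrite sqr_sqrtr ?addr_ge0 ?sqr_ge0// sqrrD !real_normK ?num_real//.
by rewrite lerD2r lerDl mulrn_wge0// mulr_ge0.
Qed.

Lemma ler_normc_sum (I : Type) (r : seq I) (F : I -> R[i]) :
  normc (\sum_(i <- r) F i) <= \sum_(i <- r) normc (F i).
Proof.
elim: r => [|i r IHr]; first by rewrite !big_nil normc0.
by rewrite !big_cons (le_trans (le_normcD _ _))// lerD2l.
Qed.

Lemma lerB_normc x y : normc x - normc y <= normc (x - y).
Proof. by rewrite lerBlDr (le_trans _ (le_normcD _ _))// subrK. Qed.

Lemma lt1_normc_neq1 z : normc z < 1 -> 1 - z != 0.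
Proof. by rewrite subr_eq0; apply: contraTneq => <-; rewrite normc1 ltxx. Qed.

End ComplexModulus.

Section RealSeries.
Context {R : realType}.
Implicit Type b : nat -> R.

Lemma series_le_lim b n : (forall i, 0 <= b i) -> cvgn (series b) ->
  series b n <= limn (series b).
Proof.
move=> b0 cvb; apply: nondecreasing_cvgn_le cvb n.
by move=> m n mn; apply: nondecreasing_series.
Qed.

Lemma series_gt0_lim_gt0 b (l : R) : (forall i, 0 < b i) ->
  series b @ \oo --> l -> 0 < l.
Proof.
move=> b0 bl; apply: (lt_le_trans (b0 0%N)).
rewrite -(cvg_lim (@Rhausdorff R) bl).
have -> : b 0%N = series b 1%N by rewrite /series/= big_nat1.
by apply: series_le_lim (cvgP _ bl) => i; exact: ltW.
Qed.

Lemma bounded_series_is_cvg b (B : R) : (forall i, 0 <= b i) ->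
  (forall n, series b n <= B) -> cvgn (series b).
Proof.
move=> b0 bB; apply: nondecreasing_is_cvgn; last by exists B => _ [n _ <-].
by move=> m n mn; apply: nondecreasing_series.
Qed.

Lemma cvg_seriesZ (c : R) b (l : R) : series b @ \oo --> l ->
  series (fun i => c * b i) @ \oo --> c * l.
Proof.
rewrite (_ : series (fun i => c * b i) = fun n => c * series b n).
  exact: cvgMl_tmp.
by apply/funext => n; rewrite /series/= mulr_sumr.
Qed.

End RealSeries.

Section ComplexSequences.
Context {R : realType}.
Implicit Types (u v : nat -> R[i]) (l : R[i]).

(* A one-constructor inductive, so that unification never unfolds the
   neighbourhood filters behind a limit. *)
Variant ccvg (u : nat -> R[i]) (l : R[i]) : Prop :=
  CCvg of (u : nat -> R[i]^o) @ \oo --> (l : R[i]^o).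

Lemma ccvgE u l : ccvg u l -> (u : nat -> R[i]^o) @ \oo --> (l : R[i]^o).
Proof. by case. Qed.

Lemma eq_ccvg u v l : u =1 v -> ccvg u l -> ccvg v l.
Proof. by move=> /funext ->. Qed.

Lemma near_eq_ccvg u v l :
  (\forall n \near \oo, u n = v n) -> ccvg u l -> ccvg v l.
Proof. by move=> uv [ul]; split; apply: cvg_trans ul; exact: near_eq_cvg. Qed.

Lemma ccvg_comp u l (phi : nat -> nat) :
  phi @ \oo --> \oo -> ccvg u l -> ccvg (u \o phi) l.
Proof. by move=> phioo [ul]; split; exact: cvg_comp phioo ul. Qed.

Lemma ccvg_shiftS u l : ccvg (fun n => u n.+1) l <-> ccvg u l.
Proof. by split=> -[ul]; split; move: ul; rewrite (@cvg_shiftS R[i]^o). Qed.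

Lemma ccvg_normcP u l :
  ccvg u l <-> (fun n => normc (l - u n)) @ \oo --> (0 : R).
Proof.
split => [[/cvgrPdist_lt ul]|/cvgrPdist_lt ul].
  apply/cvgrPdist_lt => e e0.
  have /ul : (0 : R[i]) < (e%:C)%C by rewrite ltcR.
  apply: filterS => n; rewrite normr_normc ltcR sub0r normrN.
  by rewrite ger0_norm ?normc_ge0.
split; apply/cvgrPdist_lt => e; rewrite ltcE => /andP[/eqP Ime Ree].
have /ul := Ree; apply: filterS => n.
rewrite sub0r normrN ger0_norm ?normc_ge0//.
by rewrite normr_normc ltcE /= Ime eqxx.
Qed.

Lemma ccvg_ReIm u l :
  (fun n => complex.Re (u n)) @ \oo --> complex.Re l ->
  (fun n => complex.Im (u n)) @ \oo --> complex.Im l ->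
  ccvg u l.
Proof.
move=> /cvgrPdist_lt cvRe /cvgrPdist_lt cvIm.
apply/ccvg_normcP/cvgrPdist_lt => e e0; have e20 : 0 < e / 2 by lra.
near=> n; rewrite sub0r normrN ger0_norm ?normc_ge0//.
apply: (le_lt_trans (ler_normc_ReIm _)).
rewrite (splitr e) ltrD// !raddfB /=.
  by near: n; exact: cvRe.
by near: n; exact: cvIm.
Unshelve. all: by end_near. Qed.

Lemma ccvg_Re u l : ccvg u l ->
  (fun n => complex.Re (u n)) @ \oo --> complex.Re l.
Proof.
move/ccvg_normcP/cvgrPdist_lt => ul; apply/cvgrPdist_lt => e /ul.
apply: filterS => n; rewrite sub0r normrN ger0_norm ?normc_ge0//.
by apply: le_lt_trans; rewrite -raddfB ler_Re_normc.
Qed.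

Lemma ccvg_real (u : nat -> R) (l : R) : u @ \oo --> l ->
  ccvg (fun n => (u n)%:C%C) (l%:C)%C.
Proof. by move=> ul; apply: ccvg_ReIm => //=; exact: cvg_cst. Qed.

Lemma ccvg_unique u l l' : ccvg u l -> ccvg u l' -> l = l'.
Proof.
by move=> [ul] [ul']; exact: (cvg_unique (@norm_hausdorff _ R[i]^o) ul ul').
Qed.

Lemma ccvg_normc_le u l (B : R) :
  (forall n, normc (u n) <= B) -> ccvg u l -> normc l <= B.
Proof.
move=> uB /ccvg_normcP/cvgrPdist_lt ul.
apply/ler_addgt0Pr => e /ul [N _ /(_ N)].
rewrite sub0r normrN ger0_norm ?normc_ge0// => /(_ (leqnn _)) dist_lt_e.
have := lerB_normc l (u N); have := uB N; lra.
Qed.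

Lemma ccvg_bounded u l : ccvg u l ->
  exists2 B : R, 0 < B & forall n, normc (u n) <= B.
Proof.
move=> /ccvg_normcP dist0.
have /cvg_seq_bounded [M [_ distM]] : cvgn (fun n => normc (l - u n)).
  by apply/cvg_ex; exists 0.
have MltS : M < `|M| + 1 by rewrite (le_lt_trans (ler_norm _))// ltrDl.
exists (`|M| + 1 + normc l) => [|n]; first by rewrite ltr_pwDl ?normc_ge0.
have := distM _ MltS n I; rewrite /= ger0_norm ?normc_ge0// => dist_le.
have := lerB_normc (u n) l; rewrite distcC; lra.
Qed.

Lemma ccvg0_normc_le u (b : nat -> R) : (forall n, normc (u n) <= b n) ->
  b @ \oo --> (0 : R) -> ccvg u 0.
Proof.
move=> ub b0; apply/ccvg_normcP.
apply: (@squeeze_cvgr _ _ _ _ (fun=> 0) b); [|exact: cvg_cst|exact: b0].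
by apply: nearW => n; rewrite sub0r normcN normc_ge0 ub.
Qed.

Lemma ccvg_cst l : ccvg (fun=> l) l.
Proof. by split; exact: cvg_cst. Qed.

Lemma ccvgD u v l l' :
  ccvg u l -> ccvg v l' -> ccvg (fun n => u n + v n) (l + l').
Proof. by move=> [ul] [vl]; split; exact: (cvgD ul vl). Qed.

Lemma ccvgB u v l l' :
  ccvg u l -> ccvg v l' -> ccvg (fun n => u n - v n) (l - l').
Proof. by move=> [ul] [vl]; split; exact: (cvgB ul vl). Qed.

Lemma ccvgM u v l l' :
  ccvg u l -> ccvg v l' -> ccvg (fun n => u n * v n) (l * l').
Proof. by move=> [ul] [vl]; split; exact: (cvgM ul vl). Qed.

Lemma ccvgZ (c : R[i]) u l : ccvg u l -> ccvg (fun n => c * u n) (c * l).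
Proof. exact/ccvgM/ccvg_cst. Qed.

Lemma ccvgV u l : l != 0 -> ccvg u l -> ccvg (fun n => (u n)^-1) l^-1.
Proof. by move=> l0 [ul]; split; exact: (cvgV l0 ul). Qed.

Lemma ccvgX u l k : ccvg u l -> ccvg (fun n => u n ^+ k) (l ^+ k).
Proof.
move=> ul; elim: k => [|k IHk]; first exact: ccvg_cst.
by rewrite exprS; apply: eq_ccvg (ccvgM ul IHk) => n; rewrite exprS.
Qed.

Lemma ccvg_sum (I : Type) (r : seq I) (F : I -> nat -> R[i]) (L : I -> R[i]) :
  (forall i, ccvg (F i) (L i)) ->
  ccvg (fun n => \sum_(i <- r) F i n) (\sum_(i <- r) L i).
Proof.
move=> FL; elim: r => [|i r IHr].
  by rewrite big_nil; apply: eq_ccvg (ccvg_cst 0) => n; rewrite big_nil.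
by rewrite big_cons; apply: eq_ccvg (ccvgD (FL i) IHr) => n; rewrite big_cons.
Qed.

Lemma ccvg_horner (P : {poly R[i]}) u l : ccvg u l ->
  ccvg (fun n => P.[u n]) P.[l].
Proof.
move=> ul; rewrite horner_coef.
apply: (@eq_ccvg (fun n => \sum_(i < size P) P`_i * u n ^+ i)) => [n|].
  by rewrite horner_coef.
by apply: ccvg_sum => i; apply: ccvgZ; exact: ccvgX.
Qed.

End ComplexSequences.

Section ComplexSeries.
Context {R : realType}.
Implicit Types (a : nat -> R[i]) (b : nat -> R) (s t : R[i]).

Definition csum a s : Prop := ccvg (series a) s.

Lemma csum_unique a s t : csum a s -> csum a t -> s = t.
Proof. exact: ccvg_unique. Qed.

Lemma csum_lim a s : csum a s -> limn (series a : nat -> R[i]^o) = s.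
Proof. by case=> a_s; exact: (cvg_lim (@norm_hausdorff _ R[i]^o) a_s). Qed.

Lemma eq_csum a a' s : a =1 a' -> csum a s -> csum a' s.
Proof. by move=> /funext ->. Qed.

Lemma csumD a a' s s' :
  csum a s -> csum a' s' -> csum (fun n => a n + a' n) (s + s').
Proof. by move=> a_s a_s'; rewrite /csum [series _]seriesD; exact: ccvgD. Qed.

Lemma csumZ (c : R[i]) a s : csum a s -> csum (fun n => c * a n) (c * s).
Proof.
move=> a_s; apply: eq_ccvg (ccvgZ c a_s) => n.
by rewrite /series /= mulr_sumr.
Qed.

Lemma csumN a s : csum a s -> csum (fun n => - a n) (- s).
Proof.
by move=> /(csumZ (-1)); rewrite mulN1r; apply: eq_csum => n; rewrite mulN1r.
Qed.

Lemma csumB a a' s s' :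
  csum a s -> csum a' s' -> csum (fun n => a n - a' n) (s - s').
Proof. by move=> a_s /csumN; exact: csumD. Qed.

Lemma csum0 : csum (fun=> 0) 0.
Proof. by apply: eq_ccvg (ccvg_cst 0) => n; rewrite /series/= big1. Qed.

Lemma csum_sum (I : eqType) (r : seq I) (F : I -> nat -> R[i]) (S : I -> R[i]) :
  (forall i, i \in r -> csum (F i) (S i)) ->
  csum (fun n => \sum_(i <- r) F i n) (\sum_(i <- r) S i).
Proof.
elim: r => [|i r IHr] FS.
  by rewrite big_nil; apply: eq_csum csum0 => n; rewrite big_nil.
rewrite big_cons; apply: (@eq_csum (fun n => F i n + \sum_(i <- r) F i n)).
  by move=> n; rewrite big_cons.
apply: csumD; first by apply: FS; rewrite mem_head.
by apply: IHr => j jr; apply: FS; rewrite in_cons jr orbT.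
Qed.

Lemma csum_recl a s : csum (fun n => a n.+1) s -> csum a (a 0%N + s).
Proof.
move=> a_s; apply/ccvg_shiftS; apply: eq_ccvg (ccvgD (ccvg_cst (a 0%N)) a_s).
by move=> n; rewrite /series/= big_nat_recl.
Qed.

Lemma csum_behead a s : csum a s -> csum (fun n => a n.+1) (s - a 0%N).
Proof.
move=> /(ccvg_shiftS _ _).2 a_s.
apply: eq_ccvg (ccvgB a_s (ccvg_cst (a 0%N))) => n.
by rewrite /series/= big_nat_recl// addrAC subrr add0r.
Qed.

Lemma csum_finite a n : (forall i, (n <= i)%N -> a i = 0) ->
  csum a (\sum_(0 <= i < n) a i).
Proof.
move=> a0; apply: near_eq_ccvg (ccvg_cst _); exists n => // i /= ni.
rewrite /series /= [RHS](big_cat_nat _ (n := n))//= [X in _ + X]big_nat_cond.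
by rewrite [X in _ + X]big1 ?addr0// => j /andP[/andP[/a0]].
Qed.

Lemma csum_real b (l : R) : series b @ \oo --> l ->
  csum (fun n => (b n)%:C%C) (l%:C)%C.
Proof.
by move=> /ccvg_real; apply: eq_ccvg => n; rewrite /series/= raddf_sum.
Qed.

Lemma csum_dominated a b : (forall n, normc (a n) <= b n) ->
  cvgn (series b) -> exists s, csum a s.
Proof.
move=> ab cvb.
have dominated (f : nat -> R) :
    (forall n, `|f n| <= normc (a n)) -> cvgn (series f).
  move=> fa; apply: normed_cvg; apply: series_le_cvg cvb => n //=.
    by apply: le_trans (ab n); exact: normc_ge0.
  exact: le_trans (fa n) (ab n).
have cvRe : cvgn (series (fun n => complex.Re (a n))).
  by apply: dominated => n; exact: ler_Re_normc.
have cvIm : cvgn (series (fun n => complex.Im (a n))).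
  by apply: dominated => n; exact: ler_Im_normc.
exists (limn (series (fun n => complex.Re (a n))) +i*
        limn (series (fun n => complex.Im (a n))))%C.
apply: ccvg_ReIm => /=.
  rewrite (_ : (fun n => _) = series (fun n => complex.Re (a n)))//.
  by apply/funext => n; rewrite /series/= raddf_sum.
rewrite (_ : (fun n => _) = series (fun n => complex.Im (a n)))//.
by apply/funext => n; rewrite /series/= raddf_sum.
Qed.

Lemma csum_tail_le a b s N : (forall n, normc (a n) <= b n) ->
  cvgn (series b) -> csum a s ->
  normc (s - series a N) <= limn (series b) - series b N.
Proof.
move=> ab cvb a_s; have b0 n : 0 <= b n := le_trans (normc_ge0 _) (ab n).
have : ccvg (fun n => series a (n + N)%N - series a N) (s - series a N).
  by apply: ccvgB; [exact: ccvg_comp (@cvg_addnr N) a_s|exact: ccvg_cst].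
apply: ccvg_normc_le => n.
apply: (@le_trans _ _ (series b (n + N)%N - series b N)); last first.
  by rewrite lerB// series_le_lim.
rewrite !sub_series_geq ?leq_addl// (le_trans (ler_normc_sum _ _))//.
by apply: ler_sum => i _; exact: ab.
Qed.

Lemma ccvg_series (u : nat -> nat -> R[i]) (v : nat -> R[i]) N :
  (forall d, ccvg (u^~ d) (v d)) ->
  ccvg (fun M => series (u M) N) (series v N).
Proof. by move=> uv; exact: ccvg_sum. Qed.

Lemma tannery (u : nat -> nat -> R[i]) (v : nat -> R[i]) b
    (S : nat -> R[i]) s :
  (forall M, csum (u M) (S M)) -> csum v s ->
  (forall d, ccvg (u^~ d) (v d)) ->
  (forall M d, normc (u M d) <= b d) -> cvgn (series b) ->
  ccvg S s.
Proof.
move=> uS vs uv ub cvb; apply/ccvg_normcP/cvgrPdist_lt => e e0.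
have e4 : 0 < e / 4 by lra.
have vb d : normc (v d) <= b d by apply: ccvg_normc_le (uv d).
have [N tail_lt] : exists N, limn (series b) - series b N < e / 4.
  have /cvgrPdist_lt/(_ _ e4) [N _ /(_ N (leqnn _)) dist_lt] := cvb.
  by exists N; apply: le_lt_trans dist_lt; exact: ler_norm.
have /ccvg_normcP/cvgrPdist_lt/(_ _ e4) := ccvg_series N uv.
apply: filterS => M; rewrite !sub0r !normrN !ger0_norm ?normc_ge0// => head_lt.
have tail_v := csum_tail_le N vb cvb vs.
have tail_u := csum_tail_le N (ub M) cvb (uS M); rewrite distcC in tail_u.
have -> : s - S M = (s - series v N) +
    ((series v N - series (u M) N) + (series (u M) N - S M)) by ring.
have := le_normcD (s - series v N)
  ((series v N - series (u M) N) + (series (u M) N - S M)).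
have := le_normcD (series v N - series (u M) N) (series (u M) N - S M).
lra.
Qed.

Lemma csum_exchange (a : nat -> nat -> R[i]) b :
  (forall d M, \sum_(0 <= n < M) normc (a d n) <= b d) -> cvgn (series b) ->
  exists Srow Scol s, [/\ forall d, csum (a d) (Srow d),
    forall n, csum (a^~ n) (Scol n), csum Srow s & csum Scol s].
Proof.
move=> rows_le cvb.
have partial_le d M : normc (series (a d) M) <= b d.
  by apply: le_trans (rows_le d M); exact: ler_normc_sum.
have entry_le d n : normc (a d n) <= b d.
  apply: le_trans (rows_le d n.+1); rewrite big_nat_recr//= lerDr.
  by apply: sumr_ge0 => i _; exact: normc_ge0.
have /choice[Srow row] d : exists s, csum (a d) s.
  apply: (@csum_dominated _ (fun n => normc (a d n))) => //.
  by apply: bounded_series_is_cvg (rows_le d) => i; exact: normc_ge0.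
have /choice[Scol col] n : exists s, csum (a^~ n) s.
  exact: csum_dominated (entry_le^~ n) cvb.
have Srow_le d : normc (Srow d) <= b d.
  exact: ccvg_normc_le (partial_le d) (row d).
have [s Srow_s] := csum_dominated Srow_le cvb.
exists Srow, Scol, s; split=> //.
apply: (tannery _ Srow_s row) cvb => [M|M d]; last exact: partial_le.
by apply: csum_sum => n _.
Qed.

End ComplexSeries.

Section UpperHalfPlane.
Context {R : realType}.
Implicit Types z : R[i].

Lemma upperD_real z (t : R) :
  upper_half_plane z -> upper_half_plane (z + (t%:C)%C).
Proof. by rewrite /upper_half_plane /= raddfD /= addr0. Qed.

Lemma upperD_int z (n : int) :
  upper_half_plane z -> upper_half_plane (z + n%:~R).
Proof. by rewrite -(rmorph_int (real_complex R)); exact: upperD_real. Qed.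

Lemma upperD_nat z (n : nat) :
  upper_half_plane z -> upper_half_plane (z + n%:R).
Proof. exact: (@upperD_int z n%:Z). Qed.

Lemma upperB_nat z (n : nat) :
  upper_half_plane z -> upper_half_plane (z - n%:R).
Proof. by move=> /(@upperD_int _ (- n%:Z)); rewrite mulrNz. Qed.

Lemma upperM_real z (t : R) : 0 < t ->
  upper_half_plane z -> upper_half_plane (z * (t%:C)%C).
Proof.
case: z => x y t0; rewrite /upper_half_plane /= mulr0 add0r => y0.
exact: mulr_gt0.
Qed.

Lemma upper_divn z (n : nat) : (0 < n)%N ->
  upper_half_plane z -> upper_half_plane (z / n%:R).
Proof.
move=> n0; rewrite natr_complex -fmorphV.
by apply: upperM_real; rewrite invr_gt0 ltr0n.
Qed.

Lemma upper_mulnl z (n : nat) : (0 < n)%N ->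
  upper_half_plane z -> upper_half_plane (n%:R * z).
Proof.
by move=> n0; rewrite mulrC natr_complex; apply: upperM_real; rewrite ltr0n.
Qed.

Lemma upperNV z : upper_half_plane z -> upper_half_plane (- z^-1).
Proof.
case: z => x y; rewrite /upper_half_plane /= => y0.
by rewrite opprK mulr_gt0// invr_gt0 ltr_wpDl ?sqr_ge0// exprn_gt0.
Qed.

Lemma upper_lin_neq0 z (a b : R) : upper_half_plane z ->
  (a != 0) || (b != 0) -> (a%:C)%C * z + (b%:C)%C != 0.
Proof.
case: z => x y; rewrite /upper_half_plane /= => y0 ab.
apply: contraTneq ab => /(congr1 (fun w => (complex.Re w, complex.Im w))) /=.
case=> Re0 /eqP; rewrite mul0r !addr0 mulf_eq0 (gt_eqF y0) orbF => /eqP a0.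
by move: Re0; rewrite a0 !mul0r subr0 add0r => ->; rewrite eqxx.
Qed.

Lemma upper_lin_int_neq0 z (c d : int) : upper_half_plane z ->
  (c != 0) || (d != 0) -> c%:~R * z + d%:~R != 0.
Proof.
move=> z0 cd; rewrite -!(rmorph_int (real_complex R)).
by apply: upper_lin_neq0; rewrite ?intr_eq0.
Qed.

Lemma upper_SL2 z (a b c d : int) : a * d - b * c = 1 -> upper_half_plane z ->
  upper_half_plane ((a%:~R * z + b%:~R) / (c%:~R * z + d%:~R)).
Proof.
move=> det z0; have /(@upper_lin_int_neq0 z _ _ z0) : (c != 0) || (d != 0).
  apply: contra_eqT det; rewrite negb_or !negbK => /andP[/eqP-> /eqP->].
  by rewrite !mulr0 subr0.
rewrite -!(rmorph_int (real_complex R)) -normc_gt0.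
case: z z0 => x y; rewrite /upper_half_plane /= => y0.
rewrite !(mul0r, subr0, addr0) sqrtr_gt0 => den0.
set den := _ + _ in den0 *.
have -> : (a%:~R * x + b%:~R) * - (c%:~R * y / den) +
    a%:~R * y * ((c%:~R * x + d%:~R) / den) = (a * d - b * c)%:~R * y / den.
  by rewrite rmorphB !rmorphM /=; ring.
by rewrite det mul1r divr_gt0.
Qed.

Lemma upper_neq0 z : upper_half_plane z -> z != 0.
Proof. by apply: contraTneq => ->; rewrite /upper_half_plane /= ltxx. Qed.

Lemma normc_lattice_ge z : upper_half_plane z -> exists2 c : R, 0 < c &
  forall a b : R, c * (`|a| + `|b|) <= normc ((a%:C)%C * z + (b%:C)%C).
Proof.
rewrite /upper_half_plane /= => z0.
pose d := 1 + (normc z + 1) / complex.Im z.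
have d0 : 0 < d.
  by rewrite addr_gt0// divr_gt0// ltr_wpDl// normc_ge0.
exists d^-1; first by rewrite invr_gt0.
move=> a b; rewrite mulrC ler_pdivrMr//; set t := normc (_ + _).
have Im_le : `|a| * complex.Im z <= t.
  apply: le_trans (ler_Im_normc _); rewrite raddfD /= addr0.
  case: z z0 {d d0 t} => x y /= y0.
  by rewrite mul0r addr0 normrM (gtr0_norm y0).
have triangle : `|b| - `|a| * normc z <= t.
  have := lerB_normc (b%:C)%C (- ((a%:C)%C * z)).
  by rewrite opprK normcN normcM !normc_real addrC [_%:C%C + _]addrC addrC.
have scaled : `|a| * (normc z + 1) <= t * ((normc z + 1) / complex.Im z).
  rewrite mulrA ler_pdivlMr// mulrAC ler_wpM2r// addr_ge0//.
  exact: normc_ge0.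
by rewrite /d mulrDr mulr1; lra.
Qed.

End UpperHalfPlane.

Section Nome.
Context {R : realType}.
Implicit Types (x y z : R[i]) (s t : R).

Lemma cexpD x y : cexp (x + y) = cexp x * cexp y :> R[i].
Proof.
case: x y => [a b] [c d]; rewrite /cexp /= expRD cosD sinD.
by apply: complex_ext => /=; ring.
Qed.

Lemma cexp0 : cexp 0 = 1 :> R[i].
Proof. by rewrite /cexp /= expR0 cos0 sin0; apply: complex_ext => /=; ring. Qed.

Lemma normc_cexp z : normc (cexp z) = expR (complex.Re z).
Proof.
rewrite normcM normc_real ger0_norm ?expR_ge0// normcE_sqrt /=.
by rewrite cos2Dsin2 sqrtr1 mulr1.
Qed.

Definition twopii : R[i] := (2 * pi)%:C%C * 'i%C.

Lemma twopii_neq0 : twopii != 0.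
Proof.
rewrite mulf_neq0//; last by rewrite eq_complex /= oner_eq0 andbF.
by rewrite eq_complex /= eqxx andbT mulf_neq0// gt_eqF// pi_gt0.
Qed.

Lemma nomeD x y : nome (x + y) = nome x * nome y :> R[i].
Proof. by rewrite /nome mulrDr cexpD. Qed.

Lemma nome0 : nome 0 = 1 :> R[i].
Proof. by rewrite /nome mulr0 cexp0. Qed.

Lemma nomeE s t : nome (s +i* t)%C =
  ((expR (- (2 * pi * t)) * cos (2 * pi * s)) +i*
   (expR (- (2 * pi * t)) * sin (2 * pi * s)))%C.
Proof.
rewrite /nome (_ : _ * _ = ((- (2 * pi * t)) +i* (2 * pi * s))%C).
  by rewrite /cexp; apply: complex_ext => /=; ring.
by apply: complex_ext => /=; ring.
Qed.

Lemma nome_real t :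
  nome ((t%:C)%C) = (cos (2 * pi * t) +i* sin (2 * pi * t))%C.
Proof. by rewrite nomeE mulr0 oppr0 expR0 !mul1r. Qed.

Lemma nome1 : nome 1 = 1 :> R[i].
Proof.
by rewrite -[1]/((1 : R)%:C)%C nome_real mulr1 [2 * _]mulr_natl cos2pi sin2pi.
Qed.

Lemma nomeMn n z : nome (n%:R * z) = nome z ^+ n.
Proof.
elim: n => [|n IHn]; first by rewrite mul0r nome0.
by rewrite -natr1 mulrDl mul1r nomeD IHn exprSr.
Qed.

Lemma nome_nat n : nome n%:R = 1 :> R[i].
Proof. by rewrite -[n%:R]mulr1 nomeMn nome1 expr1n. Qed.

Lemma nomeN_nat n : nome (- n%:R) = 1 :> R[i].
Proof. by rewrite -[LHS]mul1r -{1}(nome_nat n) -nomeD subrr nome0. Qed.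

Lemma nome_int (n : int) : nome n%:~R = 1 :> R[i].
Proof. by case: n => n; rewrite ?NegzE ?mulrNz ?nomeN_nat// nome_nat. Qed.

Lemma normc_nome z : normc (nome z) = expR (- (2 * pi * complex.Im z)).
Proof. by rewrite normc_cexp; case: z => a b /=; congr expR; ring. Qed.

Lemma nome_neq0 z : nome z != 0.
Proof. by rewrite -normc_gt0 normc_nome expR_gt0. Qed.

Lemma normc_nome_lt1 z : upper_half_plane z -> normc (nome z) < 1.
Proof.
move=> z0; rewrite normc_nome expR_lt1 oppr_lt0.
by rewrite mulr_gt0// mulr_gt0// pi_gt0.
Qed.

Lemma nome_upper_neq1 z : upper_half_plane z -> 1 - nome z != 0.
Proof. by move=> /normc_nome_lt1/lt1_normc_neq1. Qed.

Lemma nome_real_neq1 t : 0 < t -> t < 1 -> nome ((t%:C)%C) != 1.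
Proof.
move=> t0 t1; rewrite nome_real; apply/eqP => -[+ _].
rewrite -[2 * pi * t]mulrA [2 * (pi * t)]mulr_natl cos_mulr2n cos2sin2.
have : 0 < sin (pi * t).
  apply: sin_gt0_pi; rewrite mulr_gt0 ?pi_gt0//=.
  by rewrite -[ltRHS]mulr1 ltr_pM2l// pi_gt0.
by move=> /(exprn_gt0 2) sin2_gt0; rewrite mulr2n; lra.
Qed.

Lemma nome_frac_eq1 (n d : nat) : (0 < d)%N ->
  (nome (n%:R / d%:R) == 1 :> R[i]) = (d %| n)%N.
Proof.
move=> d0; have d0' : d%:R != 0 :> R[i] by rewrite pnatr_eq0 -lt0n.
rewrite {1}(divn_eq n d) natrD natrM mulrDl mulfK// nomeD nome_nat mul1r.
rewrite /dvdn; case: posnP => [->|rem0]; first by rewrite mul0r nome0 eqxx.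
apply/negbTE; rewrite !natr_complex -fmorph_div.
apply: nome_real_neq1; first by rewrite divr_gt0// ltr0n.
by rewrite ltr_pdivrMr ?ltr0n// mul1r ltr_nat ltn_mod.
Qed.

(* A real value of a root of unity is a sign. *)
Lemma nome_frac_real (n d : nat) t : (0 < d)%N ->
  nome (n%:R / d%:R) = (t%:C)%C -> (d %| 2 * n)%N.
Proof.
move=> d0 nome_t; rewrite -nome_frac_eq1// natrM -mulrA nomeMn nome_t.
have : normc (nome (n%:R / d%:R : R[i])) = 1.
  rewrite normc_nome (_ : complex.Im _ = 0) ?mulr0 ?oppr0 ?expR0//.
  by rewrite !natr_complex -fmorph_div.
rewrite nome_t normc_real -rmorphXn => abs_t.
by rewrite -[1]/((1 : R)%:C)%C -real_normK ?num_real// abs_t expr1n.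
Qed.

Lemma sum_roots_of_unity (K r : nat) : let M := K.*2.+1 in
  \sum_(j < M) nome ((j%:R - K%:R) / M%:R) ^+ r =
  (if (M %| r)%N then M%:R else 0) :> R[i].
Proof.
move=> M; have M0 : M%:R != 0 :> R[i] by rewrite pnatr_eq0.
case: ifPn => [/dvdnP[t ->]|Mr].
  rewrite (eq_bigr (fun=> 1)) ?sumr_const ?card_ord// => j _.
  rewrite -nomeMn natrM (_ : _ * (_ / _) = (t * j)%:R - (t * K)%:R).
    by rewrite nomeD nome_nat nomeN_nat mulr1.
  by rewrite !natrM; field.
have geometric j : nome ((j%:R - K%:R) / M%:R) ^+ r =
    nome (- (K%:R * r%:R / M%:R)) * nome (r%:R / M%:R) ^+ j :> R[i].
  by rewrite -!nomeMn -nomeD; congr nome; ring.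
under eq_bigr do rewrite geometric.
rewrite -mulr_sumr.
have : nome (r%:R / M%:R) ^+ M - 1 = 0 :> R[i].
  by rewrite -nomeMn mulrC divfK// nome_nat subrr.
rewrite subrX1 => /eqP; rewrite mulf_eq0 subr_eq0 nome_frac_eq1//.
by rewrite (negbTE Mr) => /eqP ->; rewrite mulr0.
Qed.

End Nome.

Arguments twopii {R}.

Section NomeNearZero.
Context {R : realType}.
Implicit Types (w z : R[i]) (s t x y : R).

Lemma is_derive_cvg_slope (phi : R -> R) (d : R) : is_derive (0 : R) 1 phi d ->
  (fun M : nat => M.+1%:R * (phi (M.+1%:R^-1) - phi 0)) @ \oo --> d.
Proof.
move=> phi_d; have := @ex_derive _ _ _ _ _ _ _ phi_d.
rewrite /derivable => cv_slope.
have {cv_slope} : h^-1 *: (phi (h *: 1 + 0) - phi 0) @[h --> (0 : R)^'] --> d.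
  by rewrite -(@derive_val _ _ _ _ _ _ _ phi_d).
have harmonic_dnbhs : (fun M : nat => (M.+1%:R : R)^-1) @ \oo --> (0 : R)^'.
  move=> A [e /= e0 ballA].
  have /cvgrPdist_lt/(_ _ e0) := @cvg_harmonic R.
  by apply: filterS => n /= dist_lt; apply: ballA.
move=> /(cvg_comp _ _ harmonic_dnbhs); apply: cvg_trans; apply: near_eq_cvg.
by apply: nearW => n /=; rewrite addr0 invrK /GRing.scale /= mulr1.
Qed.

Lemma ccvg_cexp_slope z :
  ccvg (fun M : nat => M.+1%:R * (cexp (z / M.+1%:R) - 1)) z.
Proof.
case: z => s t.
have slopeE M : M.+1%:R * (cexp ((s +i* t)%C / M.+1%:R) - 1) =
   ((M.+1%:R * (expR (s * M.+1%:R^-1) * cos (t * M.+1%:R^-1) -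
       expR (s * 0) * cos (t * 0))) +i*
    (M.+1%:R * (expR (s * M.+1%:R^-1) * sin (t * M.+1%:R^-1) -
       expR (s * 0) * sin (t * 0))))%C :> R[i].
  rewrite !natr_complex -fmorphV !mulr0 expR0 cos0 sin0.
  have -> : (s +i* t)%C * (M.+1%:R^-1%:C)%C =
      ((s * M.+1%:R^-1) +i* (t * M.+1%:R^-1))%C.
    by apply: complex_ext => /=; ring.
  by rewrite /cexp /=; apply: complex_ext => /=; ring.
rewrite (funext slopeE); apply: ccvg_ReIm => /=.
  apply: (@is_derive_cvg_slope (fun x => expR (s * x) * cos (t * x))).
  apply: is_derive_eq; rewrite !(mulr0, expR0, cos0, sin0, mul1r, mulr1).
  by rewrite /GRing.scale /= !(mulr0, oppr0, mul0r, mulr1, mul1r, add0r, addr0).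
apply: (@is_derive_cvg_slope (fun x => expR (s * x) * sin (t * x))).
apply: is_derive_eq; rewrite !(mulr0, expR0, cos0, sin0, mul1r, mulr1).
by rewrite /GRing.scale /= !(mulr0, oppr0, mul0r, mulr1, mul1r, add0r, addr0).
Qed.

Lemma ccvg_nome_slope w :
  ccvg (fun M : nat => M.+1%:R * (1 - nome (w / M.+1%:R))) (- (twopii * w)).
Proof.
rewrite -[- (_ * w)]mulN1r.
apply: eq_ccvg (ccvgZ (-1) (ccvg_cexp_slope (twopii * w))) => M.
by rewrite /nome -mulrA mulN1r -mulrN opprB.
Qed.

Lemma ccvg_nome_div w : ccvg (fun M : nat => nome (w / M.+1%:R)) 1.
Proof.
have := ccvgM (ccvg_real (@cvg_harmonic R)) (ccvg_nome_slope w).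
move=> /(ccvgB (ccvg_cst 1)); rewrite mul0r subr0; apply: eq_ccvg => M.
rewrite fmorphV rmorph_nat mulrA mulVf ?pnatr_eq0// mul1r.
by rewrite opprB addrC subrK.
Qed.

Lemma ler_cos : {in `[0, pi] &, {mono @cos R : x y /~ y <= x}}.
Proof. by move=> x y xpi ypi; rewrite !leNgt ltr_cos. Qed.

Lemma mulr_cos_le_sin x : 0 <= x <= pi -> x * cos x <= sin x.
Proof.
move=> /andP[]; rewrite le_eqVlt => /predU1P[<- _|x0 xpi].
  by rewrite mul0r sin0.
have [|c /= cx] := @MVT R sin cos 0 x x0 (fun t _ => is_derive_sin t).
  by apply: continuous_subspaceT; exact: continuous_sin.
rewrite sin0 !subr0 => ->; rewrite mulrC ler_pM2r//.
move: cx; rewrite in_itv /= => /andP[c0 cx].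
rewrite ler_cos ?in_itv /= ?(ltW c0) ?(ltW x0) ?(ltW cx)//.
exact: le_trans (ltW cx) xpi.
Qed.

(* By the double angle formula, sin (pi x) >= pi x cos (pi x / 2) ^ 2. *)
Lemma sqr_sin_pi_ge t x : t < 1 -> `|x| <= t ->
  (pi * cos (pi * t / 2) ^+ 2 * x) ^+ 2 <= sin (pi * x) ^+ 2.
Proof.
move=> t1; wlog x0 : x / 0 <= x => [nonneg xt|].
  have [/nonneg|x0] := leP 0 x; first exact.
  have := nonneg (- x); rewrite normrN oppr_ge0 => /(_ (ltW x0) xt).
  by rewrite !mulrN sinN !sqrrN.
rewrite ger0_norm// => xt; have pi0 := @pi_gt0 R.
set y := pi * x / 2; have -> : pi * x = y *+ 2 by rewrite /y mulr2n; lra.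
have y0 : 0 <= y by rewrite /y; nra.
have ypi : y <= pi by rewrite /y; nra.
have cos_t_gt0 : 0 < cos (pi * t / 2).
  by rewrite cos_gt0_pihalf//; apply/andP; split; nra.
have cos_le : cos (pi * t / 2) <= cos y.
  by rewrite ler_cos ?in_itv /=; [rewrite /y; nra|apply/andP; split; nra|
    apply/andP; split; nra].
have cosy_ge0 : 0 <= cos y := le_trans (ltW cos_t_gt0) cos_le.
have sin_ge : y * cos y <= sin y by apply: mulr_cos_le_sin; rewrite y0.
have lower_ge0 : 0 <= pi * cos (pi * t / 2) ^+ 2 * x.
  by rewrite !mulr_ge0// ?sqr_ge0// ltW.
have lower_le : pi * cos (pi * t / 2) ^+ 2 * x <= sin (y *+ 2).
  have -> : pi * cos (pi * t / 2) ^+ 2 * x = y *+ 2 * cos (pi * t / 2) ^+ 2.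
    by rewrite /y mulr2n; field.
  apply: (@le_trans _ _ (y *+ 2 * cos y ^+ 2)).
    by rewrite ler_wpM2l ?mulrn_wge0// lerXn2r ?nnegrE// ltW.
  have : y * cos y * cos y <= sin y * cos y by rewrite ler_wpM2r.
  by rewrite sin_mulr2n expr2 !mulr2n; lra.
by rewrite lerXn2r ?nnegrE// (le_trans lower_ge0).
Qed.

Lemma mulr_expRN_le t : t * expR (- t) <= 1 - expR (- t).
Proof.
have : (1 + t) * expR (- t) <= expR t * expR (- t).
  by rewrite ler_pM2r ?expR_gt0// expR_ge1Dx.
by rewrite expRxMexpNx_1 mulrDl mul1r; lra.
Qed.

Lemma sqr_normc_1Bnome x y : normc (1 - nome (x +i* y)%C) ^+ 2 =
  (1 - expR (- (2 * pi * y))) ^+ 2 +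
  4 * expR (- (2 * pi * y)) * sin (pi * x) ^+ 2.
Proof.
rewrite nomeE normcE_sqrt sqr_sqrtr ?addr_ge0 ?sqr_ge0//=.
rewrite -[2 * pi * x]mulrA [2 * (pi * x)]mulr_natl sub0r.
rewrite sin_mulr2n cos_mulr2n.
have /(canRL (addrK _)) cos2E := cos2Dsin2 (pi * x).
set r := expR _; rewrite sqrrN exprMn -[(_ * sin _) *+ 2]mulr_natl !exprMn.
by rewrite cos2E; ring.
Qed.

Lemma normc_1Bnome_ge (Y t : R) : t < 1 -> exists2 c : R, 0 < c &
  forall w, upper_half_plane w -> complex.Im w <= Y -> `|complex.Re w| <= t ->
    c * normc w <= normc (1 - nome w).
Proof.
move=> t1; have [t0|t0] := ltP t 0.
  by exists 1 => // w _ _ wt; have := normr_ge0 (complex.Re w); lra.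
have pi0 := @pi_gt0 R; set c := cos (pi * t / 2).
have c0 : 0 < c by rewrite cos_gt0_pihalf//; apply/andP; split; nra.
have c2_le1 : c ^+ 2 <= 1 by rewrite exprn_ile1 ?cos_le1// ltW.
pose rho := expR (- (2 * pi * `|Y|)).
have rho0 : 0 < rho by exact: expR_gt0.
have rho1 : rho <= 1 by rewrite expR_le1 oppr_le0 !mulr_ge0// ltW.
exists (2 * pi * rho * c ^+ 2).
  by rewrite mulr_gt0 ?exprn_gt0// !mulr_gt0.
case=> x y; rewrite /upper_half_plane /= => y0 yY xt.
rewrite -(ler_pXn2r (n := 2))// ?nnegrE ?normc_ge0//; last first.
  by rewrite mulr_ge0 ?normc_ge0// !mulr_ge0 ?sqr_ge0// ltW.
rewrite sqr_normc_1Bnome exprMn sqr_sqrtr ?addr_ge0 ?sqr_ge0//.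
set r := expR _.
have rho_le : rho <= r.
  rewrite ler_expR lerN2 ler_wpM2l ?mulr_ge0 ?(ltW pi0)//.
  by rewrite (le_trans yY)// ler_norm.
have imag_part : (2 * pi * rho * c ^+ 2) ^+ 2 * y ^+ 2 <= (1 - r) ^+ 2.
  rewrite -exprMn lerXn2r ?nnegrE//.
  - by rewrite !mulr_ge0 ?(ltW pi0) ?(ltW rho0) ?(ltW c0) ?(ltW y0).
  - by rewrite subr_ge0 expR_le1 oppr_le0 !mulr_ge0 ?(ltW pi0) ?(ltW y0).
  - apply: le_trans (mulr_expRN_le (2 * pi * y)); rewrite -/r.
    have -> : 2 * pi * rho * c ^+ 2 * y = 2 * pi * y * (rho * c ^+ 2) by ring.
    rewrite ler_wpM2l ?mulr_ge0 ?(ltW pi0) ?(ltW y0)//.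
    by apply: le_trans rho_le; rewrite ler_piMr// ltW.
have real_part : (2 * pi * rho * c ^+ 2) ^+ 2 * x ^+ 2 <=
    4 * r * sin (pi * x) ^+ 2.
  have -> : (2 * pi * rho * c ^+ 2) ^+ 2 * x ^+ 2 =
     4 * rho ^+ 2 * (pi * c ^+ 2 * x) ^+ 2 by ring.
  have rho2_le : rho ^+ 2 <= r by rewrite (le_trans _ rho_le)// ler_iXnr// ltW.
  have rho2_le4 : 4 * rho ^+ 2 <= 4 * r by rewrite ler_pM2l.
  apply: ler_pM rho2_le4 (sqr_sin_pi_ge t1 xt); last exact: sqr_ge0.
  by rewrite mulr_ge0// sqr_ge0.
by rewrite mulrDr addrC lerD.
Qed.

End NomeNearZero.

Section PowerSums.
Context {R : realType}.
Implicit Types (a : nat -> R[i]) (q : R[i]) (j s : nat).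

Lemma series_multiples (V : zmodType) (v : nat -> V) M N : (0 < M)%N ->
  (forall n, ~~ (M %| n)%N -> v n = 0) ->
  series v N = series (fun n => v (M * n)%N) ((N + M.-1) %/ M)%N.
Proof.
move=> M0 v0; elim: N => [|N IHN].
  by rewrite add0n divn_small ?prednK// /series/= !big_geq.
rewrite seriesSr IHN addSn divnS// -addnS prednK// dvdn_addl//.
have [/dvdnP[t ->]|/v0->] := boolP (M %| N)%N; last by rewrite addr0 add0n.
rewrite divnMDl// divn_small ?prednK// addn0 add1n.
by rewrite seriesSr mulnC.
Qed.

Lemma csum_multiples a (t : R[i]) M : (0 < M)%N ->
  (forall n, ~~ (M %| n)%N -> a n = 0) ->
  csum a t <-> csum (fun n => a (M * n)%N) t.
Proof.
move=> M0 a0; split => sum_t.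
  apply: eq_ccvg (ccvg_comp (cvg_mulnl _ M0) sum_t) => n /=.
  rewrite (@series_multiples _ _ M)// mulnC divnMDl// divn_small ?prednK//.
  by rewrite addn0.
have ceil_oo : (fun N => (N + M.-1) %/ M)%N @ \oo --> \oo.
  exact: cvg_comp (@cvg_addnr M.-1) (cvg_divnr _ M0).
apply: eq_ccvg (ccvg_comp ceil_oo sum_t) => N.
by rewrite [RHS](@series_multiples _ _ M).
Qed.

Lemma csum_stretch a (t : R[i]) M : (0 < M)%N -> csum a t ->
  csum (fun n => if (M %| n)%N then a (n %/ M)%N else 0) t.
Proof.
move=> M0 sum_t; apply/(@csum_multiples _ _ M) => // [n /negbTE -> //|].
by apply: eq_csum sum_t => n; rewrite dvdn_mulr// mulKn.
Qed.

Lemma leq_exp_fact_bin (n s : nat) : (n ^ s <= s`! * 'C(n + s, s))%N.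
Proof.
rewrite mulnC bin_ffact; elim: s => [|s IHs]; first by rewrite ffactn0.
by rewrite addnS ffactSS expnS leq_mul// -addnS leq_addr.
Qed.

Lemma bin_exp_le (K : realFieldType) (y : K) (n s : nat) : 0 <= y < 1 ->
  'C(n + s, s)%:R * y ^+ n <= (1 - y) ^- s.
Proof.
move=> /andP[y0 y1].
rewrite -[leRHS]mul1r ler_pdivlMr ?exprn_gt0 ?subr_gt0//.
have := exprDn y (1 - y) (n + s); rewrite addrC subrK expr1n => expansion.
have sn : (s < (n + s).+1)%N by rewrite ltnS leq_addl.
rewrite [leRHS]expansion (bigD1 (Ordinal sn))//= addnK -[leLHS]addr0 lerD//.
  by rewrite -mulrA mulr_natl.
apply: sumr_ge0 => i _; rewrite mulrn_wge0// mulr_ge0// exprn_ge0//.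
by rewrite subr_ge0 ltW.
Qed.

(* Half of the decay of x ^+ n absorbs the binomial coefficient: y = sqrt x. *)
Lemma bin_exp_geometric_le (x : R) s : 0 <= x < 1 ->
  exists K y : R, 0 <= y < 1 /\
    forall n, 'C(n + s, s)%:R * x ^+ n <= geometric K y n.
Proof.
move=> /andP[x0 x1]; pose y := Num.sqrt x.
have y0 : 0 <= y by exact: sqrtr_ge0.
have xE : x = y ^+ 2 by rewrite sqr_sqrtr.
have y1 : y < 1 by rewrite -(ltr_pXn2r (n := 2))// ?nnegrE// -xE expr1n.
have y01 : 0 <= y < 1 by rewrite y0.
exists ((1 - y) ^- s), y; split=> // n.
rewrite xE -exprM mulnC exprM expr2 mulrA /=.
by rewrite ler_wpM2r ?exprn_ge0// bin_exp_le.
Qed.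

Lemma is_cvg_series_pow_geometric s (x : R) : 0 <= x < 1 ->
  cvgn (series (fun n => n%:R ^+ s * x ^+ n)).
Proof.
move=> x01; have /andP[x0 _] := x01.
have [K [y [/andP[y0 y1] bin_le]]] := bin_exp_geometric_le s x01.
have pow_le n : n%:R ^+ s * x ^+ n <= s`!%:R * geometric K y n.
  apply: (@le_trans _ _ (s`!%:R * ('C(n + s, s)%:R * x ^+ n))).
    rewrite mulrA ler_wpM2r ?exprn_ge0// -natrX -natrM ler_nat.
    exact: leq_exp_fact_bin.
  by rewrite ler_wpM2l.
have pow_ge0 n : 0 <= n%:R ^+ s * x ^+ n by rewrite mulr_ge0 ?exprn_ge0.
apply: (series_le_cvg pow_ge0 _ pow_le) => [n|].
  exact: le_trans (pow_ge0 n) (pow_le n).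
by apply: is_cvg_seriesZ; apply: is_cvg_geometric_series; rewrite ger0_norm.
Qed.

Lemma ccvg_bin_exp0 q j : normc q < 1 ->
  ccvg (fun n => 'C(n + j, j)%:R * q ^+ n) 0.
Proof.
move=> q1; have q01 : 0 <= normc q < 1 by rewrite normc_ge0.
have [K [y [/andP[y0 y1] bin_le]]] := bin_exp_geometric_le j q01.
apply: (@ccvg0_normc_le _ _ (geometric K y)) => [n|].
  by rewrite normcM normc_nat normcX.
by apply: cvg_geometric; rewrite ger0_norm.
Qed.

Lemma csum_geometric q : normc q < 1 -> csum (GRing.exp q) (1 - q)^-1.
Proof.
move=> q1; have := ccvg_bin_exp0 0 q1.
move=> /(ccvgB (ccvg_cst 1))/(ccvgZ (1 - q)^-1); rewrite subr0 mulr1.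
apply: eq_ccvg => n; apply: (mulfI (lt1_normc_neq1 q1)).
rewrite mulrA divff ?lt1_normc_neq1// mul1r bin0 mul1r.
rewrite /series/= big_mkord -[LHS]opprB subrX1 -mulNr opprB.
by congr (_ * _); apply: eq_bigr.
Qed.

Lemma sum_bin_exp_recr q j N :
  (1 - q) * (\sum_(0 <= r < N) 'C(r + j.+1, j.+1)%:R * q ^+ r) =
  \sum_(0 <= r < N) 'C(r + j, j)%:R * q ^+ r - 'C(N + j, j.+1)%:R * q ^+ N.
Proof.
elim: N => [|N IHN].
  by rewrite !big_geq// mulr0 add0n bin_small// mul0r subr0.
rewrite !big_nat_recr//= mulrDr IHN addnS addSn binS natrD exprS.
by ring.
Qed.

Lemma csum_bin_geometric q j : normc q < 1 ->
  csum (fun r => 'C(r + j, j)%:R * q ^+ r) ((1 - q) ^- j.+1).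
Proof.
move=> q1; have q1_neq0 := lt1_normc_neq1 q1.
elim: j => [|j IHj].
  by rewrite expr1; apply: eq_csum (csum_geometric q1) => r; rewrite bin0 mul1r.
have boundary0 : ccvg (fun N => 'C(N + j, j.+1)%:R * q ^+ N) 0.
  apply/ccvg_shiftS; rewrite -(mulr0 q).
  apply: eq_ccvg (ccvgZ q (ccvg_bin_exp0 j.+1 q1)) => N.
  by rewrite addSnnS exprS mulrCA.
have := ccvgZ (1 - q)^-1 (ccvgB IHj boundary0).
rewrite subr0 -invfM -exprS; apply: eq_ccvg => N.
apply: (mulfI q1_neq0); rewrite mulrA divff// mul1r.
by rewrite [in RHS]/series /= sum_bin_exp_recr.
Qed.

Lemma expn_bin_basis (K : comNzRingType) s :
  exists2 c : nat -> K, c s = s`!%:R &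
  forall r : nat, r%:R ^+ s = \sum_(0 <= j < s.+1) c j * 'C(r + j, j)%:R.
Proof.
elim: s => [|s [c c_s cE]].
  by exists (fun=> 1) => // r; rewrite big_nat1 bin0 mulr1.
exists (fun j => (if j is j'.+1 then j%:R * c j' else 0) -
                 (if (j <= s)%N then j.+1%:R * c j else 0)).
  by rewrite ltnn subr0 c_s factS natrM.
move=> r; rewrite exprS cE mulr_sumr.
under [RHS]eq_bigr do rewrite mulrBl.
rewrite sumrB [X in X - _]big_nat_recl//=.
rewrite [X in _ - X]big_nat_recr//= ltnn !mul0r add0r addr0.
rewrite -sumrB !big_nat; apply: eq_bigr => j /=; rewrite ltnS => ->.
have absorption : j.+1%:R * 'C(r + j.+1, j.+1)%:R =
    (r%:R + j.+1%:R) * 'C(r + j, j)%:R :> K.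
  by rewrite -natrD -!natrM -mul_bin_diag addnS.
by rewrite mulrAC absorption; ring.
Qed.

Definition powsum s q : R[i] :=
  limn (series (fun r : nat => r%:R ^+ s * q ^+ r) : nat -> R[i]^o).

Lemma csum_powsum s q : normc q < 1 ->
  csum (fun r : nat => r%:R ^+ s * q ^+ r) (powsum s q).
Proof.
move=> q1; have q01 : 0 <= normc q < 1 by rewrite normc_ge0.
have term_le n : normc (n%:R ^+ s * q ^+ n) <= n%:R ^+ s * normc q ^+ n.
  by rewrite normcM !normcX normc_nat.
have [t sum_t] := csum_dominated term_le (is_cvg_series_pow_geometric q01).
by rewrite /powsum (csum_lim sum_t).
Qed.

Lemma powsum0E q : normc q < 1 -> powsum 0 q = (1 - q)^-1.
Proof.
move=> q1; apply: csum_unique (csum_powsum 0 q1) _.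
by apply: eq_csum (csum_geometric q1) => r; rewrite expr0 mul1r.
Qed.

Lemma powsum_rational s : exists2 P : {poly R[i]}, P.[0] = s`!%:R &
  forall q, normc q < 1 -> powsum s q = P.[1 - q] / (1 - q) ^+ s.+1.
Proof.
have [c c_s cE] := expn_bin_basis R[i] s.
exists (\sum_(0 <= j < s.+1) c j *: 'X^(s - j)) => [|q q1].
  rewrite horner_sum big_nat_recr//= hornerZ hornerXn subnn expr0 mulr1 c_s.
  rewrite big_nat big1 ?add0r// => j js; rewrite hornerZ hornerXn.
  by rewrite expr0n subn_eq0 leqNgt (andP js).2 mulr0.
have q1_neq0 := lt1_normc_neq1 q1.
apply: csum_unique (csum_powsum s q1) _; rewrite horner_sum mulr_suml.
apply: (@eq_csum _ (fun r => \sum_(j <- index_iota 0 s.+1)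
    c j * ('C(r + j, j)%:R * q ^+ r))) => [r|].
  by rewrite cE mulr_suml; apply: eq_bigr => j _; rewrite mulrA.
apply: csum_sum => j; rewrite mem_index_iota ltnS => /= js.
have -> : (c j *: 'X^(s - j)).[1 - q] / (1 - q) ^+ s.+1 = c j * (1 - q) ^- j.+1.
  rewrite hornerZ hornerXn -mulrA; congr (_ * _).
  rewrite -{2}(subnK js) -addnS exprD invfM mulrA.
  by rewrite divff ?mul1r// expf_neq0.
exact/csumZ/csum_bin_geometric.
Qed.

Lemma normr_horner_le (K : numDomainType) (P : {poly K}) (B x : K) :
  `|x| <= B -> `|P.[x]| <= \sum_(i < size P) `|P`_i| * B ^+ i.
Proof.
move=> xB; rewrite horner_coef (le_trans (ler_norm_sum _ _ _))//.
apply: ler_sum => i _; rewrite normrM normrX ler_wpM2l//.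
by rewrite lerXn2r ?nnegrE// (le_trans _ xB).
Qed.

Lemma powsum_le s : exists2 B : R, 0 < B & forall q, normc q < 1 ->
  normc (powsum s q) <= B / normc (1 - q) ^+ s.+1.
Proof.
have [P _ PE] := powsum_rational s.
pose B := \sum_(i < size P) normc P`_i * 2 ^+ i.
have B0 : 0 <= B.
  by apply: sumr_ge0 => i _; rewrite mulr_ge0 ?normc_ge0 ?exprn_ge0.
exists (B + 1) => [|q q1]; first by rewrite ltr_wpDl.
rewrite PE// normcM normcV normcX ler_pM2r; last first.
  by rewrite invr_gt0 exprn_gt0// normc_gt0 lt1_normc_neq1.
have : `|1 - q| <= 2.
  rewrite normr_normc natr_complex lecR (le_trans (le_normcD _ _))//.
  by rewrite normcN normc1; lra.
move=> /(normr_horner_le P); rewrite normr_normc.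
have -> : \sum_(i < size P) `|P`_i| * 2 ^+ i = (B%:C)%C.
  rewrite rmorph_sum; apply: eq_bigr => i _.
  by rewrite rmorphM rmorphXn rmorph_nat.
by rewrite lecR => /le_trans -> //; rewrite lerDl.
Qed.

End PowerSums.

Section Lipschitz.
Context {R : realType}.
Implicit Types (x z : R[i]) (s K : nat).

Lemma is_cvg_series_inv_sqr : cvgn (series (fun j : nat => (j.+1%:R ^- 2 : R))).
Proof.
apply: (@bounded_series_is_cvg _ _ 2) => [j|n].
  by rewrite invr_ge0 sqr_ge0.
suff : series (fun j : nat => (j.+1%:R ^- 2 : R)) n <= 2 - 2 / n.+1%:R.
  have : 0 < 2 / n.+1%:R :> R by rewrite divr_gt0.
  by move: (2 / _) => t; lra.
elim: n => [|n IHn]; first by rewrite /series/= big_geq// divr1 subrr.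
rewrite seriesSr.
have telescoping : n.+1%:R ^- 2 <= 2 / n.+1%:R - 2 / n.+2%:R :> R.
  rewrite -(subr_ge0 (_ ^- 2)).
  have -> : 2 / n.+1%:R - 2 / n.+2%:R - n.+1%:R ^- 2 =
      n%:R / (n.+1%:R ^+ 2 * n.+2%:R) :> R.
    have := ltr0Sn R n; have := ltr0Sn R n.+1.
    rewrite -![n.+2%:R]natr1 -![n.+1%:R]natr1 => n2_gt0 n1_gt0.
    by field; apply/andP; split; rewrite gt_eqF.
  by rewrite divr_ge0// mulr_ge0// sqr_ge0.
by apply: le_trans (lerD IHn telescoping) _; rewrite addrA subrK.
Qed.

Lemma is_cvg_seriesZ_inv_sqr (c : R) :
  cvgn (series (fun j : nat => c * (j.+1%:R ^- 2))).
Proof. by apply: is_cvg_seriesZ; exact: is_cvg_series_inv_sqr. Qed.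

(* The shift by 1/2 for s = 0 makes [cotsum 0] odd: up to a factor, it is the
   cotangent of pi z. *)
Definition cotsum s z : R[i] := powsum s (nome z) - (s == 0%N)%:R / 2.

Lemma cotsumS s z : cotsum s.+1 z = powsum s.+1 (nome z).
Proof. by rewrite /cotsum mul0r subr0. Qed.

Definition pole s x : R[i] := s`!%:R / (- (twopii * x)) ^+ s.+1.

Lemma cotsum_distribution s z K : upper_half_plane z ->
  cotsum s z = (K.*2.+1)%:R ^- s.+1 *
    \sum_(j < K.*2.+1) cotsum s ((z + (j%:R - K%:R)) / (K.*2.+1)%:R).
Proof.
move=> z0; set M := K.*2.+1.
have M0 : M%:R != 0 :> R[i] by rewrite pnatr_eq0.
pose w (j : nat) := (z + (j%:R - K%:R)) / M%:R.
have w0 j : upper_half_plane (w j).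
  by apply: upper_divn => //; rewrite addrA; exact/upperB_nat/upperD_nat.
have filtered r : \sum_(j <- index_iota 0 M) r%:R ^+ s * nome (w j) ^+ r =
    r%:R ^+ s * nome (z / M%:R) ^+ r * (if (M %| r)%N then M%:R else 0).
  rewrite -sum_roots_of_unity mulr_sumr big_mkord; apply: eq_bigr => j _.
  by rewrite -mulrA -exprMn -nomeD /w mulrDl.
have sum_w :
    csum (fun r => \sum_(j <- index_iota 0 M) r%:R ^+ s * nome (w j) ^+ r)
    (\sum_(j <- index_iota 0 M) powsum s (nome (w j))).
  by apply: csum_sum => j _; apply: csum_powsum; exact: normc_nome_lt1.
have sum_z : csum (fun r => M%:R ^+ s.+1 * (r%:R ^+ s * nome z ^+ r))
    (\sum_(j <- index_iota 0 M) powsum s (nome (w j))).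
  have /(@csum_multiples _ _ _ M isT) := eq_csum filtered sum_w.
  move=> /(_ _)/[dup] multiples _.
  apply: eq_csum (multiples _) => [r|r /negbTE ->]; last by rewrite mulr0.
  rewrite dvdn_mulr// natrM exprMn exprM -nomeMn mulrC [M%:R * _]mulrC divfK//.
  by rewrite exprS; ring.
have := csum_unique sum_z (csumZ _ (csum_powsum s (normc_nome_lt1 z0))).
rewrite big_mkord => sum_powsum.
rewrite /cotsum sumrB sumr_const card_ord sum_powsum mulrBr.
rewrite mulKf ?expf_neq0//; congr (_ - _).
case: s {filtered sum_w sum_z sum_powsum} => [|s].
  by rewrite expr1 -(mulr_natl (_ / 2)) mulKf.
by rewrite mul0r mul0rn mulr0.
Qed.

Lemma sum_symmetric (V : nmodType) (F : R[i] -> V) K :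
  \sum_(j < K.*2.+1) F (j%:R - K%:R) =
  F 0 + \sum_(0 <= j < K) (F j.+1%:R + F (- j.+1%:R)).
Proof.
elim: K => [|K IHK]; first by rewrite big_ord1 big_geq// subrr addr0.
rewrite doubleS big_ord_recl big_ord_recr /= [in RHS]big_nat_recr//=.
rewrite [RHS]addrA -IHK.
under eq_bigr => j _.
  have -> : (bump 0 j)%:R - K.+1%:R = j%:R - K%:R :> R[i].
    by rewrite /bump /= add1n -!natr1 opprD addrACA subrr addr0.
  over.
have -> : (bump 0 K.*2.+1)%:R - K.+1%:R = K.+1%:R :> R[i].
  by rewrite /bump /= add1n -addnn -!natr1 natrD; ring.
by rewrite sub0r addrCA [_ + F (- _)]addrC.
Qed.

Definition cotsum_pair s z K (j : nat) : R[i] := (K.*2.+1)%:R ^- s.+1 *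
  (cotsum s ((z + j.+1%:R) / (K.*2.+1)%:R) +
   cotsum s ((z - j.+1%:R) / (K.*2.+1)%:R)).

Lemma cotsum_sum_pairs s z K : upper_half_plane z ->
  cotsum s z = (K.*2.+1)%:R ^- s.+1 * cotsum s (z / (K.*2.+1)%:R) +
    \sum_(0 <= j < K) cotsum_pair s z K j.
Proof.
move=> z0; rewrite (cotsum_distribution s K z0).
rewrite (sum_symmetric (fun n => cotsum s ((z + n) / (K.*2.+1)%:R))) addr0.
by rewrite mulrDr mulr_sumr.
Qed.

Lemma cvg_double : (fun K => K.*2) @ \oo --> \oo.
Proof.
rewrite (_ : double = muln 2); first exact: cvg_mulnl.
by apply/funext => K; rewrite mul2n.
Qed.

Lemma ccvg_cotsum_pole s x : upper_half_plane x ->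
  ccvg (fun K => (K.*2.+1)%:R ^- s.+1 * cotsum s (x / (K.*2.+1)%:R)) (pole s x).
Proof.
move=> x0; have [P P0 PE] := @powsum_rational R s.
suff : ccvg (fun M : nat => M.+1%:R ^- s.+1 * cotsum s (x / M.+1%:R))
    (pole s x).
  exact: ccvg_comp cvg_double.
have num : ccvg (fun M : nat => P.[1 - nome (x / M.+1%:R)]) s`!%:R.
  rewrite -P0 -(subrr 1); apply: ccvg_horner.
  by apply: ccvgB (ccvg_nome_div x); exact: ccvg_cst.
have den := ccvgX s.+1 (ccvg_nome_slope x).
have den_neq0 : (- (twopii * x)) ^+ s.+1 != 0.
  by rewrite expf_neq0// oppr_eq0 mulf_neq0 ?twopii_neq0// upper_neq0.
have corr : ccvg (fun M : nat => M.+1%:R ^- s.+1 * ((s == 0%N)%:R / 2))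
    (0 : R[i]).
  have inv0 := ccvgX s.+1 (ccvg_real (@cvg_harmonic R)).
  have := ccvgM inv0 (ccvg_cst ((s == 0%N)%:R / 2)); rewrite expr0n mul0r.
  by apply: eq_ccvg => M; rewrite fmorphV rmorph_nat exprVn.
have := ccvgB (ccvgM num (ccvgV den_neq0 den)) corr; rewrite subr0.
apply: eq_ccvg => M.
rewrite /cotsum [RHS]mulrBr PE; last exact/normc_nome_lt1/upper_divn.
by rewrite exprMn invfM mulrCA.
Qed.

Lemma ccvg_cotsum_pair s z j : upper_half_plane z ->
  ccvg (fun K => cotsum_pair s z K j)
       (pole s (z + j.+1%:R) + pole s (z - j.+1%:R)).
Proof.
move=> z0; have zD := upperD_nat j.+1 z0; have zB := upperB_nat j.+1 z0.
apply: eq_ccvg (ccvgD (ccvg_cotsum_pole s zD) (ccvg_cotsum_pole s zB)) => K.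
by rewrite /cotsum_pair [RHS]mulrDr.
Qed.

Lemma normc_1Bnome_shift_ge z : upper_half_plane z -> exists2 c : R, 0 < c &
  forall K (n : int), 2 * `|complex.Re z| <= K%:R -> `|n%:~R : R| <= K%:R ->
    c * `|n%:~R| <=
    (K.*2.+1)%:R * normc (1 - nome ((z + n%:~R) / (K.*2.+1)%:R)).
Proof.
move=> z0; have [|c c0 nome_ge] := @normc_1Bnome_ge _ (complex.Im z) (3 / 4).
  by lra.
have [d d0 lattice_ge] := normc_lattice_ge z0.
exists (c * d); first exact: mulr_gt0.
move=> K n zK nK; set M := K.*2.+1; set t : R := n%:~R.
have M0 : 0 < M%:R :> R by rewrite ltr0n.
have ME : M%:R = K%:R * 2 + 1 :> R by rewrite /M -natr1 -muln2 natrM.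
have wE : (z + n%:~R) / M%:R =
    (((complex.Re z + t) / M%:R) +i* (complex.Im z / M%:R))%C.
  rewrite natr_complex -fmorphV -(rmorph_int (real_complex R)).
  by case: z {z0 zK nome_ge lattice_ge} => a b; apply: complex_ext => /=; ring.
have w0 : upper_half_plane ((z + n%:~R) / M%:R).
  by apply: upper_divn => //; exact: upperD_int.
have Re_w : `|complex.Re ((z + n%:~R) / M%:R)| <= 3 / 4.
  rewrite wE /= normrM normfV (gtr0_norm M0) ler_pdivrMr//.
  by have := ler_normD (complex.Re z) t; rewrite ME; lra.
have Im_w : complex.Im ((z + n%:~R) / M%:R) <= complex.Im z.
  by rewrite wE /= ler_pdivrMr// ler_peMr ?(ltW z0)// ler1n.
have := nome_ge _ w0 Im_w Re_w.
rewrite normcM normcV normc_nat mulrA ler_pdivrMr// [X in _ <= X]mulrC.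
apply: le_trans; rewrite -mulrA ler_pM2l//.
have := lattice_ge 1 t; rewrite rmorph1 mul1r rmorph_int normr1.
by apply: le_trans; rewrite ler_pM2l// lerDr.
Qed.

Lemma cotsum0_pairE x y : upper_half_plane x -> upper_half_plane y ->
  cotsum 0 x + cotsum 0 y =
  (1 - nome (x + y)) / ((1 - nome x) * (1 - nome y)).
Proof.
move=> x0 y0; rewrite /cotsum !powsum0E ?normc_nome_lt1// eqxx nomeD.
by rewrite mulr1n; field; rewrite !nome_upper_neq1.
Qed.

Lemma cotsum0_pair_le z : upper_half_plane z -> exists2 B : R, 0 < B &
  forall K j : nat, 2 * `|complex.Re z| <= K%:R -> (j < K)%N ->
    normc (cotsum_pair 0 z K j) <= B * j.+1%:R ^- 2.
Proof.
move=> z0; have [c c0 nome_ge] := normc_1Bnome_shift_ge z0.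
have [B B0 slope_le] := ccvg_bounded (ccvg_nome_slope (2 * z)).
exists (B / c ^+ 2); first by rewrite divr_gt0 ?exprn_gt0.
move=> K j zK jK; rewrite /cotsum_pair; set M := K.*2.+1.
pose w1 := (z + j.+1%:R) / M%:R; pose w2 := (z - j.+1%:R) / M%:R.
have w1_ge : c * j.+1%:R <= M%:R * normc (1 - nome w1).
  by have := nome_ge K j.+1%:Z zK; rewrite normr_nat ler_nat; exact.
have w2_ge : c * j.+1%:R <= M%:R * normc (1 - nome w2).
  have := nome_ge K (- j.+1%:Z) zK; rewrite !mulrNz normrN normr_nat ler_nat.
  exact.
have w1_up : upper_half_plane w1 by apply: upper_divn => //; exact: upperD_nat.
have w2_up : upper_half_plane w2 by apply: upper_divn => //; exact: upperB_nat.
rewrite -/w1 -/w2 cotsum0_pairE//.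
have -> : w1 + w2 = 2 * z / M%:R by rewrite /w1 /w2; ring.
have := slope_le K.*2.
rewrite -/M !normcM !normcV normcX normcM !normc_nat expr1.
set A := normc (1 - nome (2 * z / _)).
have w1_gt0 : 0 < normc (1 - nome w1) by rewrite normc_gt0 nome_upper_neq1.
have w2_gt0 : 0 < normc (1 - nome w2) by rewrite normc_gt0 nome_upper_neq1.
move: (normc (1 - nome w1)) (normc (1 - nome w2)) w1_gt0 w2_gt0 w1_ge w2_ge.
move=> a1 a2 a1_gt0 a2_gt0 a1_ge a2_ge A_le.
have M0 : 0 < M%:R :> R by rewrite ltr0n.
have j0 : 0 < c * j.+1%:R by rewrite mulr_gt0 ?ltr0n.
have -> : M%:R^-1 * (A / (a1 * a2)) = (M%:R * A) / ((M%:R * a1) * (M%:R * a2)).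
  by field; rewrite !gt_eqF.
have -> : B / c ^+ 2 * j.+1%:R ^- 2 = B / ((c * j.+1%:R) * (c * j.+1%:R)).
  by rewrite -mulrA -invfM -exprMn expr2.
apply: ler_pM => //.
- by rewrite mulr_ge0 ?normc_ge0.
- by rewrite invr_ge0 !mulr_ge0 ?ltW.
by rewrite lef_pV2 ?posrE ?mulr_gt0//; apply: ler_pM => //; exact: ltW.
Qed.

Lemma cotsumS_pair_le s z : upper_half_plane z -> exists2 B : R, 0 < B &
  forall K j : nat, 2 * `|complex.Re z| <= K%:R -> (j < K)%N ->
    normc (cotsum_pair s.+1 z K j) <= B * j.+1%:R ^- 2.
Proof.
move=> z0; have [c c0 nome_ge] := normc_1Bnome_shift_ge z0.
have [B B0 powsum_le] := @powsum_le R s.+1.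
exists (2 * (B / c ^+ s.+2)) => [|K j zK jK].
  by rewrite mulr_gt0// divr_gt0 ?exprn_gt0.
set M := K.*2.+1; have M0 : 0 < M%:R :> R by rewrite ltr0n.
have term_le (n : int) : `|n%:~R : R| = j.+1%:R ->
    normc (M%:R ^- s.+2 * cotsum s.+1 ((z + n%:~R) / M%:R)) <=
    B / c ^+ s.+2 * j.+1%:R ^- 2.
  move=> nj; have w0 : upper_half_plane ((z + n%:~R) / M%:R).
    by apply: upper_divn => //; exact: upperD_int.
  rewrite cotsumS normcM normcV normcX normc_nat.
  have := nome_ge K n zK; rewrite nj ler_nat => /(_ jK).
  rewrite -/M; set w := (z + n%:~R) / M%:R in w0 * => nome_ge_n.
  apply: (@le_trans _ _ (B / (M%:R * normc (1 - nome w)) ^+ s.+2)).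
    rewrite exprMn [in leRHS]invfM [leRHS]mulrCA.
    rewrite ler_pM2l ?invr_gt0 ?exprn_gt0//.
    exact/powsum_le/normc_nome_lt1.
  have cj0 : 0 < c * j.+1%:R by rewrite mulr_gt0 ?ltr0n.
  rewrite -mulrA ler_pM2l// -invfM lef_pV2 ?posrE; last 2 first.
  - by rewrite exprn_gt0// (lt_le_trans cj0).
  - by rewrite mulr_gt0 ?exprn_gt0 ?ltr0n.
  apply: (@le_trans _ _ ((c * j.+1%:R) ^+ s.+2)).
    by rewrite exprMn ler_pM2l ?exprn_gt0// ler_weXn2l// ler1n.
  by rewrite lerXn2r ?nnegrE ?(ltW cj0)// (le_trans (ltW cj0)).
rewrite /cotsum_pair -/M [X in normc X]mulrDr -mulrA mulr_natl mulr2n.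
rewrite (le_trans (le_normcD _ _))// lerD//.
  by apply: (term_le j.+1%:Z); rewrite normr_nat.
by have := term_le (- j.+1%:Z); rewrite !mulrNz normrN normr_nat; exact.
Qed.

Lemma cotsum_pair_le s z : upper_half_plane z -> exists2 B : R, 0 < B &
  forall K j : nat, 2 * `|complex.Re z| <= K%:R -> (j < K)%N ->
    normc (cotsum_pair s z K j) <= B * j.+1%:R ^- 2.
Proof.
by case: s => [|s]; [exact: cotsum0_pair_le|exact: cotsumS_pair_le].
Qed.

(* The distribution relation writes [cotsum s z] as a sum over residues modulo
   [2K+1]; letting K grow, only the polar parts survive. For s = 0 the limit is
   the partial fraction expansion of the cotangent. *)
Lemma lipschitz_formula s z : upper_half_plane z ->
  csum (fun j => pole s (z + j.+1%:R) + pole s (z - j.+1%:R))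
       (cotsum s z - pole s z).
Proof.
move=> z0; have [B B0 pair_le] := cotsum_pair_le s z0.
have [K0 zK0] : exists K0 : nat, 2 * `|complex.Re z| <= K0%:R.
  exists (Num.truncn (2 * `|complex.Re z|)).+1.
  by apply: ltW; rewrite truncnS_gt.
pose u K j := if (j < K + K0)%N then cotsum_pair s z (K + K0) j else 0.
pose v j := pole s (z + j.+1%:R) + pole s (z - j.+1%:R).
have u_le K j : normc (u K j) <= B * j.+1%:R ^- 2.
  rewrite /u; case: ifP => jK; last first.
    by rewrite normc0 mulr_ge0 ?(ltW B0)// invr_ge0 sqr_ge0.
  by apply: pair_le => //; apply: le_trans zK0 _; rewrite ler_nat leq_addl.
have u_v j : ccvg (u^~ j) (v j).
  apply: near_eq_ccvg (ccvg_comp (@cvg_addnr K0) (ccvg_cotsum_pair s j z0)).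
  by exists j.+1 => // K /= jK; rewrite /u (leq_trans jK)// leq_addr.
have v_le j : normc (v j) <= B * j.+1%:R ^- 2.
  exact: ccvg_normc_le (u_le^~ j) (u_v j).
have cvb := @is_cvg_seriesZ_inv_sqr B.
have [t v_t] := csum_dominated v_le cvb.
have u_sum K : csum (u K) (\sum_(0 <= j < K + K0) u K j).
  by apply: csum_finite => j; rewrite /u ltnNge => ->.
suff -> : cotsum s z - pole s z = t by [].
apply: ccvg_unique (tannery u_sum v_t u_v u_le cvb).
have := ccvg_comp (@cvg_addnr K0) (ccvg_cotsum_pole s z0).
move=> /(ccvgB (ccvg_cst (cotsum s z))); apply: eq_ccvg => K /=.
rewrite {1}(cotsum_sum_pairs s (K + K0) z0) addrAC subrr add0r !big_nat.
by apply: eq_bigr => j /= jK; rewrite /u jK.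
Qed.

End Lipschitz.

Section LambertSeries.
Context {R : realType}.
Implicit Types (q z : R[i]) (s d n : nat).

Section DivisorSums.
Variables (T : Type) (idx : T) (op : Monoid.com_law idx).

Lemma big_codivisors n (F : nat -> T) : (0 < n)%N ->
  \big[op/idx]_(d <- divisors n) F (n %/ d)%N =
  \big[op/idx]_(d <- divisors n) F d.
Proof.
move=> n0; rewrite -(big_map (divn n) xpredT F); apply: perm_big.
have codivK d : (d %| n)%N -> (n %/ (n %/ d) = d)%N.
  move=> dn; have d0 := dvdn_gt0 n0 dn.
  by rewrite -[X in (X %/ _)%N](divnK dn) mulKn// divn_gt0// dvdn_leq.
apply: uniq_perm => [||d]; last 1 first.
- apply/mapP/idP => [[e]|]; rewrite -!dvdn_divisors//.
    by move=> en ->; exact: dvdn_div.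
  move=> dn; exists (n %/ d)%N; last by rewrite codivK.
  by rewrite -dvdn_divisors// dvdn_div.
- rewrite map_inj_in_uniq ?divisors_uniq// => d e.
  rewrite -!dvdn_divisors// => dn en divE.
  by rewrite -(codivK d)// divE codivK.
- exact: divisors_uniq.
Qed.

Lemma big_divisors_range n (F : nat -> T) : (0 < n)%N ->
  \big[op/idx]_(d <- divisors n) F d =
  \big[op/idx]_(0 <= d < n | (d.+1 %| n)%N) F d.+1.
Proof.
move=> n0; rewrite -(big_add1 idx op 0 n.+1 (fun d => d %| n)%N F).
rewrite -[RHS]big_filter.
apply: perm_big; apply: uniq_perm.
- exact: divisors_uniq.
- by rewrite filter_uniq// iota_uniq.
move=> d; rewrite -dvdn_divisors// mem_filter mem_index_iota.
case: (boolP (d %| n)%N) => //= dn.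
by rewrite ltnS (dvdn_leq n0 dn) (dvdn_gt0 n0 dn).
Qed.

End DivisorSums.

Lemma sigma1n s : sigma s 1 = 1%N.
Proof. by rewrite /sigma /divisors /= big_seq1 exp1n. Qed.

(* Row d collects the multiples n of d + 1; column n then sums to sigma n. *)
Definition lambert_term s q d n : R[i] :=
  if (d.+1 %| n)%N then (n %/ d.+1)%:R ^+ s * (q ^+ d.+1) ^+ (n %/ d.+1) else 0.

Lemma csum_lambert_row s q d : normc q < 1 ->
  csum (lambert_term s q d) (powsum s (q ^+ d.+1)).
Proof.
move=> q1; have qd1 : normc (q ^+ d.+1) < 1.
  by rewrite normcX exprn_ilt1// normc_ge0.
exact: csum_stretch (ltn0Sn d) (csum_powsum s qd1).
Qed.

Lemma lambert_row_le s q : normc q < 1 -> exists T : R, forall d M,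
  \sum_(0 <= n < M) normc (lambert_term s.+1 q d n) <= geometric T (normc q) d.
Proof.
move=> q1; have q0 := normc_ge0 q; have q01 : 0 <= normc q < 1 by rewrite q0.
pose b n : R := n%:R ^+ s.+1 * normc q ^+ n.
have b0 n : 0 <= b n by rewrite mulr_ge0 ?exprn_ge0.
exists (limn (series b)) => d M.
rewrite -[leLHS]/(series (fun n => normc (lambert_term s.+1 q d n)) M).
rewrite (@series_multiples _ _ d.+1)//; last first.
  by move=> n /negbTE dn; rewrite /lambert_term dn normc0.
apply: (@le_trans _ _ (series b ((M + d) %/ d.+1)%N * normc q ^+ d)).
  rewrite /series /= mulr_suml; apply: ler_sum => r _.
  rewrite /lambert_term dvdn_mulr// mulKn// normcM !normcX normc_nat /b.
  case: r => [|r]; first by rewrite !expr0n /= !mul0r.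
  rewrite -mulrA ler_wpM2l ?exprn_ge0//.
  by rewrite -exprM -exprD ler_wiXn2l ?(ltW q1)//; nia.
rewrite ler_wpM2r ?exprn_ge0//; apply: series_le_lim b0 _.
exact: is_cvg_series_pow_geometric.
Qed.

Lemma csum_lambert_col0 s q : csum (fun d => lambert_term s.+1 q d 0) 0.
Proof.
apply: eq_csum csum0 => d.
by rewrite /lambert_term dvdn0 div0n expr0n mul0r.
Qed.

Lemma csum_lambert_col s q n : (0 < n)%N ->
  csum (fun d => lambert_term s.+1 q d n) ((sigma s.+1 n)%:R * q ^+ n).
Proof.
move=> n0.
have -> : (sigma s.+1 n)%:R * q ^+ n =
    \sum_(0 <= d < n) lambert_term s.+1 q d n.
  rewrite /sigma -(big_codivisors _ (fun d => d ^ s.+1)%N n0).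
  rewrite (big_divisors_range _ _ n0) natr_sum mulr_suml big_mkcond /=.
  apply: eq_bigr => d _; rewrite /lambert_term; case: ifP => // dn.
  by rewrite natrX -exprM mulnC divnK.
by apply: csum_finite => d nd; rewrite /lambert_term gtnNdvd.
Qed.

Lemma lambert s z : upper_half_plane z -> exists L : R[i],
  csum (fun d => powsum s.+1 (nome (d.+1%:R * z))) L /\
  csum (fun n => (sigma s.+1 n.+1)%:R * nome z ^+ n.+1) L.
Proof.
move=> /normc_nome_lt1 q1; set q := nome z in q1 *.
have [T rows_le] := lambert_row_le s q1.
have cvT : cvgn (series (geometric T (normc q))).
  by apply: is_cvg_geometric_series; rewrite ger0_norm ?normc_ge0.
have [Srow [Scol [L [row col Srow_L Scol_L]]]] := csum_exchange rows_le cvT.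
exists L; split.
  apply: eq_csum Srow_L => d; rewrite nomeMn.
  exact: csum_unique (row d) (csum_lambert_row _ _ q1).
have := csum_behead Scol_L.
rewrite (csum_unique (col 0%N) (csum_lambert_col0 _ _)) subr0.
by apply: eq_csum => n; exact: csum_unique (col _) (csum_lambert_col _ _ _).
Qed.

Lemma csum_exchange_inv_sqr (a : nat -> nat -> R[i]) (C : R) :
  (forall d n, normc (a d n) <= C * d.+1%:R ^- 2 * n.+1%:R ^- 2) ->
  exists Srow Scol t, [/\ forall d, csum (a d) (Srow d),
    forall n, csum (a^~ n) (Scol n), csum Srow t & csum Scol t].
Proof.
move=> a_le; pose b (n : nat) : R := n.+1%:R ^- 2.
have b0 n : 0 <= b n by rewrite invr_ge0 exprn_ge0.
have C0 : 0 <= C.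
  by have := le_trans (normc_ge0 _) (a_le 0%N 0%N); rewrite expr1n invr1 !mulr1.
apply: (@csum_exchange _ _ (fun d => C * limn (series b) * b d)); last first.
  exact: is_cvg_seriesZ_inv_sqr.
move=> d M; apply: (@le_trans _ _ (C * b d * series b M)).
  by rewrite /series /= mulr_sumr; apply: ler_sum => n _; exact: a_le.
rewrite mulrAC ler_wpM2r// ler_wpM2l//.
exact/series_le_lim/is_cvg_series_inv_sqr.
Qed.

End LambertSeries.

Section BernoulliNumbers.
Context {R : realType}.
Implicit Types (t K : R) (n l : nat).

Lemma size_bernoulli_seq n : size (bernoulli_seq n) = n.
Proof. by elim: n => //= n IHn; rewrite size_rcons IHn. Qed.

Lemma nth_bernoulli_seq n j : (j < n)%N ->
  (bernoulli_seq n)`_j = bernoulli_number j.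
Proof.
elim: n => // n IHn; rewrite ltnS leq_eqVlt => /predU1P[->//|jn].
by rewrite /= nth_rcons size_bernoulli_seq jn IHn.
Qed.

Lemma bernoulli_numberE n : bernoulli_number n =
  ((n == 0%N)%:R - \sum_(j < n) 'C(n.+1, j)%:R * bernoulli_number j) / n.+1%:R.
Proof.
rewrite {1}/bernoulli_number /= nth_rcons size_bernoulli_seq ltnn eqxx.
congr ((_ - _) / _); apply: eq_bigr => j _.
by rewrite nth_bernoulli_seq.
Qed.

Lemma bernoulli_unique (K : numFieldType) (beta : nat -> K) :
  (forall n, \sum_(0 <= j < n.+1) 'C(n.+1, j)%:R * beta j = (n == 0%N)%:R) ->
  forall n, ratr (bernoulli_number n) = beta n.
Proof.
move=> betaE; elim/ltn_ind => n IHn.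
rewrite bernoulli_numberE fmorph_div /= rmorphB /= rmorph_nat raddf_sum /=.
have := betaE n; rewrite big_nat_recr//= big_mkord binSn.
under [X in _ - X]eq_bigr => j _ do rewrite rmorphM /= ratr_nat IHn ?ltn_ord//.
by move=> <-; rewrite addrAC subrr add0r ratr_nat mulrAC divff ?mul1r.
Qed.

Lemma eq0_norm_le_small (C c : R) :
  (forall t, 0 < t -> t <= 1 -> `|c| <= C * t) -> c = 0.
Proof.
move=> small; apply/eqP; rewrite -normr_le0; apply/ler_addgt0Pr => e e0.
rewrite add0r; have C0 : 0 < `|C| + 1 by rewrite ltr_wpDl.
pose t := Num.min 1 (e / (`|C| + 1)).
have t0 : 0 < t by rewrite lt_min ltr01 divr_gt0.
have t1 : t <= 1 by rewrite ge_min lexx.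
have te : t * (`|C| + 1) <= e by rewrite -ler_pdivlMr// ge_min lexx orbT.
apply: le_trans (small t t0 t1) _; apply: le_trans te.
by rewrite mulrC ler_pM2l// (le_trans (ler_norm C))// lerDl.
Qed.

Lemma coef_eq0_horner_le K n (Q : {poly R}) :
  (forall t, 0 < t -> t <= 1 -> `|Q.[t]| <= K * t ^+ n) ->
  forall i, (i < n)%N -> Q`_i = 0.
Proof.
elim: n Q => // n IHn Q Q_le.
have [P [c QE]] : exists P c, Q = P * 'X + c%:P.
  elim/poly_ind: Q {Q_le} => [|P c _]; last by exists P, c.
  by exists 0, 0; rewrite mul0r add0r.
pose B := \sum_(i < size P) `|P`_i|.
have K0 : 0 <= K.
  by have := Q_le 1 ltr01 (lexx 1); rewrite expr1n mulr1; apply: le_trans.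
have c0 : c = 0.
  apply: (@eq0_norm_le_small (K + B)) => t t0 t1.
  have -> : c = Q.[t] - P.[t] * t by rewrite QE !hornerE; ring.
  rewrite (le_trans (ler_normB _ _))// mulrDl lerD//.
    rewrite (le_trans (Q_le t t0 t1))// ler_wpM2l// exprS.
    by rewrite ler_piMr ?(ltW t0)// exprn_ile1// ltW.
  rewrite normrM (gtr0_norm t0) ler_wpM2r ?(ltW t0)//.
  have t_norm : `|t| <= 1 by rewrite gtr0_norm.
  apply: le_trans (normr_horner_le P t_norm) _; rewrite /B.
  by under eq_bigr do rewrite expr1n mulr1.
have P_le t : 0 < t -> t <= 1 -> `|P.[t]| <= K * t ^+ n.
  move=> t0 t1; have := Q_le t t0 t1.
  rewrite QE c0 !hornerE normrM (gtr0_norm t0).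
  by rewrite exprSr mulrA ler_pM2r.
move=> [|i] i_lt; rewrite QE c0 addr0 coefMX//=.
exact: IHn P_le _ i_lt.
Qed.

Lemma leq_fact_add i n : (i`! <= (i + n)`!)%N.
Proof.
elim: n => [|n IHn]; first by rewrite addn0.
by rewrite addnS factS (leq_trans IHn)// leq_pmull.
Qed.

Lemma expR_taylor_le n t : 0 <= t -> t <= 1 ->
  `|expR t - \sum_(i < n) t ^+ i / i`!%:R| <= expR 1 * t ^+ n.
Proof.
move=> t0 t1.
have exp_ge0 (x : R) : 0 <= x -> forall i, 0 <= exp_coeff x i.
  by move=> x0 i; exact: exp_coeff_ge0.
have cv (x : R) : cvgn (series (exp_coeff x)) by exact: is_cvg_series_exp_coeff.
have -> : \sum_(i < n) t ^+ i / i`!%:R = series (exp_coeff t) n.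
  by rewrite /series/= big_mkord.
rewrite ger0_norm; last first.
  by rewrite subr_ge0; exact: series_le_lim (exp_ge0 t t0) (cv t).
have tail_cvg : (fun N => series (exp_coeff t) (N + n)%N -
    series (exp_coeff t) n) @ \oo --> expR t - series (exp_coeff t) n.
  apply: cvgB; last exact: cvg_cst.
  by rewrite (cvg_shiftn n (series (exp_coeff t))); exact: cv.
rewrite -(cvg_lim (@Rhausdorff R) tail_cvg).
apply: limr_le; first exact: cvgP tail_cvg.
apply: nearW => N; rewrite sub_series_geq ?leq_addl//.
rewrite -{1}[n]add0n big_addn addnK.
apply: (@le_trans _ _ (series (exp_coeff (1 : R)) N * t ^+ n)); last first.
  rewrite ler_wpM2r ?exprn_ge0//.
  exact: series_le_lim (exp_ge0 1 ler01) (cv 1).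
rewrite /series /= mulr_suml; apply: ler_sum => i _.
rewrite /exp_coeff /= expr1n div1r exprD mulrAC ler_wpM2r ?exprn_ge0//.
apply: (@le_trans _ _ ((i + n)`!%:R^-1)).
  by rewrite ler_piMl ?invr_ge0// exprn_ile1.
by rewrite lef_pV2 ?posrE ?ltr0n ?fact_gt0// ler_nat leq_fact_add.
Qed.

Definition pole_sqr (j : nat) : R := (2 * pi * j.+1%:R) ^+ 2.

Lemma pole_sqr_ge j : j.+1%:R ^+ 2 <= pole_sqr j.
Proof.
rewrite /pole_sqr lerXn2r ?nnegrE// ?mulr_ge0 ?pi_ge0//.
by rewrite ler_peMl//; have := @pi_ge2 R; lra.
Qed.

Lemma pole_sqr_ge1 j : 1 <= pole_sqr j.
Proof. by apply: le_trans (pole_sqr_ge j); rewrite exprn_ege1// ler1n. Qed.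

Lemma pole_sqr_gt0 j : 0 < pole_sqr j.
Proof. exact: lt_le_trans ltr01 (pole_sqr_ge1 j). Qed.

Lemma sqrD_pole_sqr_gt0 t j : 0 < t ^+ 2 + pole_sqr j.
Proof. by rewrite ltr_wpDl ?sqr_ge0 ?pole_sqr_gt0. Qed.

(* The sum of (2 pi j)^(-2 l), that is, zeta (2 l) / (2 pi)^(2 l). *)
Definition even_zeta l : R := limn (series (fun j => pole_sqr j ^- l)).

Lemma cvg_even_zeta l : (0 < l)%N ->
  series (fun j => pole_sqr j ^- l) @ \oo --> even_zeta l.
Proof.
case: l => // l _.
apply: (@series_le_cvg _ _ (fun j : nat => (j.+1%:R ^- 2 : R))) => [j|j|j|].
- by rewrite invr_ge0 exprn_ge0// ltW// pole_sqr_gt0.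
- by rewrite invr_ge0 exprn_ge0.
- rewrite lef_pV2 ?posrE; [|exact/exprn_gt0/pole_sqr_gt0|exact: exprn_gt0].
  by apply: le_trans (pole_sqr_ge j) _; rewrite ler_eXnr// pole_sqr_ge1.
- exact: is_cvg_series_inv_sqr.
Qed.

Lemma even_zeta_gt0 l : (0 < l)%N -> 0 < even_zeta l.
Proof.
move=> l0; apply: series_gt0_lim_gt0 (cvg_even_zeta l0) => j.
by rewrite invr_gt0 exprn_gt0// pole_sqr_gt0.
Qed.

Lemma sqr_twopii_nat j :
  (twopii * j.+1%:R) ^+ 2 = - ((pole_sqr j)%:C)%C :> R[i].
Proof.
by rewrite /twopii /pole_sqr natr_complex; apply: complex_ext => /=; ring.
Qed.

Definition coth_point t : R[i] := (0 +i* (t / (2 * pi)))%C.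

Lemma twopii_coth_point t : - (twopii * coth_point t) = (t%:C)%C.
Proof.
have : pi != 0 :> R by rewrite gt_eqF// pi_gt0.
rewrite /twopii /coth_point; move: pi => p p0.
by apply: complex_ext => /=; [field|ring].
Qed.

Lemma nome_coth_point t : nome (coth_point t) = ((expR (- t))%:C)%C.
Proof.
have : pi != 0 :> R by rewrite gt_eqF// pi_gt0.
rewrite nomeE mulr0 cos0 sin0 !mulr0 mulr1; move: pi => p p0.
by congr (expR _ +i* _)%C; field.
Qed.

Lemma pole0_coth_point t (x : R[i]) :
  pole 0 (coth_point t + x) = ((t%:C)%C - twopii * x)^-1.
Proof. by rewrite /pole fact0 div1r expr1 mulrDr opprD twopii_coth_point. Qed.

Lemma pole0_pair_coth_point t j : 0 < t ->
  pole 0 (coth_point t + j.+1%:R) + pole 0 (coth_point t - j.+1%:R) =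
  ((2 * t / (t ^+ 2 + pole_sqr j))%:C)%C.
Proof.
move=> t0; rewrite !pole0_coth_point mulrN opprK.
have prodE : ((t%:C)%C - twopii * j.+1%:R) * ((t%:C)%C + twopii * j.+1%:R) =
    ((t ^+ 2 + pole_sqr j)%:C)%C.
  by rewrite -subr_sqr sqr_twopii_nat opprK -rmorphXn -rmorphD.
have : ((t ^+ 2 + pole_sqr j)%:C)%C != 0 :> R[i].
  by rewrite (inj_eq (@complexI R) _ 0) gt_eqF// sqrD_pole_sqr_gt0.
rewrite -prodE mulf_eq0 negb_or => /andP[].
rewrite rmorphM fmorphV /= -prodE rmorphM rmorph_nat /=.
move: (twopii * _) (t%:C)%C => a T TB TD.
by field; rewrite TB TD.
Qed.

Lemma cvg_coth t : 0 < t ->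
  series (fun j => 2 * t / (t ^+ 2 + pole_sqr j)) @ \oo -->
  ((1 - expR (- t))^-1 - 1 / 2 - t^-1).
Proof.
move=> t0; have z0 : upper_half_plane (coth_point t).
  by rewrite /upper_half_plane /= divr_gt0// mulr_gt0// pi_gt0.
have -> : (1 - expR (- t))^-1 - 1 / 2 - t^-1 =
    complex.Re (cotsum 0 (coth_point t) - pole 0 (coth_point t)).
  have := pole0_coth_point t 0; rewrite addr0 mulr0 subr0 => ->.
  rewrite /cotsum powsum0E ?normc_nome_lt1// nome_coth_point.
  by rewrite -!(rmorph1 (real_complex R), rmorph_nat (real_complex R),
    rmorphB, fmorphV, rmorphM).
have := eq_csum (fun j => pole0_pair_coth_point j t0) (lipschitz_formula 0 z0).
move=> /ccvg_Re; apply: cvg_trans; apply: near_eq_cvg; apply: nearW => n.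
by rewrite /series/= raddf_sum.
Qed.

(* Taylor coefficients at 0 of t / (e^t - 1), read off from [cvg_coth]. *)
Definition todd_coef (i : nat) : R :=
  if i == 0%N then 1 else if i == 1%N then - (1 / 2)
  else if odd i then 0 else 2 * (-1) ^+ (i./2).-1 * even_zeta i./2.

Definition todd_rest (L : nat) t (j : nat) : R :=
  t ^+ (2 * L.+1) / (pole_sqr j ^+ L * (t ^+ 2 + pole_sqr j)).

Lemma cvg_todd_rest0 t : 0 < t -> series (todd_rest 0 t) @ \oo -->
  (t / (expR t - 1) - 1 + t / 2) / 2.
Proof.
move=> t0; have t_neq0 : t != 0 by rewrite gt_eqF.
have expB1 : expR t - 1 != 0 by rewrite subr_eq0 gt_eqF// expR_gt1.
have exp0 : expR t != 0 by rewrite gt_eqF// expR_gt0.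
have -> : (t / (expR t - 1) - 1 + t / 2) / 2 =
    t / 2 * ((1 - expR (- t))^-1 - 1 / 2 - t^-1).
  have -> : 1 - expR (- t) = (expR t - 1) / expR t.
    by rewrite expRN mulrBl divff// div1r.
  by field; apply/and3P; split.
rewrite (_ : todd_rest 0 t = fun j => t / 2 * (2 * t / (t ^+ 2 + pole_sqr j))).
  exact/cvg_seriesZ/cvg_coth.
apply/funext => j; rewrite /todd_rest muln1 expr0.
by field; rewrite gt_eqF// sqrD_pole_sqr_gt0.
Qed.

Lemma cvg_todd_restS L t (W : R) : series (todd_rest L t) @ \oo --> W ->
  series (todd_rest L.+1 t) @ \oo --> t ^+ (2 * L.+1) * even_zeta L.+1 - W.
Proof.
move=> cvW.
have cvZ := @cvg_seriesZ _ (t ^+ (2 * L.+1)) _ _ (cvg_even_zeta (ltn0Sn L)).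
rewrite (_ : series (todd_rest L.+1 t) = fun n =>
    series (fun j => t ^+ (2 * L.+1) * pole_sqr j ^- L.+1) n -
    series (todd_rest L t) n); first exact: cvgB cvZ cvW.
apply/funext => n; rewrite /series/= -sumrB; apply: eq_bigr => j _.
rewrite /todd_rest [(2 * L.+2)%N](_ : _ = 2 * L.+1 + 2)%N; last by lia.
rewrite exprD (exprS (pole_sqr j)).
have : pole_sqr j ^+ L != 0 by rewrite expf_neq0// gt_eqF// pole_sqr_gt0.
have : t ^+ 2 + pole_sqr j != 0 by rewrite gt_eqF// sqrD_pole_sqr_gt0.
have : pole_sqr j != 0 by rewrite gt_eqF// pole_sqr_gt0.
move: (pole_sqr j ^+ L) (t ^+ (2 * L.+1)) (pole_sqr j) => a b x x0 xD0 a0.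
by field; rewrite x0 xD0 a0.
Qed.

Lemma todd_expansion L t : 0 < t -> exists2 W : R,
  series (todd_rest L t) @ \oo --> W &
  t / (expR t - 1) =
    \sum_(i < 2 * L.+1) todd_coef i * t ^+ i + 2 * (-1) ^+ L * W.
Proof.
move=> t0; elim: L => [|L [W cvW expansion]].
  exists ((t / (expR t - 1) - 1 + t / 2) / 2); first exact: cvg_todd_rest0.
  rewrite muln1 !big_ord_recr big_ord0 /= /todd_coef /= add0r !expr0 expr1.
  by field; rewrite subr_eq0 gt_eqF// expR_gt1.
exists (t ^+ (2 * L.+1) * even_zeta L.+1 - W); first exact: cvg_todd_restS.
rewrite expansion [(2 * L.+2)%N](_ : _ = (2 * L.+1).+2)%N; last by lia.
have coef_odd : todd_coef (2 * L.+1).+1 = 0.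
  by rewrite /todd_coef mul2n /= odd_double.
have coef_even : todd_coef (2 * L.+1) = 2 * (-1) ^+ L * even_zeta L.+1.
  by rewrite /todd_coef mul2n /= odd_double /= doubleK.
rewrite [in RHS]big_ord_recr [in RHS]big_ord_recr /= coef_odd coef_even.
by rewrite (exprS (-1)); ring.
Qed.

Lemma todd_taylor_le L t : 0 < t ->
  `|t / (expR t - 1) - \sum_(i < 2 * L.+1) todd_coef i * t ^+ i| <=
  2 * even_zeta L.+1 * t ^+ (2 * L.+1).
Proof.
move=> t0; have [W cvW ->] := todd_expansion L t0.
have W0 : 0 < W.
  apply: series_gt0_lim_gt0 cvW => j; rewrite divr_gt0 ?exprn_gt0// mulr_gt0//.
    exact/exprn_gt0/pole_sqr_gt0.
  exact: sqrD_pole_sqr_gt0.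
rewrite addrAC subrr add0r !normrM normrX normrN1 expr1n mulr1 normr_nat.
rewrite gtr0_norm// -mulrA ler_pM2l//.
have cv_major :=
  @cvg_seriesZ _ (t ^+ (2 * L.+1)) _ _ (cvg_even_zeta (ltn0Sn L)).
rewrite mulrC; apply: ler_cvg_to cvW cv_major _; apply: nearW => n.
rewrite /series/=; apply: ler_sum => j _; rewrite ler_pM2l ?exprn_gt0//.
have pj := pole_sqr_gt0 j; have pL : 0 < pole_sqr j ^+ L by exact: exprn_gt0.
rewrite lef_pV2 ?posrE; last 2 first.
- by rewrite mulr_gt0 ?sqrD_pole_sqr_gt0.
- exact: exprn_gt0.
by rewrite exprSr ler_pM2l// lerDr sqr_ge0.
Qed.

Definition expB1_poly n : {poly R} :=
  \poly_(i < n) (if i == 0%N then 0 else i`!%:R^-1).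

Definition todd_poly n : {poly R} := \poly_(i < n) todd_coef i.

Lemma expB1_poly_taylor_le n t : 0 <= t -> t <= 1 ->
  `|expR t - 1 - (expB1_poly n.+1).[t]| <= expR 1 * t ^+ n.+1.
Proof.
move=> t0 t1; have -> : expR t - 1 - (expB1_poly n.+1).[t] =
    expR t - \sum_(i < n.+1) t ^+ i / i`!%:R; last exact: expR_taylor_le.
rewrite horner_poly !big_ord_recl /= mul0r add0r fact0 divr1 expr0.
rewrite opprD addrA; congr (_ - _); apply: eq_bigr => i _.
by rewrite mulrC.
Qed.

Lemma expB1_todd_poly_le N : exists C : R, forall t, 0 < t -> t <= 1 ->
  `|(expB1_poly (2 * N.+1) * todd_poly (2 * N.+1) - 'X).[t]| <=
    C * t ^+ (2 * N.+1).
Proof.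
have [n nE] : exists n, (2 * N.+1 = n.+1)%N by exists (2 * N).+1; lia.
pose B := \sum_(i < size (todd_poly n.+1)) `|(todd_poly n.+1)`_i|.
exists (expR 1 * (2 * even_zeta N.+1) + expR 1 * B) => t t0 t1.
have expB1 : expR t - 1 != 0 by rewrite subr_eq0 gt_eqF// expR_gt1.
have := todd_taylor_le N t0.
rewrite nE -[X in _ - X]horner_poly -/(todd_poly _).
have := expB1_poly_taylor_le n (ltW t0) t1.
have todd_le : `|(todd_poly n.+1).[t]| <= B.
  have t_norm : `|t| <= 1 by rewrite gtr0_norm.
  apply: le_trans (normr_horner_le _ t_norm) _; rewrite /B.
  by under eq_bigr do rewrite expr1n mulr1.
have exp_le : `|expR t - 1| <= expR 1.
  rewrite ger0_norm; last by rewrite subr_ge0 ltW// expR_gt1.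
  by have : expR t <= expR 1; [rewrite ler_expR|lra].
have -> : (expB1_poly n.+1 * todd_poly n.+1 - 'X).[t] =
    - ((expR t - 1) * (t / (expR t - 1) - (todd_poly n.+1).[t])) -
    (expR t - 1 - (expB1_poly n.+1).[t]) * (todd_poly n.+1).[t].
  by rewrite !hornerE; field.
move: (todd_poly _).[t] (expB1_poly _).[t] todd_le => P A P_le A_near P_near.
rewrite (le_trans (ler_normB _ _))// normrN !normrM mulrDl lerD//.
  by rewrite -mulrA ler_pM.
by rewrite mulrAC ler_pM.
Qed.

Lemma todd_coef_recurrence N :
  \sum_(0 <= j < N.+1) todd_coef j / (N.+1 - j)`!%:R = (N == 0%N)%:R.
Proof.
set n := (2 * N.+1)%N; have Nn : (N.+1 < n)%N by rewrite /n; lia.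
have [C product_le] := expB1_todd_poly_le N.
have := coef_eq0_horner_le product_le Nn; rewrite -/n.
rewrite coefB coefX coefMr big_ord_recr /= subnn.
rewrite {2}/expB1_poly coef_poly muln_gt0 /= mul0r addr0.
move/eqP; rewrite subr_eq0 => /eqP; rewrite -[N.+1 == 1%N]/(N == 0%N) => <-.
rewrite big_mkord; apply: eq_bigr => j _; have jN := ltn_ord j.
rewrite /expB1_poly /todd_poly !coef_poly.
have -> : (N.+1 - j < n)%N by apply: leq_ltn_trans Nn; exact: leq_subr.
have -> : (j < n)%N by apply: ltn_trans jN Nn.
by rewrite subn_eq0 leqNgt jN /= mulrC.
Qed.

Lemma bernoulli_todd_coef n : ratr (bernoulli_number n) = n`!%:R * todd_coef n.
Proof.
move: n; apply: bernoulli_unique => n.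
have -> : (n == 0%N)%:R = n.+1`!%:R * (n == 0%N)%:R :> R.
  by case: n => [|n]; rewrite ?fact0 ?mul1r// !mulr0.
rewrite -todd_coef_recurrence mulr_sumr !big_nat; apply: eq_bigr => j /= jn.
rewrite -(bin_fact (ltnW jn)) !natrM.
have fact_neq0 : (n.+1 - j)`!%:R != 0 :> R by rewrite pnatr_eq0 -lt0n fact_gt0.
by field.
Qed.

Lemma bernoulli_even l : (0 < l)%N -> ratr (bernoulli_number l.*2) =
  l.*2`!%:R * (2 * (-1) ^+ l.-1 * even_zeta l).
Proof.
case: l => // l _; rewrite bernoulli_todd_coef; congr (_ * _).
by rewrite /todd_coef /= odd_double /= doubleK.
Qed.

End BernoulliNumbers.

Section EisensteinInversion.
Context {R : realType}.
Implicit Types (x y z : R[i]) (s l d n N : nat).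

Definition eis_const (k : nat) : R[i] :=
  - ratr (bernoulli_number k / (2 * k)%:R).

Lemma csum_eisenstein s z : upper_half_plane z ->
  csum (fun n => (sigma s.+1 n.+1)%:R * nome z ^+ n.+1)
       (eisenstein s.+2 z - eis_const s.+2) /\
  csum (fun d => powsum s.+1 (nome (d.+1%:R * z)))
       (eisenstein s.+2 z - eis_const s.+2).
Proof.
move=> z0; have [L [sum_powsum sum_sigma]] := lambert s z0.
suff -> : eisenstein s.+2 z - eis_const s.+2 = L by [].
by rewrite /eisenstein /eis_const addrAC subrr add0r (csum_lim sum_sigma).
Qed.

Lemma exprN_double (K : pzRingType) (x : K) n : (- x) ^+ n.*2 = x ^+ n.*2.
Proof. by rewrite exprNn -signr_odd odd_double mul1r. Qed.

Lemma poleM s x y : pole s (x * y) = pole s x / y ^+ s.+1.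
Proof. by rewrite /pole mulrA -mulNr exprMn invfM mulrA. Qed.

Lemma poleN s x : odd s -> pole s (- x) = pole s x.
Proof.
by move=> so; rewrite -mulrN1 poleM -signr_odd /= so expr0 divr1.
Qed.

Lemma pole_nat l d : pole l.*2.+1 d.+1%:R =
  ((l.*2.+1`!%:R * (-1) ^+ l.+1 * pole_sqr d ^- l.+1)%:C)%C :> R[i].
Proof.
rewrite /pole -doubleS exprN_double -[l.+1.*2]mul2n exprM sqr_twopii_nat.
rewrite -rmorphN -rmorphXn -fmorphV -(rmorph_nat (real_complex R)) -rmorphM.
by rewrite [in LHS](exprNn (pole_sqr d)) invfM -exprVn invrN invr1 mulrA.
Qed.

Lemma csum_pole_nat l :
  csum (fun d => pole l.*2.+1 d.+1%:R) (eis_const l.+1.*2).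
Proof.
apply: (eq_csum (fun d => esym (pole_nat l d))).
have -> : eis_const l.+1.*2 =
    ((l.*2.+1`!%:R * (-1) ^+ l.+1 * even_zeta l.+1)%:C)%C.
  rewrite /eis_const -(fmorph_rat (real_complex R)) -rmorphN /=.
  congr (_%:C)%C; rewrite fmorph_div /= bernoulli_even// ratr_nat /=.
  rewrite doubleS factS natrM natrM exprS.
  have : l.*2.+2%:R != 0 :> R by rewrite pnatr_eq0.
  by move=> k_neq0; field.
by apply: csum_real; apply: cvg_seriesZ; exact: cvg_even_zeta.
Qed.

Lemma eis_const_neq0 l : eis_const l.+1.*2 != 0.
Proof.
rewrite /eis_const oppr_eq0 fmorph_eq0; apply: mulf_neq0; last first.
  by rewrite invr_neq0// pnatr_eq0 -lt0n muln_gt0.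
rewrite -(fmorph_eq0 (@ratr R)) /= bernoulli_even//.
rewrite mulf_neq0 ?pnatr_eq0 -?lt0n ?fact_gt0// mulf_neq0//.
  by rewrite mulf_neq0// signr_eq0.
by rewrite lt0r_neq0// even_zeta_gt0.
Qed.

Definition pole_pair s z d n : R[i] :=
  pole s (d.+1%:R * z + n.+1%:R) + pole s (d.+1%:R * z - n.+1%:R).

Lemma csum_pole_pair s z d : upper_half_plane z ->
  csum (pole_pair s z d) (cotsum s (d.+1%:R * z) - pole s (d.+1%:R * z)).
Proof. by move=> z0; apply: lipschitz_formula; exact: upper_mulnl. Qed.

Lemma pole_pairNV l z d n : upper_half_plane z ->
  pole_pair l.*2.+1 (- z^-1) d n = z ^+ l.+1.*2 * pole_pair l.*2.+1 z n d.
Proof.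
move=> /upper_neq0 z_neq0; rewrite /pole_pair doubleS.
have -> : d.+1%:R * (- z^-1) + n.+1%:R = (n.+1%:R * z - d.+1%:R) * z^-1.
  by field.
have -> : d.+1%:R * (- z^-1) - n.+1%:R = - ((n.+1%:R * z + d.+1%:R) * z^-1).
  by field.
rewrite poleN ?oddS ?odd_double// !poleM exprVn invrK -mulrDl mulrC.
by congr (_ * _); exact: addrC.
Qed.

Lemma csum_pole_pair_rows l z : upper_half_plane z ->
  csum (fun d => cotsum l.*2.+1 (d.+1%:R * z) - pole l.*2.+1 (d.+1%:R * z))
   (eisenstein l.+1.*2 z
    - eis_const l.+1.*2 - eis_const l.+1.*2 / z ^+ l.+1.*2).
Proof.
move=> z0; have [_ sum_powsum] := csum_eisenstein l.*2 z0.
rewrite doubleS; apply: csumB.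
  by apply: eq_csum sum_powsum => d; rewrite cotsumS.
rewrite mulrC; apply: eq_csum (csumZ _ (csum_pole_nat l)) => d.
by rewrite poleM mulrC.
Qed.

Lemma csum_pole_pair_cols l z : upper_half_plane z -> exists2 Scol,
  forall n, csum (fun d => pole_pair l.*2.+1 z d n) (Scol n) &
  csum Scol (eisenstein l.+1.*2 (- z^-1) / z ^+ l.+1.*2
             - eis_const l.+1.*2 - eis_const l.+1.*2 / z ^+ l.+1.*2).
Proof.
move=> z0; have z0' := upperNV z0.
have zk : z ^+ l.+1.*2 != 0 by rewrite expf_neq0// upper_neq0.
exists (fun n => (z ^+ l.+1.*2)^-1 *
    (cotsum l.*2.+1 (n.+1%:R * - z^-1) - pole l.*2.+1 (n.+1%:R * - z^-1))).
  move=> n; apply: eq_csum (csumZ _ (csum_pole_pair l.*2.+1 n z0')) => d.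
  by rewrite pole_pairNV// mulKf.
have := csumZ (z ^+ l.+1.*2)^-1 (csum_pole_pair_rows l z0').
by rewrite exprN_double exprVn; congr csum; field.
Qed.

Lemma normc_lattice_nat_ge z : upper_half_plane z -> exists2 c : R, 0 < c &
  forall d n (e : R), `|e| <= 1 / 2 ->
    c * (d.+1%:R + n.+1%:R) <= normc (d.+1%:R * z + n.+1%:R + (e%:C)%C) /\
    c * (d.+1%:R + n.+1%:R) <= normc (d.+1%:R * z - n.+1%:R + (e%:C)%C).
Proof.
move=> z0; have [c c0 lattice_ge] := normc_lattice_ge z0.
exists (c / 2); first by rewrite divr_gt0.
move=> d n e e_le; have n1 : 1 <= n.+1%:R :> R by rewrite ler1n.
have d1 : 1 <= d.+1%:R :> R by rewrite ler1n.
have shifted_ge (b : R) : `|b| = n.+1%:R ->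
    c / 2 * (d.+1%:R + n.+1%:R) <= normc (d.+1%:R * z + ((b + e)%:C)%C).
  move=> bn; rewrite natr_complex; apply: le_trans (lattice_ge _ _).
  rewrite -mulrA ler_pM2l// ger0_norm//.
  by have := ler_normB (b + e) e; rewrite addrK bn; lra.
split.
  have := shifted_ge n.+1%:R; rewrite normr_nat => /(_ erefl).
  by rewrite rmorphD rmorph_nat addrA.
have := shifted_ge (- n.+1%:R); rewrite normrN normr_nat => /(_ erefl).
by rewrite rmorphD rmorphN rmorph_nat addrA.
Qed.

Lemma inv_expD_le (K : realFieldType) (a b : K) m : 1 <= a -> 1 <= b ->
  (4 <= m)%N -> (a + b) ^- m <= a ^- 2 * b ^- 2.
Proof.
move=> a1 b1 m4; have ab : 1 <= a + b by lra.
have a0 := lt_le_trans ltr01 a1; have b0 := lt_le_trans ltr01 b1.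
rewrite -invfM lef_pV2 ?posrE ?mulr_gt0 ?exprn_gt0 ?addr_gt0//.
apply: le_trans (ler_weXn2l ab m4).
rewrite -exprMn [(a + b) ^+ 4](exprM _ 2 2) lerXn2r ?nnegrE//.
- by rewrite mulr_ge0// ltW.
- by rewrite sqr_ge0.
- by nra.
Qed.

Lemma normc_pole_le s x (m : R) : 0 < m -> m <= normc x ->
  normc (pole s x) <= s`!%:R / (normc (@twopii R) * m) ^+ s.+1.
Proof.
move=> m0 mx; rewrite /pole normcM normc_nat normcV normcX normcN normcM.
have tau0 : 0 < normc (@twopii R) by rewrite normc_gt0 twopii_neq0.
have x0 := lt_le_trans m0 mx.
rewrite ler_pM2l ?ltr0n ?fact_gt0//.
rewrite lef_pV2 ?posrE ?exprn_gt0 ?mulr_gt0// lerXn2r ?nnegrE ?ler_pM2l//.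
  by rewrite ltW ?mulr_gt0.
by rewrite ltW ?mulr_gt0.
Qed.

Lemma normc_pole_pair_le l z : upper_half_plane z -> exists C : R, forall d n,
  normc (pole_pair l.+1.*2.+1 z d n) <= C * d.+1%:R ^- 2 * n.+1%:R ^- 2.
Proof.
move=> z0; have [c c0 lattice_ge] := normc_lattice_nat_ge z0.
set s := l.+1.*2.+1; pose B : R := s`!%:R / (normc (@twopii R) * c) ^+ s.+1.
have B0 : 0 < B.
  rewrite divr_gt0 ?ltr0n ?fact_gt0// exprn_gt0// mulr_gt0//.
  by rewrite normc_gt0 twopii_neq0.
exists (B *+ 2) => d n.
have dn : 0 < c * (d.+1%:R + n.+1%:R) by rewrite mulr_gt0.
have [] := lattice_ge d n 0; first by rewrite normr0.
have pole_le x : c * (d.+1%:R + n.+1%:R) <= normc x ->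
    normc (pole s x) <= B * d.+1%:R ^- 2 * n.+1%:R ^- 2.
  move=> /(normc_pole_le s dn)/le_trans -> //.
  rewrite [normc twopii * _]mulrA exprMn invfM [leLHS]mulrA -/B.
  by rewrite -[leRHS]mulrA ler_pM2l// inv_expD_le ?ler1n.
rewrite !addr0 => /pole_le plus_le /pole_le minus_le.
rewrite mulrnAl mulrnAl mulr2n.
by apply: le_trans (lerD plus_le minus_le); exact: le_normcD.
Qed.

Lemma eisensteinNV_ge4 l z : upper_half_plane z ->
  eisenstein l.+2.*2 (- z^-1) = z ^+ l.+2.*2 * eisenstein l.+2.*2 z.
Proof.
move=> z0; have zk : z ^+ l.+2.*2 != 0 by rewrite expf_neq0// upper_neq0.
have [C pair_le] := normc_pole_pair_le l z0.
have [Srow [Scol [t [row col rows_t cols_t]]]] := csum_exchange_inv_sqr pair_le.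
have rowsE := csum_pole_pair_rows l.+1 z0.
have {}rowsE := csum_unique (eq_csum (fun d =>
  csum_unique (csum_pole_pair _ d z0) (row d)) rowsE) rows_t.
have [Pcol pole_col colsE] := csum_pole_pair_cols l.+1 z0.
have {}colsE := csum_unique (eq_csum (fun n =>
  csum_unique (pole_col n) (col n)) colsE) cols_t.
have /addIr/addIr invE := etrans colsE (esym rowsE).
by rewrite -[LHS](divfK zk) invE mulrC.
Qed.

End EisensteinInversion.

Section WeightTwo.
Context {R : realType}.
Implicit Types (x y z : R[i]) (d n N : nat).

Lemma half_complex : ((1 / 2 : R)%:C)%C = 2^-1 :> R[i].
Proof. by rewrite rmorphM rmorph1 mul1r fmorphV rmorph_nat. Qed.

(* Comparison term for the conditionally convergent weight 2 sum: it telescopes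
   along integer translates and agrees with [pole 1] up to O(x^-4). *)
Definition tele x : R[i] := twopii ^- 2 * ((x - 2^-1)^-1 - (x + 2^-1)^-1).

Lemma pole1_sub_tele x : x != 0 -> x - 2^-1 != 0 -> x + 2^-1 != 0 ->
  pole 1 x - tele x =
  twopii ^- 2 * (- 4^-1 / (x ^+ 2 * ((x - 2^-1) * (x + 2^-1)))).
Proof.
rewrite /tele /pole sqrrN exprMn (_ : 1`!%:R = 1)//.
have -> : 4^-1 = 2^-1 ^+ 2 :> R[i] by field.
have : 2^-1 + 2^-1 = 1 :> R[i] by field.
move: (2^-1 : R[i]) => h double_h x0 xB0 xD0.
have -> : (x - h)^-1 - (x + h)^-1 = (h + h) / ((x - h) * (x + h)).
  by field; rewrite xB0 xD0.
by rewrite double_h; field; rewrite x0 xB0 xD0 twopii_neq0.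
Qed.

Lemma normc_pole1_sub_tele_le x (m : R) : 0 < m -> m <= normc x ->
  m <= normc (x - 2^-1) -> m <= normc (x + 2^-1) ->
  normc (pole 1 x - tele x) <= normc (@twopii R ^- 2) * m ^- 4.
Proof.
move=> m0 mx mxB mxD.
have neq0 y : m <= normc y -> y != 0 by rewrite -normc_gt0; exact: lt_le_trans.
rewrite pole1_sub_tele ?neq0// normcM ler_wpM2l ?normc_ge0//.
rewrite (normcM (- _)) normcN !normcV normc_nat.
rewrite (normcM (x ^+ 2)) normcX (normcM (x - _)).
have sqr_le : m ^+ 2 <= normc x ^+ 2.
  by rewrite lerXn2r ?nnegrE ?normc_ge0// ltW.
have prod_le : m ^+ 2 <= normc (x - 2^-1) * normc (x + 2^-1).
  by rewrite expr2 ler_pM// ltW.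
have quartic_le :
  m ^+ 4 <= normc x ^+ 2 * (normc (x - 2^-1) * normc (x + 2^-1)).
  by rewrite (exprD m 2 2) ler_pM// sqr_ge0.
have den0 := lt_le_trans (exprn_gt0 4 m0) quartic_le.
apply: (@le_trans _ _ (1 * m ^- 4)); last by rewrite mul1r.
apply: ler_pM; rewrite ?invr_ge0 ?(ltW den0)//.
  by rewrite invf_le1// ler1n.
by rewrite lef_pV2 ?posrE ?exprn_gt0.
Qed.

Definition tele_pair z d n : R[i] :=
  tele (d.+1%:R * z + n.+1%:R) + tele (d.+1%:R * z - n.+1%:R).

Lemma normc_pole_tele_pair_le z : upper_half_plane z -> exists C : R,
  forall d n, normc (pole_pair 1 z d n - tele_pair z d n) <=
    C * d.+1%:R ^- 2 * n.+1%:R ^- 2.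
Proof.
move=> z0; have [c c0 lattice_ge] := normc_lattice_nat_ge z0.
pose T := normc (@twopii R ^- 2); exists ((T / c ^+ 4) *+ 2) => d n.
have cdn : 0 < c * (d.+1%:R + n.+1%:R) by rewrite mulr_gt0.
have half_le : `|1 / 2| <= 1 / 2 :> R by rewrite ger0_norm.
have Nhalf_le : `|- (1 / 2)| <= 1 / 2 :> R by rewrite normrN.
have zero_le : `|0 : R| <= 1 / 2 :> R by rewrite normr0.
have [] := lattice_ge d n _ zero_le; rewrite !addr0 => plus minus.
have [] := lattice_ge d n _ half_le; rewrite half_complex => plusD minusD.
have [] := lattice_ge d n _ Nhalf_le.
rewrite rmorphN /= half_complex => plusB minusB.
have bound : T * (c * (d.+1%:R + n.+1%:R)) ^- 4 <=
    T / c ^+ 4 * d.+1%:R ^- 2 * n.+1%:R ^- 2.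
  rewrite exprMn invfM mulrA -[leRHS]mulrA ler_wpM2l//.
    by rewrite divr_ge0 ?exprn_ge0 ?normc_ge0 ?ltW.
  by rewrite inv_expD_le ?ler1n.
have -> : pole_pair 1 z d n - tele_pair z d n =
    (pole 1 (d.+1%:R * z + n.+1%:R) - tele (d.+1%:R * z + n.+1%:R)) +
    (pole 1 (d.+1%:R * z - n.+1%:R) - tele (d.+1%:R * z - n.+1%:R)).
  by rewrite /pole_pair /tele_pair opprD addrACA.
rewrite (le_trans (le_normcD _ _))// mulr2n (mulrDl (T / _)) mulrDl lerD//.
  by apply: le_trans bound; exact: normc_pole1_sub_tele_le.
by apply: le_trans bound; exact: normc_pole1_sub_tele_le.
Qed.

Definition half_integer N : R := N%:R + 1 / 2.

Lemma half_integer_gt0 N : 0 < half_integer N.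
Proof. by rewrite ltr_wpDl. Qed.

Lemma half_integer_ge N : N.+1%:R / 2 <= half_integer N.
Proof. by rewrite /half_integer -natr1; have := ler0n R N; lra. Qed.

Lemma half_integerC N : ((half_integer N)%:C)%C = N%:R + 2^-1 :> R[i].
Proof. by rewrite rmorphD rmorph_nat /= half_complex. Qed.

Definition tele_boundary z N d : R[i] :=
  (d.+1%:R * z - (half_integer N)%:C%C)^-1 -
  (d.+1%:R * z + (half_integer N)%:C%C)^-1.

Lemma series_tele_pair z d N : series (tele_pair z d) N =
  - tele (d.+1%:R * z) + twopii ^- 2 * tele_boundary z N d.
Proof.
elim: N => [|N IHN].
  by rewrite /series/= big_geq// /tele_boundary half_integerC add0r addNr.
rewrite seriesSr IHN /tele_pair /tele /tele_boundary !half_integerC.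
have -> : d.+1%:R * z + N.+1%:R - 2^-1 = d.+1%:R * z + (N%:R + 2^-1).
  by rewrite -natr1; field.
have -> : d.+1%:R * z - N.+1%:R + 2^-1 = d.+1%:R * z - (N%:R + 2^-1).
  by rewrite -natr1; field.
by rewrite -!addrA -opprD; ring.
Qed.

Lemma ccvg_inv0 (u : nat -> R[i]) (c : R) : 0 < c ->
  (forall N, c * N.+1%:R <= normc (u N)) -> ccvg (fun N => (u N)^-1) 0.
Proof.
move=> c0 u_ge; apply: (@ccvg0_normc_le _ _ (fun N => c^-1 * harmonic N)).
  move=> N; have cN0 : 0 < c * N.+1%:R by rewrite mulr_gt0.
  by rewrite normcV -invfM lef_pV2 ?posrE// (lt_le_trans cN0).
by rewrite -[X in _ --> X](mulr0 c^-1); apply: cvgMl_tmp; exact: cvg_harmonic.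
Qed.

Lemma ccvg_tele_boundary z d : upper_half_plane z ->
  ccvg (fun N => tele_boundary z N d) 0.
Proof.
move=> z0; have [c c0 lattice_ge] := normc_lattice_ge z0.
have shift_ge N (b : R) : `|b| = half_integer N ->
    c / 2 * N.+1%:R <= normc (d.+1%:R * z + (b%:C)%C).
  move=> bN; rewrite [d.+1%:R]natr_complex; apply: le_trans (lattice_ge _ _).
  rewrite -mulrA ler_pM2l// mulrC bN (le_trans (half_integer_ge N))//.
  by rewrite lerDr.
have c2 : 0 < c / 2 by rewrite divr_gt0.
have abs_half N : `|half_integer N| = half_integer N.
  by rewrite gtr0_norm// half_integer_gt0.
rewrite -(subr0 0); apply: ccvgB.
  apply: (ccvg_inv0 c2) => N; rewrite -raddfN /=.
  by apply: shift_ge; rewrite normrN.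
by apply: (ccvg_inv0 c2) => N; exact: shift_ge.
Qed.

Lemma csum_tele_pair_row z d : upper_half_plane z ->
  csum (tele_pair z d) (- tele (d.+1%:R * z)).
Proof.
move=> z0; apply: (eq_ccvg (fun N => esym (series_tele_pair z d N))).
have := ccvgD (ccvg_cst (- tele (d.+1%:R * z)))
  (ccvgZ (twopii ^- 2) (ccvg_tele_boundary d z0)).
by rewrite mulr0 addr0.
Qed.

Definition half_integer_point z N : R[i] := - z^-1 * (half_integer N)%:C%C.

Lemma upper_half_integer_point z N : upper_half_plane z ->
  upper_half_plane (half_integer_point z N).
Proof.
by move=> z0; apply: upperM_real; [exact: half_integer_gt0|exact: upperNV].
Qed.

Lemma csum_tele_boundary z N : upper_half_plane z ->
  csum (tele_boundary z N) (- twopii / z *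
    (cotsum 0 (half_integer_point z N) - pole 0 (half_integer_point z N))).
Proof.
move=> z0; have w0 := upper_half_integer_point N z0.
apply: eq_csum (csumZ (- twopii / z) (lipschitz_formula 0 w0)) => d.
rewrite /tele_boundary /half_integer_point; set a := (half_integer N)%:C%C.
have z_neq0 := upper_neq0 z0.
have shift_neq0 (b : R) : d.+1%:R * z + (b%:C)%C != 0.
  by rewrite natr_complex upper_lin_neq0// pnatr_eq0.
have nB : d.+1%:R * z - a != 0.
  by have := shift_neq0 (- half_integer N); rewrite rmorphN.
have nD : d.+1%:R * z + a != 0 := shift_neq0 (half_integer N).
have -> : - z^-1 * a + d.+1%:R = (d.+1%:R * z - a) / z by field.
have -> : - z^-1 * a - d.+1%:R = - (d.+1%:R * z + a) / z by field.
rewrite /pole fact0 !expr1.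
move: (d.+1%:R * z - a) (d.+1%:R * z + a) nB nD => u v u0 v0.
by field; rewrite u0 v0 z_neq0 twopii_neq0.
Qed.

Lemma ccvg_nome_half_integer_point z : upper_half_plane z ->
  ccvg (fun N => nome (half_integer_point z N)) 0.
Proof.
move=> /upperNV y0; set r := expR (- (pi * complex.Im (- z^-1))).
have pi0 := @pi_gt0 R.
have r1 : `|r| < 1.
  by rewrite ger0_norm ?expR_ge0// expR_lt1 oppr_lt0 mulr_gt0.
apply: (@ccvg0_normc_le _ _ (fun N => r ^+ N.+1)) => [N|]; last first.
  by rewrite (cvg_shiftS (GRing.exp r)); exact: cvg_expr.
rewrite normc_nome /r -expRM_natl ler_expR mulrN lerN2.
have -> : complex.Im (half_integer_point z N) =
    half_integer N * complex.Im (- z^-1).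
  by rewrite /half_integer_point; case: (- z^-1) => u v /=; ring.
have := half_integer_ge N; rewrite ler_pdivrMr// => half_ge.
have : 0 < pi * complex.Im (- z^-1) by rewrite mulr_gt0.
by move: (complex.Im _) => t; nra.
Qed.

Lemma ccvg_half_integer_point_inv z : upper_half_plane z ->
  ccvg (fun N => (half_integer_point z N)^-1) 0.
Proof.
move=> /upperNV/upper_neq0; rewrite -normc_gt0 => y0.
have c0 : 0 < normc (- z^-1) / 2 by rewrite divr_gt0.
apply: (ccvg_inv0 c0) => N.
rewrite normcM normc_real gtr0_norm ?half_integer_gt0//.
by rewrite -mulrA ler_pM2l// mulrC half_integer_ge.
Qed.

Lemma ccvg_cotsum_half_integer_point z : upper_half_plane z ->
  ccvg (fun N => cotsum 0 (half_integer_point z N) -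
                 pole 0 (half_integer_point z N)) 2^-1.
Proof.
move=> z0; have one_neq0 : 1 - 0 != 0 :> R[i] by rewrite subr0 oner_eq0.
have powsum_lim := ccvgV one_neq0
  (ccvgB (ccvg_cst 1) (ccvg_nome_half_integer_point z0)).
have cot_lim := ccvgB powsum_lim (ccvg_cst (1 / 2)).
have pole_lim := ccvgZ (- twopii)^-1 (ccvg_half_integer_point_inv z0).
have := ccvgB cot_lim pole_lim.
rewrite mulr0 !subr0 invr1 (_ : 1 - 1 / 2 = 2^-1); last by field.
apply: eq_ccvg => N; congr (_ - _).
  rewrite /cotsum powsum0E//.
  exact: normc_nome_lt1 (upper_half_integer_point N z0).
by rewrite /pole fact0 div1r expr1 -(mulNr twopii) [in RHS]invfM.
Qed.

Lemma csum_tele_pair_cols z (Scol : nat -> R[i]) (t : R[i]) :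
  upper_half_plane z -> (forall n, csum (tele_pair z ^~ n) (Scol n)) ->
  csum (fun d => - tele (d.+1%:R * z)) t ->
  csum Scol (t - (2 * twopii * z)^-1).
Proof.
move=> z0 cols rows.
pose V N := - twopii / z *
  (cotsum 0 (half_integer_point z N) - pole 0 (half_integer_point z N)).
have partial N : t + twopii ^- 2 * V N = series Scol N.
  have boundary := csumD rows (csumZ (twopii ^- 2) (csum_tele_boundary N z0)).
  apply: csum_unique boundary _.
  apply: (eq_csum (series_tele_pair z ^~ N)).
  by apply: csum_sum => n _; exact: cols.
apply: (eq_ccvg partial).
have := ccvgD (ccvg_cst t) (ccvgZ (twopii ^- 2)
  (ccvgZ (- twopii / z) (ccvg_cotsum_half_integer_point z0))).
by congr ccvg; field; rewrite upper_neq0// twopii_neq0.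
Qed.

Lemma eisensteinNV_2 z : upper_half_plane z ->
  eisenstein 2 (- z^-1) = z ^+ 2 * eisenstein 2 z - z / (2 * twopii).
Proof.
move=> z0; have z_neq0 := upper_neq0 z0.
have [C rest_le] := normc_pole_tele_pair_le z0.
have [Srow [Scol [t [row col rows_t cols_t]]]] := csum_exchange_inv_sqr rest_le.
have pole_rows := csum_pole_pair_rows 0 z0.
have [Pcol pole_col pole_cols] := csum_pole_pair_cols 0 z0.
have tele_row d : - tele (d.+1%:R * z) =
    cotsum 1 (d.+1%:R * z) - pole 1 (d.+1%:R * z) - Srow d.
  apply: csum_unique (csum_tele_pair_row d z0) _.
  by apply: eq_csum (csumB (csum_pole_pair 1 d z0) (row d)) => n; rewrite subKr.
have tele_col n : csum (tele_pair z ^~ n) (Pcol n - Scol n).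
  by apply: eq_csum (csumB (pole_col n) (col n)) => d; rewrite subKr.
have tele_rows := eq_csum (fun d => esym (tele_row d)) (csumB pole_rows rows_t).
have := csum_unique (csumB pole_cols cols_t)
  (csum_tele_pair_cols z0 tele_col tele_rows).
set E' := eisenstein _ (- z^-1); set E := eisenstein _ z; set E0 := eis_const _.
move=> defect.
have -> : E' =
    z ^+ 2 * (E' / z ^+ 2 - E0 - E0 / z ^+ 2 - t + t + E0 / z ^+ 2 + E0).
  by field.
by rewrite defect; field; rewrite z_neq0 twopii_neq0.
Qed.

End WeightTwo.

Section EisensteinModularity.
Context {R : realType}.
Implicit Types (w z q xi : R[i]) (k l : nat).

Lemma eisenstein_shift k z (n : int) :
  eisenstein k (z + n%:~R) = eisenstein k z.
Proof. by rewrite /eisenstein nomeD nome_int mulr1. Qed.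

Definition quasi_coef k : R[i] := (k == 2%N)%:R / (2 * twopii).

Lemma eisensteinNV l z : upper_half_plane z ->
  eisenstein l.+1.*2 (- z^-1) =
  z ^+ l.+1.*2 * eisenstein l.+1.*2 z - quasi_coef l.+1.*2 * z.
Proof.
case: l => [|l] z0; rewrite /quasi_coef.
  by rewrite eisensteinNV_2// eqxx mul1r [_^-1 * _]mulrC.
by rewrite eisensteinNV_ge4// mul0r mul0r subr0.
Qed.

Definition quasimodular k (f : R[i] -> R[i]) (a b c d : int) : Prop :=
  forall z, upper_half_plane z -> let j := c%:~R * z + d%:~R in
  f ((a%:~R * z + b%:~R) / j) = j ^+ k * f z - quasi_coef k * c%:~R * j.

Lemma quasimodular_triangular l (a b d : int) : a * d = 1 ->
  quasimodular l.+1.*2 (eisenstein l.+1.*2) a b 0 d.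
Proof.
move=> ad z z0 /=; rewrite mul0r add0r mulr0 mul0r subr0.
have dE : d = 1 \/ d = -1.
  by have /orP[/eqP ->|/eqP ->] := intUnitRing.unitzPl ad; [left|right].
have aE : a = d by case: dE ad => ->; lia.
have dd : (d%:~R : R[i]) ^+ 2 = 1.
  by case: dE => ->; rewrite ?mulrNz ?sqrrN expr1n.
have d_neq0 : d%:~R != 0 :> R[i] by rewrite intr_eq0; case: dE => ->.
have -> : (a%:~R * z + b%:~R) / d%:~R = z + (b * d)%:~R.
  rewrite aE rmorphM /= mulrDl mulrAC divff// mul1r; congr (_ + _).
  by apply: (mulIf d_neq0); rewrite divfK// -mulrA -expr2 dd mulr1.
by rewrite eisenstein_shift -mul2n exprM dd expr1n mul1r.
Qed.

(* With S = [[0, -1], [1, 0]] and T = [[1, 1], [0, 1]], the new matrix is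
   - T^m S [[- c, - d], [a, b]]. *)
Lemma quasimodular_step l (m a b c d : int) : a * d - b * c = 1 -> c != 0 ->
  quasimodular l.+1.*2 (eisenstein l.+1.*2) (- c) (- d) a b ->
  quasimodular l.+1.*2 (eisenstein l.+1.*2) (m * c + a) (m * d + b) c d.
Proof.
move=> det c0 IH z z0 j; have /= := IH z z0.
set j' := a%:~R * z + b%:~R; set w := _ / j' => w_transform.
have w0 : upper_half_plane w by apply: upper_SL2 z0; rewrite -det; ring.
have ab0 : (a != 0) || (b != 0).
  apply: contra_eqT det; rewrite negb_or !negbK => /andP[/eqP-> /eqP->].
  by rewrite !mul0r subr0.
have j'0 : j' != 0 by exact: upper_lin_int_neq0.
have j0 : j != 0 by apply: upper_lin_int_neq0; rewrite // c0.
have wE : w = - (j / j') by rewrite /w /j !mulrNz; field.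
have -> : ((m * c + a)%:~R * z + (m * d + b)%:~R) / j = - w^-1 + m%:~R.
  rewrite wE invrN opprK invf_div; apply: (mulIf j0).
  by rewrite divfK// mulrDl divfK// /j' /j !(rmorphD, rmorphM) /=; ring.
rewrite eisenstein_shift eisensteinNV// w_transform.
have w_j' : w ^+ l.+1.*2 * j' ^+ l.+1.*2 = j ^+ l.+1.*2.
  by rewrite wE exprN_double -exprMn divfK.
rewrite mulrBr mulrA w_j' -addrA; congr (_ + _); rewrite /quasi_coef.
case: l {IH w_transform w_j'} => [|l]; last by rewrite !mul0r mulr0 !subr0.
have detE : a%:~R * j - 1 = c%:~R * j'.
  by rewrite -[X in _ - X]/(1%:~R) -det rmorphB !rmorphM /= /j /j'; ring.
move: (_ / (2 * twopii)) => K; rewrite -[1.*2]/2%N wE.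
transitivity (- (K * j * ((a%:~R * j - 1) / j'))); first by field.
by rewrite detE mulfK//; ring.
Qed.

Lemma eisenstein_SL2 l (a b c d : int) : a * d - b * c = 1 ->
  quasimodular l.+1.*2 (eisenstein l.+1.*2) a b c d.
Proof.
have [n] := ubnP (absz c); elim: n a b c d => // n IHn a b c d cn det.
have [c0|c0] := eqVneq c 0.
  by rewrite c0; apply: quasimodular_triangular; rewrite -det c0 mulr0 subr0.
pose m := (a %/ c)%Z; pose a' := (a %% c)%Z; pose b' := b - m * d.
have aE : a = m * c + a' := divz_eq a c.
have bE : b = m * d + b' by rewrite addrC subrK.
have a'0 : 0 <= a' by exact: modz_ge0.
have a'c : a' < `|c|%R by exact: ltz_mod.
have det' : a' * d - b' * c = 1 by rewrite -det [in RHS]aE [in RHS]bE; ring.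
rewrite aE bE; apply: quasimodular_step => //.
by apply: IHn; [lia|rewrite -det'; ring].
Qed.

(* The factorization diag(A D, 1) g = g' [A, B; 0, D] with g' in SL2(Z),
   written on coefficients. *)
Lemma eisenstein_slash l (A D : nat) (a b c d c' B d' : int) z :
  (0 < A)%N -> (0 < D)%N -> a * d - b * c = 1 -> c = A%:Z * c' ->
  c' * B + D%:Z * d' = d -> upper_half_plane z ->
  let j := c%:~R * z + d%:~R in
  j ^- l.+1.*2 * eisenstein l.+1.*2 ((A * D)%:R * ((a%:~R * z + b%:~R) / j)) =
  D%:R ^- l.+1.*2 * eisenstein l.+1.*2 ((A%:R * z + B%:~R) / D%:R)
  - quasi_coef l.+1.*2 * (c%:~R / j) / (A * D)%:R.
Proof.
move=> A0 D0 det cE dE z0 j.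
have A_neq0 : A%:R != 0 :> R[i] by rewrite pnatr_eq0 -lt0n.
have D_neq0 : D%:R != 0 :> R[i] by rewrite pnatr_eq0 -lt0n.
have j_neq0 : j != 0.
  apply: upper_lin_int_neq0 => //; apply: contra_eqT det.
  rewrite negb_or !negbK => /andP[/eqP-> /eqP->].
  by rewrite !mulr0 subr0.
set w := (_ + B%:~R) / D%:R.
have w0 : upper_half_plane w.
  by apply: upper_divn => //; apply: upperD_int; exact: upper_mulnl.
have det' : (D%:Z * a) * d' - (A%:Z * b - a * B) * c' = 1.
  by rewrite -det cE -dE; ring.
have /= := eisenstein_SL2 l det' w0; set j' := c'%:~R * w + d'%:~R.
have j'E : j' = j / D%:R.
  rewrite /j' /w /j -dE cE !(rmorphD, rmorphM) /= -!pmulrn.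
  by field.
have -> : ((D%:Z * a)%:~R * w + (A%:Z * b - a * B)%:~R) / j' =
    (A * D)%:R * ((a%:~R * z + b%:~R) / j).
  rewrite j'E /w !(rmorphD, rmorphB, rmorphM) /= -!pmulrn ?natrM.
  by field; rewrite D_neq0 j_neq0.
move=> ->; rewrite j'E mulrBr; congr (_ - _).
  by rewrite exprMn exprVn -(mulrA (j ^+ _)) mulKf ?expf_neq0.
rewrite /quasi_coef; case: l => [|l]; last by rewrite !mul0r mulr0.
rewrite cE rmorphM /= -pmulrn natrM; move: (_ / (2 * twopii)) => K.
by field; rewrite A_neq0 D_neq0 j_neq0.
Qed.

(* Coefficients of E_k (w) in q, where the nome of w is xi q^L. *)
Definition eis_coef k (L : nat) xi (n : nat) : R[i] :=
  if n == 0%N then eis_const k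
  else if (L %| n)%N then (sigma k.-1 (n %/ L))%:R * xi ^+ (n %/ L) else 0.

Lemma csum_eis_coef s (L : nat) xi q w : (0 < L)%N -> upper_half_plane w ->
  nome w = xi * q ^+ L ->
  csum (fun n => eis_coef s.+2 L xi n * q ^+ n) (eisenstein s.+2 w).
Proof.
move=> L0 w0 nome_w; have [sum_sigma _] := csum_eisenstein s w0.
pose u n :=
  if n == 0%N then eis_const s.+2 else (sigma s.+1 n)%:R * nome w ^+ n.
have u_sum : csum u (eisenstein s.+2 w).
  have := @csum_recl _ u _ sum_sigma; congr csum.
  by rewrite /u eqxx addrC subrK.
apply: eq_csum (csum_stretch L0 u_sum) => n; rewrite /eis_coef /u.
have [->|n0] := posnP n; first by rewrite dvdn0 div0n eqxx expr0 mulr1.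
case: ifP => [Ln|_]; last by rewrite mul0r.
rewrite gtn_eqF ?divn_gt0 ?(dvdn_leq n0 Ln)// nome_w exprMn -exprM.
by rewrite [(L * _)%N]mulnC divnK// mulrA.
Qed.

End EisensteinModularity.

Section IntegralMatrices.
Implicit Types (A B g : 'M[int]_2).

Lemma ord2P (i : 'I_2) : i = 0 \/ i = 1.
Proof. by case: i => [[|[|//]] i2]; [left|right]; exact/val_inj. Qed.

Lemma mulmx2E A B i j : (A *m B) i j = A i 0 * B 0 j + A i 1 * B 1 j.
Proof.
by rewrite mxE big_ord_recl big_ord1; congr (_ + A i _ * B _ j); exact/val_inj.
Qed.

Lemma det_mx22 A : \det A = A 0 0 * A 1 1 - A 0 1 * A 1 0.
Proof.
rewrite (expand_det_row _ 0) big_ord_recl big_ord1.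
rewrite /cofactor !det_mx11 !mxE /= expr0 expr1 mul1r mulN1r mulrN.
by congr (A 0 _ * A _ _ - A 0 _ * A _ _); exact/val_inj.
Qed.

Lemma eq_mx2 A B : A 0 0 = B 0 0 -> A 0 1 = B 0 1 -> A 1 0 = B 1 0 ->
  A 1 1 = B 1 1 -> A = B.
Proof.
move=> e00 e01 e10 e11; apply/matrixP => i j.
by case: (ord2P i) => ->; case: (ord2P j) => ->.
Qed.

Definition mx2 (a b c d : int) : 'M[int]_2 :=
  \matrix_(i, j) (if i == 0 then (if j == 0 then a else b)
                  else (if j == 0 then c else d)).

Lemma mx2E a b c d : (mx2 a b c d 0 0 = a) * (mx2 a b c d 0 1 = b) *
  (mx2 a b c d 1 0 = c) * (mx2 a b c d 1 1 = d).
Proof. by rewrite !mxE. Qed.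

Lemma translationE h : translation h = mx2 1 h%:Z 0 1.
Proof.
by apply: eq_mx2; rewrite mx2E !mxE /= ?mulr0 ?mulr1 ?addr0 ?add0r.
Qed.

Lemma SL2Z_translation h : SL2Z (translation h).
Proof.
by rewrite /SL2Z /= translationE det_mx22 !mx2E mulr1 mulr0 subr0.
Qed.

Lemma SL2Z_mul g g' : SL2Z g -> SL2Z g' -> SL2Z (g *m g').
Proof. by rewrite /SL2Z /= det_mulmx => -> ->; rewrite mulr1. Qed.

Lemma SL2Z_unitmx g : SL2Z g -> g \in unitmx.
Proof. by rewrite /SL2Z /= unitmxE => ->; rewrite unitr1. Qed.

Lemma SL2Z_inv g : SL2Z g -> SL2Z (invmx g).
Proof. by rewrite /SL2Z /= det_inv => ->; rewrite invr1. Qed.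

Lemma invmx2 g : SL2Z g -> invmx g = mx2 (g 1 1) (- g 0 1) (- g 1 0) (g 0 0).
Proof.
move=> sg; set h := mx2 _ _ _ _; suff gh : g *m h = 1%:M.
  by rewrite -[h](mulKmx (SL2Z_unitmx sg)) gh mulmx1.
move: sg; rewrite /SL2Z /= det_mx22 => det_g.
by apply: eq_mx2; rewrite mulmx2E !mx2E !mxE /=; lia.
Qed.

Lemma SL2Z_coprime g : SL2Z g -> coprimez (g 1 0) (g 1 1).
Proof.
rewrite /SL2Z /= det_mx22 => det_g.
by apply/coprimezP; exists (- g 0 1, g 0 0); rewrite /= -det_g; ring.
Qed.

Lemma SL2Z_conj_translation g h : SL2Z g ->
  SL2Z (g *m translation h *m invmx g).
Proof.
move=> sg; apply/SL2Z_mul/SL2Z_inv/sg.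
exact: SL2Z_mul sg (SL2Z_translation h).
Qed.

Lemma conj_translation10 g h : SL2Z g ->
  (g *m translation h *m invmx g) 1 0 = - (h%:Z * g 1 0 ^+ 2).
Proof.
by move=> sg; rewrite invmx2// translationE !(mulmx2E, mx2E) expr2; ring.
Qed.

Lemma cusp_act_None g g' : g 0 0 = g' 0 0 -> g 1 0 = g' 1 0 ->
  cusp_act g None = cusp_act g' None.
Proof. by rewrite /cusp_act => -> ->. Qed.

Lemma cusp_act_mul g g' : SL2Z g -> SL2Z g' ->
  cusp_act g' (cusp_act g None) = cusp_act (g' *m g) None.
Proof.
rewrite /SL2Z /= => det_g det_g'; rewrite /cusp_act !mulmx2E.
have [c0|c0] := eqVneq (g 1 0) 0.
  move: det_g; rewrite det_mx22 c0 mulr0 subr0 => ad.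
  have a0 : g 0 0 != 0 by apply/eqP => a0; move: ad; rewrite a0 mul0r.
  rewrite !mulr0 !addr0 mulf_eq0 (negbTE a0) orbF; case: ifP => // _.
  by rewrite !rmorphM /= -mulf_div divff ?mulr1// intr_eq0.
have c0' : (g 1 0)%:~R != 0 :> rat by rewrite intr_eq0.
have denE : (g' 1 0)%:~R * ((g 0 0)%:~R / (g 1 0)%:~R) + (g' 1 1)%:~R =
    (g' 1 0 * g 0 0 + g' 1 1 * g 1 0)%:~R / (g 1 0)%:~R :> rat.
  by rewrite rmorphD !rmorphM /=; field.
rewrite denE mulf_eq0 invr_eq0 (negbTE c0') orbF intr_eq0.
case: ifPn => // den0.
have : (g' 1 0 * g 0 0 + g' 1 1 * g 1 0)%:~R != 0 :> rat by rewrite intr_eq0.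
rewrite !rmorphD !rmorphM /=.
by move: ((g' 1 0)%:~R * _ + _) => v v0; congr Some; field; rewrite v0 c0'.
Qed.

Lemma cusp_lift (r : cusp) : exists2 g, SL2Z g & cusp_act g None = r.
Proof.
case: r => [x|]; last first.
  exists 1%:M; first by rewrite /SL2Z /= det1.
  by rewrite /cusp_act !mxE.
have [[u v] /= bezout] := coprimezP _ _ (coprime_num_den x).
exists (mx2 (numq x) (- v) (denq x) u).
  by rewrite /SL2Z /= det_mx22 !mx2E; lia.
by rewrite /cusp_act !mx2E denq_eq0 divq_num_den.
Qed.

End IntegralMatrices.

Section PrimePowerCusps.
Variables p m : nat.
Hypothesis p_prime : prime p.
Implicit Types (c d : int) (e : nat) (g : 'M[int]_2).

Definition cusp_level c e : Prop := gcdz c (p ^ m)%:Z = (p ^ e)%:Z.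

Definition cusp_unit c e : int := (c %/ (p ^ e)%:Z)%Z.

Lemma prime_expz_neq0 e : (p ^ e)%:Z != 0.
Proof. by rewrite -lt0n expn_gt0 prime_gt0. Qed.

Lemma cusp_level_ex c : exists e, cusp_level c e.
Proof.
have : (gcdn (absz c) (p ^ m) %| p ^ m)%N by exact: dvdn_gcdr.
move=> /(dvdn_pfactor _ _ p_prime)[e _ gcdE]; exists e.
by rewrite /cusp_level /gcdz gcdE.
Qed.

Lemma cusp_levelP c e : cusp_level c e <->
  [/\ (e <= m)%N, c = (p ^ e)%:Z * cusp_unit c e &
      coprimez (cusp_unit c e) (p ^ (m - e))%:Z].
Proof.
have pe0 := prime_expz_neq0 e.
have gcd_split u : (e <= m)%N -> gcdz ((p ^ e)%:Z * u) (p ^ m)%:Z =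
    (p ^ e)%:Z * gcdz u (p ^ (m - e))%:Z.
  by move=> em; rewrite -{1}(subnKC em) expnD PoszM -mulz_gcdr.
split=> [level|[em cE unit_coprime]].
  have em : (e <= m)%N.
    rewrite -(@dvdn_Pexp2l p) ?prime_gt1//.
    by have := dvdz_gcdr c (p ^ m)%:Z; rewrite level dvdzE.
  have cE : c = (p ^ e)%:Z * cusp_unit c e.
    rewrite /cusp_unit mulrC divzK//.
    by have := dvdz_gcdl c (p ^ m)%:Z; rewrite level.
  split=> //; move: level; rewrite /cusp_level {1}cE gcd_split//.
  by rewrite -[RHS]mulr1 => /(mulfI pe0) gcd1; rewrite /coprimez gcd1.
by rewrite /cusp_level cE gcd_split// (eqP unit_coprime) mulr1.
Qed.

Lemma cusp_unit_coprime c e i : cusp_level c e -> (i <= m)%N ->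
  coprimez (cusp_unit c e) (p ^ (i - e))%:Z.
Proof.
move=> /cusp_levelP[_ _ unit_coprime] im; apply: coprimez_dvdr unit_coprime.
by rewrite dvdn_exp2l// leq_sub2r.
Qed.

Lemma cusp_width_level g e : SL2Z g -> cusp_level (g 1 0) e ->
  cusp_width (p ^ m) g (p ^ (m - e.*2)).
Proof.
move=> sg level; have [em cE _] := (cusp_levelP _ _).1 level.
set u := cusp_unit _ _ in cE.
have stabE h : Gamma0 (p ^ m) (g *m translation h *m invmx g) <->
    ((p ^ m)%:Z %| (h * p ^ e.*2)%:Z * u ^+ 2)%Z.
  have -> : (h * p ^ e.*2)%:Z * u ^+ 2 = h%:Z * g 1 0 ^+ 2.
    by rewrite cE -addnn expnD !PoszM; ring.
  split=> [[_]|dvd]; first by rewrite conj_translation10// rpredN.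
  by split; [exact: SL2Z_conj_translation|rewrite conj_translation10// rpredN].
split.
  split; first by rewrite expn_gt0 prime_gt0.
  by apply/stabE; rewrite dvdz_mulr// dvdzE /= -expnD dvdn_exp2l//; lia.
move=> j [j0 /stabE]; have [e2m|me2] := leqP e.*2 m; last first.
  by rewrite (_ : m - e.*2 = 0)%N//; lia.
rewrite -{1}(subnK e2m) expnD !PoszM mulrAC dvdz_mul2r ?prime_expz_neq0//.
have unit_coprime : coprimez (p ^ (m - e.*2))%:Z (u ^+ 2).
  rewrite coprimez_sym coprimezXl//.
  by have := cusp_unit_coprime level (leq_subr e m); rewrite -subnDA addnn.
by rewrite Gauss_dvdzl// dvdzE /=; exact: dvdn_leq.
Qed.

Definition cusp_modulus e : nat := (p ^ minn e (m - e))%N.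

Lemma cusp_modulus_gt0 e : (0 < cusp_modulus e)%N.
Proof. by rewrite expn_gt0 prime_gt0. Qed.

Lemma cusp_modulus_gcd e (v : int) : coprimez v (p ^ (m - e))%:Z ->
  gcdz (v * (p ^ e)%:Z) (p ^ (m - e))%:Z = (cusp_modulus e)%:Z.
Proof.
move=> v_coprime; rewrite gcdzC Gauss_gcdzr; last by rewrite coprimez_sym.
rewrite /gcdz /= /cusp_modulus; congr Posz.
have [le_e|le_me] := leqP e (m - e).
  by apply/gcdn_idPr; rewrite dvdn_exp2l.
by apply/gcdn_idPl; rewrite dvdn_exp2l// ltnW.
Qed.

(* The Gamma0 (p^m)-orbit of g(oo), for g with lower row c, d: writing
   c = p^e u, the class x of d / u modulo p^min(e, m - e) is well defined. *)
Definition cusp_invariant c d (k : nat * nat) : Prop :=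
  [/\ cusp_level c k.1, (k.2 < cusp_modulus k.1)%N,
      coprime (cusp_modulus k.1) k.2 &
      (k.2%:Z * cusp_unit c k.1 == d %[mod (cusp_modulus k.1)%:Z])%Z].

Lemma cusp_invariant_ex c d : coprimez c d -> exists k, cusp_invariant c d k.
Proof.
move=> cd; have [e level] := cusp_level_ex c.
have [em cE unit_coprime] := (cusp_levelP _ _).1 level.
set M := cusp_modulus e; set u := cusp_unit c e in cE unit_coprime.
have M0 : M%:Z != 0 by rewrite -lt0n cusp_modulus_gt0.
have uM : coprimez u M%:Z.
  by apply: coprimez_dvdr unit_coprime; rewrite dvdn_exp2l// geq_minr.
have [[s t] /= bezout] := coprimezP _ _ uM.
pose x := (d * s %% M%:Z)%Z.
have x0 : 0 <= x by exact: modz_ge0.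
have xu : (x * u == d %[mod M%:Z])%Z.
  rewrite modzMml eqz_mod_dvd; apply/dvdzP; exists (- (d * t)).
  by rewrite -[X in _ - X]mulr1 -bezout; ring.
exists (e, absz x); split=> //=; rewrite ?gez0_abs//.
  by rewrite -ltz_nat gez0_abs// -[M%:Z]gez0_abs// ltz_mod.
have Md : coprimez M%:Z d.
  apply: coprimez_dvdl cd; rewrite cE abszM dvdn_mulr//.
  by rewrite dvdn_exp2l// geq_minl.
have : coprimez M%:Z (x * u) by rewrite /coprimez -gcdz_modr (eqP xu) gcdz_modr.
by rewrite coprimezMr => /andP[].
Qed.

Lemma dvdz_sub_mul (a n x : int) : (gcdz a n %| x)%Z ->
  exists t : int, (n %| x - t * a)%Z.
Proof.
move=> /dvdzP[q ->]; have [u [v <-]] := Bezoutz a n.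
by exists (q * u); apply/dvdzP; exists (q * v); ring.
Qed.

Lemma cusp_invariant_equiv g g' k : SL2Z g -> SL2Z g' ->
  cusp_invariant (g 1 0) (g 1 1) k -> cusp_invariant (g' 1 0) (g' 1 1) k ->
  cusp_equiv (p ^ m) (cusp_act g None) (cusp_act g' None).
Proof.
case: k => e x sg sg' [/= level _ _ xu] [/= level' _ _ xu'].
have [em cE unit_coprime] := (cusp_levelP _ _).1 level.
have [_ cE' unit_coprime'] := (cusp_levelP _ _).1 level'.
set u := cusp_unit _ _ in xu cE unit_coprime.
set u' := cusp_unit _ _ in xu' cE' unit_coprime'.
have dvdM : ((cusp_modulus e)%:Z %| u' * g 1%R 1%R - u * g' 1%R 1%R)%Z.
  have -> : u' * g 1 1 - u * g' 1 1 =
      u * (x%:Z * u' - g' 1 1) - u' * (x%:Z * u - g 1 1) by ring.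
  by rewrite rpredB// dvdz_mull// -eqz_mod_dvd.
have uu' : coprimez (u * u') (p ^ (m - e))%:Z.
  by rewrite coprimezMl unit_coprime.
rewrite -(cusp_modulus_gcd uu') in dvdM.
have [n /dvdzP[w wE]] := dvdz_sub_mul dvdM.
pose T := mx2 1 n 0 1.
have sT : SL2Z T by rewrite /SL2Z /= det_mx22 !mx2E mulr1 mulr0 subr0.
exists (g' *m T *m invmx g).
  split; first by apply/SL2Z_mul/SL2Z_inv/sg; exact: SL2Z_mul.
  rewrite invmx2// /T !(mulmx2E, mx2E); apply/dvdzP; exists w.
  rewrite -{1}(subnKC em) expnD PoszM mulrCA -wE cE cE'.
  by ring.
rewrite cusp_act_mul//; last first.
  by apply/SL2Z_mul/SL2Z_inv/sg; exact: SL2Z_mul.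
rewrite mulmxKV ?SL2Z_unitmx//.
by apply: cusp_act_None; rewrite mulmx2E /T !mx2E mulr1 mulr0 addr0.
Qed.

Definition cusp_invariants : seq (nat * nat) :=
  [seq (e, x) | e <- iota 0 m.+1,
     x <- [seq x <- iota 0 (cusp_modulus e) | coprime (cusp_modulus e) x]].

Lemma mem_cusp_invariants c d k : cusp_invariant c d k -> k \in cusp_invariants.
Proof.
case: k => e x [/= /cusp_levelP[em _ _] x_lt x_coprime _].
apply/allpairsPdep; exists e, x; split => //; first by rewrite mem_iota.
by rewrite mem_filter x_coprime mem_iota.
Qed.

Lemma size_cusp_invariants :
  size cusp_invariants = (\sum_(0 <= e < m.+1) totient (cusp_modulus e))%N.
Proof.
rewrite size_allpairs_dep sumnE big_map; apply: eq_bigr => e _.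
rewrite size_filter totient_count_coprime -sum1_count big_mkcond /=.
by rewrite /index_iota subn0; apply: eq_bigr => x _; case: coprime.
Qed.

Definition cusp_at_level (r : cusp) e : Prop :=
  exists2 g, SL2Z g /\ cusp_act g None = r & cusp_level (g 1 0) e.

Lemma cusp_representatives_invariants (rs : seq cusp) :
  cusp_representatives (p ^ m) rs -> exists K : cusp -> nat * nat,
  [/\ forall r, cusp_at_level r (K r).1, forall r, K r \in cusp_invariants &
      {in rs &, injective K}].
Proof.
move=> [_ inj _].
have /choice[K KP] : forall r : cusp, exists k, exists2 g,
    SL2Z g /\ cusp_act g None = r & cusp_invariant (g 1 0) (g 1 1) k.
  move=> r; have [g sg gr] := cusp_lift r.
  by have [k inv] := cusp_invariant_ex (SL2Z_coprime sg); exists k, g.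
exists K; split=> [r|r|r s rrs srs eqK].
- by have [g gr [level _ _ _]] := KP r; exists g.
- by have [g _ inv] := KP r; exact: mem_cusp_invariants inv.
have [g [sg gr] inv] := KP r; have [g' [sg' gs] inv'] := KP s.
apply: inj => //; rewrite -gr -gs; rewrite eqK in inv.
exact: cusp_invariant_equiv inv inv'.
Qed.

Lemma cusp_representatives_size (rs : seq cusp) :
  cusp_representatives (p ^ m) rs ->
  (size rs <= \sum_(0 <= e < m.+1) totient (cusp_modulus e))%N.
Proof.
move=> reps; have [K [_ K_inv Kinj]] := cusp_representatives_invariants reps.
have [uniq_rs _ _] := reps.
rewrite -size_cusp_invariants -(size_map K) uniq_leq_size//.
  by rewrite map_inj_in_uniq.
by move=> _ /mapP[r _ ->].
Qed.

Lemma cusp_level_Gamma0 h g e : SL2Z g -> Gamma0 (p ^ m) h ->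
  cusp_level (g 1 0) e -> cusp_level ((h *m g) 1 0) e.
Proof.
move=> sg [sh /dvdzP[w h10]]; rewrite /cusp_level => <-.
have h11 : coprimez (p ^ m)%:Z (h 1 1).
  apply: coprimez_dvdl (SL2Z_coprime sh).
  by rewrite h10 abszM dvdn_mull.
by rewrite mulmx2E h10 mulrAC gcdzC gcdzMDl Gauss_gcdzr// gcdzC.
Qed.

Lemma cusp_representative_at_level (rs : seq cusp) e : (e <= m)%N ->
  cusp_representatives (p ^ m) rs -> exists2 r, r \in rs & cusp_at_level r e.
Proof.
move=> em [_ _ surj]; pose g := mx2 1 0 (p ^ e)%:Z 1.
have sg : SL2Z g by rewrite /SL2Z /= det_mx22 !mx2E mulr1 mul0r subr0.
have level : cusp_level (g 1 0) e.
  rewrite /cusp_level mx2E /gcdz; congr Posz.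
  by apply/gcdn_idPl; rewrite dvdn_exp2l.
have [r rrs [h Gh hr]] := surj (cusp_act g None); have [sh _] := Gh.
exists r => //; exists (h *m g); last exact: cusp_level_Gamma0.
by split; [exact: SL2Z_mul|rewrite -cusp_act_mul].
Qed.

End PrimePowerCusps.

Section CuspCount.
Implicit Types p m n : nat.

Lemma sum_minn_recr (F : nat -> nat) n :
  (\sum_(0 <= e < n.+3) F (minn e (n.+2 - e)) =
   F 0 + F 0 + \sum_(0 <= e < n.+1) F (minn e (n - e)).+1)%N.
Proof.
rewrite big_nat_recl// min0n big_nat_recr//= subnn minn0.
have -> : (\sum_(0 <= i < n.+1) F (minn i.+1 (n.+2 - i.+1)) =
    \sum_(0 <= e < n.+1) F (minn e (n - e)).+1)%N.
  by rewrite !big_nat; apply: eq_bigr => e e_le; congr F; lia.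
by lia.
Qed.

Definition cusp_bound p m : nat :=
  (p ^ ((m - 1) %/ 2) * (p ^ ((m - 1) - 2 * ((m - 1) %/ 2)) + 1))%N.

Lemma cusp_boundS p n : cusp_bound p n.+4 = (p * cusp_bound p n.+2)%N.
Proof.
rewrite /cusp_bound !subn1 /= (_ : n.+3 %/ 2 = (n.+1 %/ 2).+1)%N; last by lia.
by rewrite expnS -mulnA; congr (_ * (_ * (p ^ _ + 1)))%N; lia.
Qed.

Lemma sum_expn_minn p n : (0 < p)%N ->
  (p.-1 * (\sum_(0 <= e < n.+1) p ^ minn e (n - e)) + 2 = cusp_bound p n.+2)%N.
Proof.
move=> p0; have [k] := ubnP n; elim: k n => // k IHk [|[|n]] nk.
- by rewrite big_nat1 /cusp_bound /= expn0 expn1; lia.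
- by rewrite big_nat_recr// big_nat1 /cusp_bound /= expn0 expn1; lia.
rewrite (sum_minn_recr (fun t => p ^ t)%N) expn0.
under eq_bigr do rewrite expnS.
rewrite -big_distrr /= cusp_boundS -IHk; last by lia.
move: (\sum_(0 <= e < n.+1) _)%N => S.
by case: p p0 {IHk} => // q _ /=; nia.
Qed.

Lemma sum_totient_cusp_modulus p m : prime p -> (0 < m)%N ->
  (\sum_(0 <= e < m.+1) totient (cusp_modulus p m e) = cusp_bound p m)%N.
Proof.
move=> p_prime; case: m => [//|[|m]] _; rewrite /cusp_modulus.
  by rewrite big_nat_recr// big_nat1 min0n subnn minn0 /cusp_bound.
rewrite -sum_expn_minn ?prime_gt0//.
rewrite (sum_minn_recr (fun t => totient (p ^ t))) expn0 addnC.
congr addn; rewrite big_distrr; apply: eq_bigr => e _.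
by rewrite totient_pfactor.
Qed.

End CuspCount.

Section EisensteinCombinations.
Context {R : realType}.
Variable p : nat.
Hypothesis p_prime : prime p.
Implicit Types (f : R[i] -> R[i]) (co : nat -> rat) (m k : nat).

(* The condition in weight 2 makes the quasimodular parts cancel. *)
Definition eis_combination m k co f : Prop :=
  (forall z, upper_half_plane z ->
     f z = \sum_(0 <= i < m.+1) ratr (co i) * eisenstein k ((p ^ i)%:R * z)) /\
  (k = 2%N -> \sum_(0 <= i < m.+1) co i / (p ^ i)%:R = 0).

Lemma prime_natrX_neq0 (K : numDomainType) n : (p ^ n)%:R != 0 :> K.
Proof. by rewrite pnatr_eq0 -lt0n expn_gt0 prime_gt0. Qed.

Lemma perm_divisors_pfactor m :
  perm_eq (divisors (p ^ m)) [seq (p ^ i)%N | i <- index_iota 0 m.+1].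
Proof.
apply: uniq_perm; first exact: divisors_uniq.
  rewrite map_inj_uniq ?iota_uniq// => i j /eqP.
  by rewrite eqn_exp2l ?prime_gt1// => /eqP.
move=> d; rewrite -dvdn_divisors ?expn_gt0 ?prime_gt0//.
apply/(dvdn_pfactor _ _ p_prime)/mapP => -[i im ->]; exists i => //.
  by rewrite mem_index_iota.
by move: im; rewrite mem_index_iota.
Qed.

Lemma sum_divisors_pfactor (V : nmodType) m (F : nat -> V) :
  \sum_(d <- divisors (p ^ m)) F d = \sum_(0 <= i < m.+1) F (p ^ i)%N.
Proof. by rewrite (perm_big _ (perm_divisors_pfactor m)) big_map. Qed.

Lemma sum_proper_divisors_pfactor (V : nmodType) m (F : nat -> V) :
  \sum_(d <- [seq d <- divisors (p ^ m) | (1 < d)%N]) F d =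
  \sum_(0 <= i < m) F (p ^ i.+1)%N.
Proof.
rewrite big_filter big_mkcond sum_divisors_pfactor big_nat_recl//= add0r.
by apply: eq_bigr => i _; rewrite ifT// -(expn0 p) ltn_exp2l// prime_gt1.
Qed.

Lemma sum_weight2 m (c : nat -> rat) (E : nat -> R[i]) :
  \sum_(0 <= i < m) ratr (c i) * (E 0%N - (p ^ i.+1)%:R * E i.+1) =
  ratr (\sum_(0 <= i < m) c i) * E 0%N +
  \sum_(0 <= i < m) ratr (- ((p ^ i.+1)%:R * c i)) * E i.+1.
Proof.
rewrite rmorph_sum mulr_suml -big_split /=; apply: eq_bigr => i _.
by rewrite rmorphN rmorphM /= ratr_nat; ring.
Qed.

Lemma eis_space2P m f :
  eis_space 2 (p ^ m) f <-> exists co, eis_combination m 2 co f.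
Proof.
rewrite /eis_space eqxx; split=> [[c fE]|[co [fE quasi]]].
  exists (fun i => if i is 0 then \sum_(0 <= j < m) c (p ^ j.+1)%N
                   else - ((p ^ i)%:R * c (p ^ i)%N)).
  split=> [z z0|_].
    rewrite fE// sum_proper_divisors_pfactor big_nat_recl//= expn0 mul1r.
    have := sum_weight2 m (fun i => c (p ^ i.+1)%N)
      (fun i => eisenstein 2 ((p ^ i)%:R * z)).
    by rewrite /= expn0 mul1r.
  rewrite big_nat_recl//= expn0 divr1 -big_split /= big1// => i _.
  by rewrite mulNr mulrAC divff ?prime_natrX_neq0// mul1r subrr.
pose c (d : nat) := - (co (logn p d) / d%:R).
have cE i : c (p ^ i)%N = - (co i / (p ^ i)%:R) by rewrite /c pfactorK.
exists c => z z0; rewrite fE// sum_proper_divisors_pfactor big_nat_recl//=.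
have := sum_weight2 m (fun i => c (p ^ i.+1)%N)
  (fun i => eisenstein 2 ((p ^ i)%:R * z)).
rewrite /= expn0 mul1r => ->; congr (ratr _ * _ + _).
  have := quasi erefl; rewrite big_nat_recl//= expn0 divr1 => /eqP.
  rewrite addr_eq0 => /eqP ->; rewrite -sumrN.
  by apply: eq_bigr => i _; rewrite cE.
apply: eq_bigr => i _; congr (ratr _ * _).
by rewrite cE mulrN opprK mulrC divfK// prime_natrX_neq0.
Qed.

Lemma eis_spaceP m k f :
  eis_space k (p ^ m) f <-> exists co, eis_combination m k co f.
Proof.
have [->|k2] := eqVneq k 2%N; first exact: eis_space2P.
rewrite /eis_space (negbTE k2); split=> [[c fE]|[co [fE _]]].
  exists (fun i => c (p ^ i)%N); split=> [z z0|k2']; last by rewrite k2' in k2.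
  by rewrite (fE z z0) sum_divisors_pfactor.
exists (fun d => co (logn p d)) => z z0; rewrite (fE z z0) sum_divisors_pfactor.
by apply: eq_bigr => i _; rewrite pfactorK.
Qed.

Lemma eis_combination_last0 m k co f : co m.+1 = 0 ->
  eis_combination m.+1 k co f -> eis_combination m k co f.
Proof.
move=> co0 [fE quasi]; split=> [z z0|k2].
  by rewrite (fE z z0) (big_nat_recr m.+1)//= co0 rmorph0 mul0r addr0.
by have := quasi k2; rewrite big_nat_recr//= co0 mul0r addr0.
Qed.

Lemma eis_combination_first0 m k co f : co 0%N = 0 ->
  eis_combination m.+1 k co f ->
  exists2 g, eis_combination m k (co \o succn) g &
  forall z, upper_half_plane z -> f z = g (p%:R * z).
Proof.
move=> co0 [fE quasi].
exists (fun w => \sum_(0 <= i < m.+1)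
    ratr (co i.+1) * eisenstein k ((p ^ i)%:R * w)).
  split=> // k2; have := quasi k2; rewrite big_nat_recl//= co0 mul0r add0r.
  under eq_bigr do rewrite expnS natrM invfM mulrCA.
  rewrite -mulr_sumr => /eqP; rewrite mulf_eq0 invr_eq0 pnatr_eq0.
  by rewrite gtn_eqF ?prime_gt0//= => /eqP.
move=> z z0; rewrite (fE z z0) (big_nat_recl m.+1)//= co0 rmorph0 mul0r add0r.
by apply: eq_bigr => i _; rewrite expnSr natrM mulrA.
Qed.

Lemma prim_eis_coefs m k f : prim_eis k (p ^ m) f -> exists2 co,
  eis_combination m k co f & (0 < m)%N -> co 0%N != 0 /\ co m != 0.
Proof.
move=> [/eis_spaceP[co comb] f_new]; exists co => //.
case: m comb f_new => // m comb f_new _.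
have old_level : [/\ (1 < p)%N, (p %| p ^ m.+1)%N & (p ^ m.+1 %/ p = p ^ m)%N].
  by rewrite prime_gt1// expnS dvdn_mulr// mulKn// prime_gt0.
have [p1 p_dvd divE] := old_level.
split; apply/eqP => co0; apply: f_new; exists p; split=> //; rewrite divE.
  have [g comb_g fg] := eis_combination_first0 co0 comb.
  by right; exists g => //; apply/eis_spaceP; exists (co \o succn).
by left; apply/eis_spaceP; exists co; exact: eis_combination_last0.
Qed.

End EisensteinCombinations.

Section CuspExpansions.
Context {R : realType}.
Variables (p m l : nat) (co : nat -> rat).
Hypothesis p_prime : prime p.
Local Notation k := l.+1.*2.
Implicit Types (f : R[i] -> R[i]) (z : R[i]) (e i n : nat) (B : nat -> nat).

Lemma ratr_natX n j : ratr (n%:R ^+ j) = n%:R ^+ j :> R[i].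
Proof. by rewrite rmorphXn /= ratr_nat. Qed.

Lemma cusp_factor (c d : int) e i : coprimez c d -> cusp_level p m c e ->
  (i <= m)%N -> exists2 b : nat, ((e < i)%N -> (0 < e)%N -> ~~ (p %| b)%N) &
  exists c' d' : int, c = (p ^ minn i e)%:Z * c' /\
    c' * b%:Z + (p ^ (i - e))%:Z * d' = d.
Proof.
move=> cd level im; have [em cE _] := (cusp_levelP m p_prime _ _).1 level.
have [[s t] /= bezout] := coprimezP _ _ (cusp_unit_coprime p_prime level im).
set u := cusp_unit _ _ _ in cE bezout; set D := (p ^ (i - e))%N in bezout *.
pose x := (s * d %% D%:Z)%Z; pose q := (s * d %/ D%:Z)%Z.
have D0 : D%:Z != 0 by exact: prime_expz_neq0.
have x0 : 0 <= x by exact: modz_ge0.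
have sdE : s * d = q * D%:Z + x by exact: divz_eq.
have dE : u * x + D%:Z * (t * d + u * q) = d.
  by rewrite -[RHS]mul1r -bezout mulrDl mulrAC sdE; ring.
exists (absz x) => [ei e0|]; last first.
  exists ((p ^ (e - minn i e))%:Z * u), (t * d + u * q).
  rewrite mulrA -PoszM -expnD subnKC ?geq_minr// gez0_abs//; split=> //.
  have [ie|ei] := leqP i e; last by rewrite subnn mul1r.
  have x_eq0 : x = 0 by rewrite /x /D (eqP ie) modz1.
  by move: dE; rewrite x_eq0 !mulr0.
apply/negP => px.
have pD : (p %| D)%N by rewrite /D -{1}(expn1 p) dvdn_exp2l// subn_gt0.
have pd : (p %| d)%Z.
  by rewrite -dE rpredD//; [apply: dvdz_mull|apply: dvdz_mulr]; rewrite dvdzE.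
have pc : (p %| c)%Z.
  by rewrite cE dvdz_mulr// dvdzE /= -{1}(expn1 p) dvdn_exp2l.
have : (p%:Z %| gcdz c d)%Z by rewrite dvdz_gcd pc pd.
by rewrite (eqP cd) dvdzE /= dvdn1 gtn_eqF ?prime_gt1.
Qed.

(* p ^ local_exponent is p ^ min(i, e) h / p ^ (i - e), where h is the width of
   the cusp. *)
Definition local_exponent e i : nat := (m - e.*2 + minn i e - (i - e))%N.

Definition cusp_coef e B n : R[i] :=
  \sum_(0 <= i < m.+1) ratr (co i) * ((p ^ (i - e))%:R ^- k *
    eis_coef k (p ^ local_exponent e i) (nome ((B i)%:R / (p ^ (i - e))%:R)) n).

Definition triangular_point e B i z : R[i] :=
  ((p ^ minn i e)%:R * z + (B i)%:R) / (p ^ (i - e))%:R.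

Lemma upper_triangular_point e B i z :
  upper_half_plane z -> upper_half_plane (triangular_point e B i z).
Proof.
move=> z0; apply: upper_divn; first by rewrite expn_gt0 prime_gt0.
by apply/upperD_nat/upper_mulnl => //; rewrite expn_gt0 prime_gt0.
Qed.

Lemma nome_triangular_point e B i z : (e <= m)%N -> (i <= m)%N ->
  nome (triangular_point e B i z) = nome ((B i)%:R / (p ^ (i - e))%:R) *
    nome (z / (p ^ (m - e.*2))%:R) ^+ (p ^ local_exponent e i).
Proof.
move=> em im; rewrite -nomeMn -nomeD; congr nome.
rewrite /triangular_point mulrDl addrC; congr (_ + _).
have exponents : (p ^ minn i e * p ^ (m - e.*2) =
    p ^ local_exponent e i * p ^ (i - e))%N.
  by rewrite -!expnD; congr expn; rewrite /local_exponent; lia.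
have D_neq0 := @prime_natrX_neq0 p p_prime R[i] (i - e).
have h_neq0 := @prime_natrX_neq0 p p_prime R[i] (m - e.*2).
apply: (mulIf D_neq0); rewrite divfK//; apply: (mulIf h_neq0).
by rewrite mulrAC -natrM exponents natrM; field.
Qed.

Definition triangular_offsets e (c d : int) B : Prop := forall i, (i <= m)%N ->
  ((e < i)%N -> (0 < e)%N -> ~~ (p %| B i)%N) /\
  exists c' d' : int, c = (p ^ minn i e)%:Z * c' /\
    c' * (B i)%:Z + (p ^ (i - e))%:Z * d' = d.

Lemma triangular_offsets_ex e (c d : int) : coprimez c d ->
  cusp_level p m c e -> exists B, triangular_offsets e c d B.
Proof.
move=> cd level; suff /choice[B BP] : forall i, exists b : nat, (i <= m)%N ->
    ((e < i)%N -> (0 < e)%N -> ~~ (p %| b)%N) /\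
    exists c' d' : int, c = (p ^ minn i e)%:Z * c' /\
      c' * b%:Z + (p ^ (i - e))%:Z * d' = d by exists B.
move=> i; have [im|_] := leqP i m; last by exists 0%N.
by have [b b_ndvd factor] := cusp_factor cd level im; exists b.
Qed.

Lemma slash_eis_combination f g e B z : eis_combination p m k co f -> SL2Z g ->
  triangular_offsets e (g 1 0) (g 1 1) B -> upper_half_plane z ->
  slash k f g z = \sum_(0 <= i < m.+1) ratr (co i) *
    ((p ^ (i - e))%:R ^- k * eisenstein k (triangular_point e B i z)).
Proof.
rewrite /SL2Z /= det_mx22 => -[fE quasi] det BP z0.
rewrite /slash fE; last exact: upper_SL2.
set j := (g 1 0)%:~R * z + (g 1 1)%:~R.
set gz := _ / j; set E := fun i => eisenstein k (triangular_point e B i z).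
have term i : (0 <= i < m.+1)%N ->
    j ^- k * (ratr (co i) * eisenstein k ((p ^ i)%:R * gz)) =
    ratr (co i) * ((p ^ (i - e))%:R ^- k * E i) -
    quasi_coef k * ((g 1 0)%:~R / j) * (ratr (co i) / (p ^ i)%:R).
  move=> /andP[_ im]; have [_ [c' [d' [cE dE]]]] := BP i im.
  have -> : (p ^ i = p ^ minn i e * p ^ (i - e))%N.
    by rewrite -expnD; congr expn; lia.
  rewrite mulrCA (eisenstein_slash l _ _ det cE dE z0) ?expn_gt0 ?prime_gt0//.
  rewrite -/j -/(triangular_point e B i z) -/(E i) mulrBr.
  by congr (_ - _); ring.
rewrite mulr_sumr [LHS](eq_big_nat _ _ term) sumrB -mulr_sumr.
rewrite -[RHS]subr0; congr (_ - _).
have [k2|k2] := eqVneq k 2%N; last by rewrite /quasi_coef (negbTE k2) !mul0r.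
rewrite (_ : \sum_(0 <= i < m.+1) _ =
    ratr (\sum_(0 <= i < m.+1) co i / (p ^ i)%:R)).
  by rewrite quasi// rmorph0 mulr0.
by rewrite rmorph_sum; apply: eq_bigr => i _; rewrite fmorph_div /= ratr_nat.
Qed.

Lemma cusp_expansion_eis_combination f g e B : eis_combination p m k co f ->
  SL2Z g -> cusp_level p m (g 1 0) e ->
  triangular_offsets e (g 1 0) (g 1 1) B ->
  cusp_expansion (p ^ m) k f g (cusp_coef e B).
Proof.
move=> comb sg level BP; have [em _ _] := (cusp_levelP m p_prime _ _).1 level.
exists (p ^ (m - e.*2))%N; first exact: cusp_width_level.
move=> z z0; apply: ccvgE; rewrite (slash_eis_combination comb sg BP z0).
set q := nome _; rewrite -[ccvg _ _]/(csum _ _).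
have termwise i : i \in index_iota 0 m.+1 ->
    csum (fun n => ratr (co i) * ((p ^ (i - e))%:R ^- k *
      (eis_coef k (p ^ local_exponent e i)
         (nome ((B i)%:R / (p ^ (i - e))%:R)) n * q ^+ n)))
    (ratr (co i) *
      ((p ^ (i - e))%:R ^- k * eisenstein k (triangular_point e B i z))).
  rewrite mem_index_iota => /andP[_ im]; apply/csumZ/csumZ/csum_eis_coef.
  - by rewrite expn_gt0 prime_gt0.
  - exact: upper_triangular_point.
  - exact: nome_triangular_point.
apply: eq_csum (csum_sum termwise) => n; rewrite /cusp_coef mulr_suml.
by apply: eq_bigr => i _; rewrite !mulrA.
Qed.

Definition constant_sum e : rat :=
  \sum_(0 <= i < m.+1) co i / (p ^ (i - e))%:R ^+ k.

Lemma constant_sum_neq0_ex : co m != 0 ->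
  exists2 e, (e <= m)%N & constant_sum e != 0.
Proof.
move=> co_last; have [Sm|] := eqVneq (constant_sum m) 0; last by exists m.
exists m.-1; first exact: leq_pred.
apply: contra_neq co_last => Sm1; have [m0|m0] := posnP m.
  by move: Sm; rewrite /constant_sum m0 big_nat1 expn0 expr1n divr1.
have mB : (m - m.-1 = 1)%N by lia.
have diff : constant_sum m - constant_sum m.-1 = co m * (1 - p%:R ^- k).
  rewrite /constant_sum !big_nat_recr//= subnn expn0 expr1n divr1 mB expn1.
  rewrite (@eq_big_nat _ _ _ 0 m _ (fun i => co i / (p ^ (i - m.-1))%:R ^+ k)).
    by ring.
  by move=> i im; rewrite (_ : i - m = i - m.-1)%N//; lia.
move/eqP: diff; rewrite Sm Sm1 subrr eq_sym mulf_eq0 => /orP[/eqP//|].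
rewrite subr_eq0 eq_sym invr_eq1 => /eqP pk1.
have : (1 : rat) < p%:R ^+ k by rewrite exprn_egt1// ltr1n prime_gt1.
by rewrite pk1 ltxx.
Qed.

Lemma cusp_coef0 e B :
  cusp_coef e B 0%N = ratr (constant_sum e) * eis_const k.
Proof.
rewrite /cusp_coef rmorph_sum mulr_suml; apply: eq_bigr => i _.
by rewrite /eis_coef eqxx fmorph_div /= ratr_natX mulrA.
Qed.

Lemma cusp_coef1 e B : cusp_coef e B 1%N =
  \sum_(0 <= i < m.+1) (if local_exponent e i == 0%N then
    ratr (co i) * ((p ^ (i - e))%:R ^- k * nome ((B i)%:R / (p ^ (i - e))%:R))
    else 0).
Proof.
apply: eq_bigr => i _; rewrite /eis_coef /= dvdn1.
have -> : (p ^ local_exponent e i == 1)%N = (local_exponent e i == 0)%N.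
  by rewrite -(expn0 p) eqn_exp2l// prime_gt1.
case: ifP => [/eqP ->|_]; last by rewrite !mulr0.
by rewrite expn0 divn1 sigma1n mul1r expr1.
Qed.

Lemma cusp_coef1_low e B : (e.*2 < m)%N -> cusp_coef e B 1%N =
  ratr (co m) * ((p ^ (m - e))%:R ^- k * nome ((B m)%:R / (p ^ (m - e))%:R)).
Proof.
move=> e2m; rewrite cusp_coef1 big_nat_recr//= big_nat big1 ?add0r => [|i im].
  by rewrite ifT//; rewrite /local_exponent; lia.
by rewrite ifF//; rewrite /local_exponent; lia.
Qed.

Lemma cusp_coef1_high e B : (e <= m)%N -> (m < e.*2)%N ->
  cusp_coef e B 1%N = ratr (co 0%N).
Proof.
move=> em me2.
rewrite cusp_coef1 big_nat_recl//= big_nat big1 ?addr0 => [|i im].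
  rewrite ifT; last by rewrite /local_exponent; lia.
  by rewrite sub0n expn0 expr1n !invr1 mul1r !mulr1 nome_nat mulr1.
by rewrite ifF//; rewrite /local_exponent; lia.
Qed.

Lemma cusp_coef1_mid e B : (0 < e)%N -> m = e.*2 -> cusp_coef e B 1%N =
  ratr (co 0%N) +
  ratr (co m) * ((p ^ e)%:R ^- k * nome ((B m)%:R / (p ^ e)%:R)).
Proof.
move=> e0 mE; have m0 : (0 < m)%N by lia.
rewrite cusp_coef1 big_nat_recr//= big_ltn//= big_nat big1 ?addr0 => [|i im].
  rewrite ifT; last by rewrite /local_exponent; lia.
  rewrite ifT; last by rewrite /local_exponent; lia.
  rewrite sub0n expn0 expr1n !invr1 mul1r !mulr1 nome_nat mulr1.
  by rewrite (_ : m - e = e)%N//; lia.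
by rewrite ifF//; rewrite /local_exponent; lia.
Qed.

Hypothesis co_first : co 0%N != 0.
Hypothesis co_last : co m != 0.

Lemma cusp_coef1_mid_neq0 e B : (0 < e)%N -> m = e.*2 -> (p ^ m)%N != 4%N ->
  ~~ (p %| B m)%N -> cusp_coef e B 1%N != 0.
Proof.
move=> e0 mE pm4 pB.
have pe_neq0 : (p ^ e)%:R ^+ k != 0 :> R[i].
  by rewrite expf_neq0// prime_natrX_neq0.
have com_neq0 : ratr (co m) != 0 :> R[i] by rewrite fmorph_eq0.
rewrite cusp_coef1_mid//; apply/eqP => coef0.
have : nome ((B m)%:R / (p ^ e)%:R) =
    ((ratr (- (co 0%N * (p ^ e)%:R ^+ k / co m)))%:C)%C :> R[i].
  rewrite fmorph_rat rmorphN fmorph_div rmorphM /= ratr_natX.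
  move/eqP: coef0; rewrite addr_eq0 => /eqP ->.
  move: (nome _) ((p ^ e)%:R ^+ k) pe_neq0 => x y y0.
  by field; rewrite y0 com_neq0.
move/nome_frac_real; rewrite expn_gt0 prime_gt0//= => /(_ isT).
rewrite Gauss_dvdl; last by rewrite coprimeXl// prime_coprime.
move=> pe2; have p2 : p = 2%N.
  have : (p %| 2)%N by apply: dvdn_trans pe2; rewrite -{1}(expn1 p) dvdn_exp2l.
  by rewrite dvdn_prime2// => /eqP.
have e1 : e = 1%N.
  have := dvdn_leq (isT : 0 < 2)%N pe2.
  by rewrite p2 -{2}(expn1 2) leq_exp2l//; lia.
by move: pm4; rewrite p2 mE e1.
Qed.

Lemma cusp_coef1_neq0 e B (c d : int) : (0 < m)%N -> (e <= m)%N ->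
  (m = e.*2 -> (p ^ m)%N != 4%N) -> triangular_offsets e c d B ->
  cusp_coef e B 1%N != 0.
Proof.
move=> m0 em pm4 BP; have [e2m|me2|e2m] := ltngtP e.*2 m.
- rewrite cusp_coef1_low// mulf_neq0 ?fmorph_eq0// mulf_neq0 ?nome_neq0//.
  by rewrite invr_neq0// expf_neq0// prime_natrX_neq0.
- by rewrite cusp_coef1_high// fmorph_eq0.
apply: cusp_coef1_mid_neq0; [lia|by []|exact: pm4|].
by have [B_ndvd _] := BP m (leqnn m); apply: B_ndvd; lia.
Qed.

End CuspExpansions.

Section SumsOfOrders.
Context {R : realType}.

Lemma lee_sum_nat (T : eqType) (rs : seq T) (F : T -> \bar R) (o : T -> nat) :
  (forall r, r \in rs -> (F r <= (o r)%:R%:E)%E) ->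
  (\sum_(r <- rs) F r <= (\sum_(r <- rs) o r)%N%:R%:E)%E.
Proof.
elim: rs => [|r rs IHrs] F_le; first by rewrite !big_nil.
rewrite !big_cons natrD EFinD leeD ?F_le ?mem_head// IHrs// => s srs.
by apply: F_le; rewrite in_cons srs orbT.
Qed.

Lemma lte_sum_size (T : eqType) (rs : seq T) (F : T -> \bar R) (r0 : T) :
  (forall r, r \in rs -> (F r <= 1%:R%:E)%E) ->
  r0 \in rs -> (F r0 <= 0%:R%:E)%E ->
  (\sum_(r <- rs) F r < (size rs)%:R%:E)%E.
Proof.
move=> F_le1 r0rs F0.
apply: (@le_lt_trans _ _ (\sum_(r <- rs) (r != r0))%N%:R%:E).
  apply: lee_sum_nat => r rrs.
  by case: eqVneq => [->|_]; [exact: F0|exact: F_le1].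
rewrite lte_fin ltr_nat -(count_predC (pred1 r0)).
rewrite (_ : (\sum_(r <- rs) (r != r0))%N = count (predC (pred1 r0)) rs).
  by rewrite -[X in (X < _)%N]add0n ltn_add2r -has_count has_pred1.
rewrite -sum1_count [RHS]big_mkcond; apply: eq_bigr => r _ /=.
by case: (r == r0).
Qed.

End SumsOfOrders.

Section CuspOrders.
Context {R : realType}.
Variables (p m l : nat) (co : nat -> rat) (f : R[i] -> R[i]).
Local Notation k := l.+1.*2.
Local Notation order := (cusp_order (p ^ m) k f).
Hypothesis p_prime : prime p.
Hypothesis f_comb : eis_combination p m k co f.
Implicit Types (r : cusp) (e n : nat).

Lemma cusp_order_le_nonzero_coef r e n : cusp_at_level p m r e ->
  (forall c d B, triangular_offsets p m e c d B ->
     cusp_coef p m l co e B n != 0 :> R[i]) ->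
  (order r <= n%:R%:E)%E.
Proof.
move=> [g [sg <-] level] coef_neq0.
have [B BP] := triangular_offsets_ex p_prime (SL2Z_coprime sg) level.
apply: ereal_inf_lbound; exists n => //=; exists g, (cusp_coef p m l co e B).
split=> //; last exact: coef_neq0 BP.
exact: cusp_expansion_eis_combination.
Qed.

Lemma cusp_order_le0 r e : cusp_at_level p m r e ->
  constant_sum p m l co e != 0 -> (order r <= 0%:R%:E)%E.
Proof.
move=> r_e Se; apply: (cusp_order_le_nonzero_coef r_e) => c d B _.
by rewrite cusp_coef0 mulf_neq0 ?eis_const_neq0// fmorph_eq0.
Qed.

Lemma sum_cusp_order_le0 (rs : seq cusp) :
  (forall e, constant_sum p m l co e != 0) -> cusp_representatives (p ^ m) rs ->
  (\sum_(r <- rs) order r <= 0%:R%:E)%E.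
Proof.
move=> S_neq0 reps.
have [K [K_level _ _]] := cusp_representatives_invariants p_prime reps.
have order_le0 r : r \in rs -> (order r <= 0%:R%:E)%E.
  by move=> _; exact: cusp_order_le0 (K_level r) (S_neq0 _).
by apply: le_trans (lee_sum_nat order_le0) _; rewrite big1.
Qed.

Hypothesis co_first : co 0%N != 0.
Hypothesis co_last : co m != 0.

Lemma cusp_order_le1 r e : (0 < m)%N -> cusp_at_level p m r e ->
  (m = e.*2 -> (p ^ m)%N != 4%N) -> (order r <= 1%:R%:E)%E.
Proof.
move=> m0 r_e pm4; apply: (cusp_order_le_nonzero_coef r_e) => c d B BP.
have [g _ /(cusp_levelP m p_prime)[em _ _]] := r_e.
exact: cusp_coef1_neq0 BP.
Qed.

Lemma cusp_order0_ex (rs : seq cusp) : cusp_representatives (p ^ m) rs ->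
  exists2 r, r \in rs & (order r <= 0%:R%:E)%E.
Proof.
move=> reps; have [e em Se] := constant_sum_neq0_ex l p_prime co_last.
have [r rrs r_e] := cusp_representative_at_level em reps.
by exists r => //; exact: cusp_order_le0 r_e Se.
Qed.

Lemma sum_cusp_order_lt_size (rs : seq cusp) : (0 < m)%N -> (p ^ m)%N != 4%N ->
  cusp_representatives (p ^ m) rs ->
  (\sum_(r <- rs) order r < (size rs)%:R%:E)%E.
Proof.
move=> m0 pm4 reps.
have [K [K_level _ _]] := cusp_representatives_invariants p_prime reps.
have [r0 r0rs order_r0] := cusp_order0_ex reps.
apply: lte_sum_size r0rs order_r0 => r _.
exact: cusp_order_le1 m0 (K_level r) _.
Qed.

End CuspOrders.

(* At level 4 the coefficient of q may vanish at the cusp 1/2. If the constant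
   term vanishes there too, f is known up to a scalar. *)
Section LevelFour.
Context {R : realType}.
Variables (l : nat) (co : nat -> rat) (f : R[i] -> R[i]).
Local Notation k := l.+1.*2.
Local Notation order := (cusp_order (2 ^ 2) k f).
Hypothesis f_comb : eis_combination 2 2 k co f.
Hypothesis co_first : co 0%N != 0.
Hypothesis co_last : co 2%N != 0.
Implicit Types (r : cusp) (e : nat) (B : nat -> nat) (c d : int).

Lemma nome_half (b : nat) : odd b -> nome (b%:R / 2) = -1 :> R[i].
Proof.
move=> b_odd; have : nome (b%:R / 2) ^+ 2 - 1 = 0 :> R[i].
  by rewrite -nomeMn mulrC divfK ?pnatr_eq0// nome_nat subrr.
move/eqP; rewrite subr_sqr_1 mulf_eq0 subr_eq0 nome_frac_eq1// dvdn2 b_odd /=.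
by rewrite addr_eq0 => /eqP.
Qed.

Definition degenerate : bool :=
  (co 2%N == co 0%N * 2 ^+ k) && (co 1%N == - (2 * co 0%N)).

Lemma constant_sum_four e : constant_sum 2 2 l co e = co 0%N +
  co 1%N / (2 ^ (1 - e))%:R ^+ k + co 2%N / (2 ^ (2 - e))%:R ^+ k.
Proof.
rewrite /constant_sum big_nat_recr//= big_nat_recr//= big_nat1.
by rewrite sub0n expn0 expr1n divr1.
Qed.

Lemma offsets_four_odd c d B : triangular_offsets 2 2 1 c d B -> odd (B 2).
Proof.
move=> /(_ 2 isT)[B_odd _].
by rewrite -[odd _]negbK -dvdn2; exact: B_odd.
Qed.

Lemma cusp_coef1_four c d B : triangular_offsets 2 2 1 c d B ->
  cusp_coef 2 2 l co 1 B 1%N = ratr (co 0%N - co 2%N / 2 ^+ k) :> R[i].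
Proof.
move=> /offsets_four_odd B_odd; rewrite cusp_coef1_mid// expn1 nome_half//.
by rewrite rmorphB fmorph_div /= ratr_natX mulrN1 mulrN.
Qed.

Lemma sigma_two j : sigma j 2 = (1 + 2 ^ j)%N.
Proof.
rewrite /sigma (_ : divisors 2 = [:: 1; 2]%N)//.
by rewrite !big_cons big_nil exp1n addn0.
Qed.

Lemma cusp_coef2_four c d B : triangular_offsets 2 2 1 c d B ->
  cusp_coef 2 2 l co 1 B 2%N = ratr (co 0%N * (1 + 2 ^+ l.*2.+1) + co 1%N +
    co 2%N / 2 ^+ k * (1 + 2 ^+ l.*2.+1)) :> R[i].
Proof.
move=> /offsets_four_odd B_odd.
have coef_level1 (xi : R[i]) :
    eis_coef k (2 ^ 0) xi 2 = (1 + 2 ^+ l.*2.+1) * xi ^+ 2.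
  by rewrite /eis_coef /= sigma_two natrD natrX.
have coef_level2 (xi : R[i]) : eis_coef k (2 ^ 1) xi 2 = xi.
  by rewrite /eis_coef /= sigma1n mul1r.
rewrite /cusp_coef big_nat_recr//= big_nat_recr//= big_nat1.
rewrite (_ : local_exponent 2 1 0 = 0)%N// (_ : local_exponent 2 1 1 = 1)%N//.
rewrite (_ : local_exponent 2 1 2 = 0)%N// !coef_level1 coef_level2.
rewrite sub0n subnn expn1 expn0 nome_half// !divr1 !nome_nat sqrrN !expr1n.
rewrite invr1 !mul1r !mulr1 !(rmorphD, rmorphM, fmorphV) /=.
by rewrite !ratr_natX rmorph1 mulrA.
Qed.

Lemma cusp_order_nondegenerate r e : ~~ degenerate ->
  cusp_at_level 2 2 r e -> (order r <= 1%:R%:E)%E.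
Proof.
move=> nondeg r_e; have [e1|e1] := eqVneq e 1%N; last first.
  apply: (cusp_order_le1 _ f_comb co_first co_last _ r_e) => // e2.
  by move: e1; lia.
rewrite e1 in r_e; have k_neq0 : 2 ^+ k != 0 :> rat by rewrite expf_neq0.
have [S1|S1] := eqVneq (constant_sum 2 2 l co 1) 0; last first.
  by apply: le_trans (cusp_order_le0 _ f_comb r_e S1) _.
apply: (cusp_order_le_nonzero_coef _ f_comb r_e) => // c d B BP.
rewrite (cusp_coef1_four BP) fmorph_eq0; apply: contraNneq nondeg => coef0.
have co2E : co 2%N = co 0%N * 2 ^+ k.
  by move/eqP: coef0; rewrite subr_eq0 => /eqP ->; rewrite divfK.
rewrite /degenerate co2E eqxx /=; move: S1.
rewrite constant_sum_four subnn expn0 expr1n divr1 co2E mulfK// => S1.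
by apply/eqP/(addrI (co 0%N))/(addIr (co 0%N)); rewrite S1; ring.
Qed.

Lemma cusp_order_degenerate_mid r : degenerate ->
  cusp_at_level 2 2 r 1 -> (order r <= 2%:R%:E)%E.
Proof.
move=> /andP[/eqP co2E /eqP co1E] r_1.
have k_neq0 : 2 ^+ k != 0 :> rat by rewrite expf_neq0.
apply: (cusp_order_le_nonzero_coef _ f_comb r_1) => // c d B BP.
rewrite (cusp_coef2_four BP) fmorph_eq0 co2E co1E mulfK//.
have -> : co 0%N * (1 + 2 ^+ l.*2.+1) + - (2 * co 0%N) +
    co 0%N * (1 + 2 ^+ l.*2.+1) = co 0%N * 2 ^+ k.
  by rewrite doubleS (exprS 2 l.*2.+1); ring.
by rewrite mulf_neq0.
Qed.

Lemma cusp_order_degenerate_ends r e : degenerate -> e != 1%N ->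
  cusp_at_level 2 2 r e -> (order r <= 0%:R%:E)%E.
Proof.
move=> /andP[/eqP co2E /eqP co1E] e1 r_e.
have [g _ /(cusp_levelP 2 (isT : prime 2))[e2 _ _]] := r_e.
apply: (cusp_order_le0 _ f_comb r_e) => //; rewrite constant_sum_four co2E co1E.
have k_neq0 : 2 ^+ k != 0 :> rat by rewrite expf_neq0.
have k_neq1 : (2 ^+ k : rat) - 1 != 0.
  by rewrite subr_eq0 gt_eqF// exprn_egt1// ltr1n.
have [-> |->] : e = 0%N \/ e = 2%N by lia.
  rewrite !subn0 expn1 (_ : (2 ^ 2)%:R ^+ k = 2 ^+ k * 2 ^+ k :> rat).
    rewrite (_ : _ + _ = co 0%N * (2 ^+ k - 1) / 2 ^+ k).
      by rewrite !mulf_neq0 ?invr_neq0.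
    by move: (2 ^+ k) k_neq0 => y y0; field.
  by rewrite -exprMn -natrM.
rewrite subnn -[(1 - 2)%N]/0%N expn0 expr1n !divr1.
by rewrite (_ : _ + _ = co 0%N * (2 ^+ k - 1)); [rewrite mulf_neq0|ring].
Qed.

Lemma sum_cusp_order_four (rs : seq cusp) : cusp_representatives (2 ^ 2) rs ->
  (\sum_(r <- rs) order r < 4%:R%:E)%E.
Proof.
move=> reps; have [uniq_rs _ _] := reps.
have prime2 : prime 2 by [].
have [K [K_level K_inv Kinj]] := cusp_representatives_invariants prime2 reps.
have [deg|nondeg] := boolP degenerate; last first.
  have order_le1 r : r \in rs -> (order r <= 1%:R%:E)%E.
    by move=> _; exact: cusp_order_nondegenerate (K_level r).
  apply: le_lt_trans (lee_sum_nat order_le1) _.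
  rewrite lte_fin ltr_nat sum1_size.
  have := cusp_representatives_size prime2 reps.
  by rewrite sum_totient_cusp_modulus.
have K_mid r : (K r).1 = 1%N -> K r = (1, 1)%N.
  have /allpairsPdep[e [x [_ + ->]]] /= := K_inv r => + e1.
  rewrite e1 mem_filter mem_iota /cusp_modulus /= => /andP[].
  by case: x => [|[|x]].
apply: (@le_lt_trans _ _ (2 * count_mem (1, 1)%N (map K rs))%:R%:E).
  rewrite -sum1_count big_map big_distrr /= [X in X%:R]big_mkcond /=.
  apply: lee_sum_nat => r _; have [e1|e1] := eqVneq (K r).1 1%N.
    rewrite K_mid// eqxx; have := K_level r; rewrite e1.
    exact: cusp_order_degenerate_mid.
  apply: le_trans (cusp_order_degenerate_ends deg e1 (K_level r)) _.
  by rewrite lee_fin ler_nat.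
rewrite lte_fin ltr_nat count_uniq_mem ?map_inj_in_uniq//.
by case: (_ \in _).
Qed.

End LevelFour.

Lemma order_boundE (p m : nat) : prime p -> (0 < m)%N -> (p ^ m)%N != 4%N ->
  order_bound p m = cusp_bound p m.
Proof.
move=> p_prime m0 pm4; rewrite /order_bound (negbTE pm4) ifF//.
by rewrite -(expn0 p) eqn_exp2l ?prime_gt1// gtn_eqF.
Qed.

Lemma expn_prime_eq4 (p m : nat) : prime p -> (p ^ m)%N = 4%N ->
  p = 2%N /\ m = 2%N.
Proof.
move=> p_prime pm4; have p2 : p = 2%N.
  have m0 : (0 < m)%N by case: m pm4.
  have : (p %| 2 ^ 2)%N by rewrite -[(2 ^ 2)%N]pm4 dvdn_exp.
  by rewrite Euclid_dvdX// dvdn_prime2// andbT => /eqP.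
by split=> //; apply/eqP; rewrite -(eqn_exp2l _ _ (isT : 1 < 2)%N) -{1}p2 pm4.
Qed.

Theorem theorem1p1 (R : realType) (p m k : nat) (f : R[i] -> R[i])
    (rs : seq cusp) (p_prime : prime p) (k_ge2 : (2 <= k)%N)
    (k_even : ~~ odd k) (f_prim : prim_eis k (p ^ m) f)
    (f_nonzero : exists2 z, upper_half_plane z & f z != 0)
    (rs_cusps : cusp_representatives (p ^ m) rs) :
  (\sum_(r <- rs) cusp_order (p ^ m) k f r < (order_bound p m)%:R%:E)%E.
Proof.
have [l kE] : exists l, k = l.+1.*2 by exists k./2.-1; lia.
subst k; have [co comb co_ends] := prim_eis_coefs p_prime f_prim.
have [m0|m0] := posnP m.
  subst m; have co0 : co 0%N != 0.
    have [z z0] := f_nonzero; have [-> // _] := comb.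
    by apply: contra_neq => co0; rewrite big_nat1 co0 rmorph0 mul0r.
  apply: le_lt_trans (sum_cusp_order_le0 p_prime comb _ rs_cusps) _ => [e|].
    by rewrite /constant_sum big_nat1 expn0 expr1n divr1.
  by rewrite lte_fin ltr_nat.
have [co_first co_last] := co_ends m0.
have [pm4|pm4] := eqVneq (p ^ m)%N 4%N.
  have [p2 m2] := expn_prime_eq4 p_prime pm4; subst p m.
  exact: sum_cusp_order_four comb co_first co_last _ rs_cusps.
have := sum_cusp_order_lt_size p_prime comb co_first co_last m0 pm4 rs_cusps.
move=> /lt_le_trans; apply; rewrite lee_fin ler_nat order_boundE//.
by rewrite -sum_totient_cusp_modulus//; exact: cusp_representatives_size.
Qed.
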